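(* Let $\mathcal D$ be a circular multiply connected domain satisfying Assumption A and with $\rho_a>0$. Then $$P_n(z)=z^n+\frac1n\sum_{j:|a_j|=\rho_a}a_j^{n+1}F_{j,n}(z)+O\left(\frac{\rho_a^n}{n^2}\right)$$ uniformly on closed subsets of $\overline{D(0,\rho_a)}\setminus\{a_j:|a_j|=\rho_a\}$ as $n\to\infty$, while for every $j$ with $|a_j|=\rho_a$, $$P_n(a_j)=\frac{a_j^n}{1-\sigma_j^2}+O\left(\frac{\rho_a^n}{n}\right)\quad\text{as } n\to\infty.$$
   Context: Notation: $D(c,r)=\{z\in\mathbb C:|z-c|<r\}$. ''Closed subsets'' of $\overline{D(0,\rho_a)}\setminus\{a_j:|a_j|=\rho_a\}$ means subsets of it that are closed in $\mathbb C$ (hence compact). A circular multiply connected domain (CMCD) is a domain $\mathcal D=D(0,1)\setminus\bigcup_{j=1}^s\overline{D(c_j,r_j)}$ with $s\ge1$, $r_j>0$, where the closed disks $\overline{D(c_j,r_j)}$ are contained in $D(0,1)$ and pairwise disjoint. Let $dA=\pi^{-1}dx\,dy$. For $n\ge0$, $P_n(z)=z^n+\cdots$ is the unique monic polynomial of degree $n$ with $\int_{\mathcal D}P_n(z)\overline{z^m}\,dA(z)=0$ for $0\le m\le n-1$. For each $j$ there is a unique pair $a_j\in D(0,1)$, $\sigma_j\in(0,1)$ such that $\Phi_j(z)=\frac{\overline{a_j}}{|a_j|}\frac{z-a_j}{1-\overline{a_j}z}$ maps $D(c_j,r_j)$ onto $D(0,\sigma_j)$ (if $a_j=0$, the factor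 $\overline{a_j}/|a_j|$ is read as $1$). Put $\rho_a=\max_j|a_j|$ and $T_j(z)=\Phi_j^{-1}(\sigma_j^2\Phi_j(z))$. Let $\mathcal T$ consist of the identity map and all finite compositions $T_{j_n}\cdots T_{j_1}$, $n\ge1$, $j_k\in\{1,\dots,s\}$. Assumption A: the series $\sum_{\tau\in\mathcal T}|\tau'(z)|$ converges locally uniformly on $D(0,\rho_a^{-1})$. ($\rho_a>0$ is equivalent to $c_j\ne0$ for some $j$.) For $\sigma\in(0,1)$ let $\Theta_\sigma(t)=t\sum_{v\in\mathbb Z}\sigma^ve^{\sigma^vt}$, $\Re t<0$. For $j$ with $|a_j|=\rho_a$ and $n\ge1$ let $$F_{j,n}(z)=\sum_{\tau\in\mathcal T\setminus\mathcal T_j}\frac{\Phi_j'(\tau(z))}{\Phi_j(\tau(z))}\,\Theta_{\sigma_j^2}\big(n\alpha_j\Phi_j(\tau(z))\big)\,\tau'(z),\qquad z\in\overline{D(0,\rho_a)}\setminus\{a_j\},$$ where $\alpha_j=|a_j|^{-1}-|a_j|$ and $\mathcal T_j=\{T_j\tau:\tau\in\mathcal T\}$ (here $T_j\tau=T_j\circ\tau$). *)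

(* Defs.v *)
From HB Require Import structures.
From mathcomp Require Import all_boot all_order all_algebra.
From mathcomp Require Import all_classical all_reals all_analysis.
From mathcomp Require Import showcase.summability.
From mathcomp Require Import complex ring.

Set Implicit Arguments.
Unset Strict Implicit.
Unset Printing Implicit Defensive.

Import Order.TTheory GRing.Theory Num.Theory.
Import numFieldNormedType.Exports.

Local Open Scope classical_set_scope.
Local Open Scope complex_scope.
Local Open Scope ring_scope.

(* [R[i]] with the topology of its modulus, as a normed module over itself, so
   that [derive1] on functions [R[i] -> R[i]] is the complex derivative. *)
HB.instance Definition _ (R : realType) := NormedModule.copy R[i] R[i]^o.

(* Real-valued modulus; the norm [`|z|] takes values in [R[i]]. *)
Notation cmod := ComplexField.Normc.normc.

Section Definitions.
Context {R : realType}.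
Local Notation C := R[i].

Definition disk (c : C) (r : R) : set C := [set z | cmod (z - c) < r].

Definition cexp (z : C) : C :=
  (expR (complex.Re z))%:C * (cos (complex.Im z) +i* sin (complex.Im z)).

(* Integral against dA = dx dy / pi. *)
Definition area_integral (D : set C) (f : C -> C) : C :=
  let mu := (lebesgue_measure \x lebesgue_measure)%E in
  let D' := [set p : measurableTypeR R * measurableTypeR R | D (p.1 +i* p.2)] in
  (pi^-1 * Rintegral mu D' (fun p => complex.Re (f (p.1 +i* p.2))))
  +i* (pi^-1 * Rintegral mu D' (fun p => complex.Im (f (p.1 +i* p.2)))).

(* Unordered sum over a set, i.e. the limit of the net of its finite partial
   sums. *)
Definition sum_over (T : choiceType) (A : set T) (f : T -> C) : C :=
  sum (fun x : A => f (val x)).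

Definition locally_uniformly_summable (T : choiceType) (A : set T)
    (f : T -> C -> R) (U : set C) : Prop :=
  exists S : C -> R, forall z, U z -> exists2 V, nbhs z V &
    {uniform V, (fun J w => partial_sum (fun x : A => f (val x) w) J) @ totally
                --> S}.

Definition is_cmcd (s : nat) (c : 'I_s -> C) (r : 'I_s -> R) : Prop :=
  [/\ (0 < s)%N,
      forall j, 0 < r j,
      forall j, closure (disk (c j) (r j)) `<=` disk 0 1
    & forall j k, j != k ->
        closure (disk (c j) (r j)) `&` closure (disk (c k) (r k)) = set0].

Definition cmcd (s : nat) (c : 'I_s -> C) (r : 'I_s -> R) : set C :=
  disk 0 1 `\` \bigcup_(j in [set: 'I_s]) closure (disk (c j) (r j)).

Definition monic_orthogonal (D : set C) (n : nat) (p : {poly C}) : Prop :=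
  [/\ p \is monic, size p = n.+1 &
      forall m, (m < n)%N ->
        area_integral D (fun z => p.[z] * (z ^+ m)^*) = 0].

Definition phase (a : C) : C := if a == 0 then 1 else a^* / (cmod a)%:C.

Definition Phi (a z : C) : C := phase a * ((z - a) / (1 - a^* * z)).

(* Inverse Moebius transformation of [Phi a], see [PhiK] and [PhiVK]. *)
Definition PhiV (a w : C) : C := (w + phase a * a) / (phase a + a^* * w).

Definition is_uniformizer (c : C) (r : R) (a : C) (sigma : R) : Prop :=
  [/\ disk 0 1 a, 0 < sigma < 1 & Phi a @` disk c r = disk 0 sigma].

Definition Theta (sigma : R) (t : C) : C :=
  t * sum (fun v : int => (sigma ^ v)%:C * cexp ((sigma ^ v)%:C * t) : C).

Section Family.
Variables (s : nat) (a : 'I_s -> C) (sigma : 'I_s -> R).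

Definition rho : R := \big[Num.max/0]_(j < s) cmod (a j).

(* Division by zero makes this total; all poles met, and the point 1/(a j)^*
   where [Phi (a j)] is infinite, have modulus at least 1/|a j| >= 1/rho. *)
Definition Tmap (j : 'I_s) (z : C) : C :=
  PhiV (a j) ((sigma j ^+ 2)%:C * Phi (a j) z).

(* The word [:: j_n; ...; j_1] stands for T_{j_n} \o ... \o T_{j_1}; since the
   result is a set of maps, a map given by several words is counted once. *)
Definition Tcal : set (C -> C) :=
  [set tau | exists w : seq 'I_s, tau = foldr (fun j f => Tmap j \o f) id w].

Definition Tcal_at (j : 'I_s) : set (C -> C) :=
  [set Tmap j \o tau | tau in Tcal].

Definition Tcal_derivatives_summable : Prop :=
  locally_uniformly_summable Tcal (fun tau z => cmod (derive1 tau z))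
    (disk 0 rho^-1).

Definition alpha (j : 'I_s) : R := (cmod (a j))^-1 - cmod (a j).

Definition F (j : 'I_s) (n : nat) (z : C) : C :=
  sum_over (Tcal `\` Tcal_at j) (fun tau =>
    derive1 (Phi (a j)) (tau z) / Phi (a j) (tau z)
    * Theta (sigma j ^+ 2) (n%:R * (alpha j)%:C * Phi (a j) (tau z))
    * derive1 tau z).

Definition singular_points : set C := [set a j | j in [set j | cmod (a j) = rho]].

End Family.

Lemma phase_neq0 (a : C) : phase a != 0.
Proof.
rewrite /phase; case: (eqVneq a 0) => [_|a0]; first exact: oner_neq0.
apply: mulf_neq0; first by rewrite conjc_eq0.
rewrite invr_eq0; apply: contra a0 => /eqP [e].
by apply/eqP/ComplexField.Normc.eq0_normc.
Qed.

Lemma disk_conj_neq0 (a : C) : disk 0 1 a -> 1 - a^* * a != 0.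
Proof.
rewrite /disk /= subr0 => h; rewrite subr_eq0; apply/eqP => e.
have : cmod (1 : C) = cmod (a^* * a) by rewrite e.
rewrite ComplexField.Normc.normcM ComplexField.Normc.normc1.
have -> : cmod a^* = cmod a by case: (a) => x y /=; rewrite sqrrN.
have a0 : 0 <= cmod a by case: (a) => x y; exact: sqrtr_ge0.
move=> h1; have : cmod a * cmod a < 1 by rewrite mulr_ilt1.
by rewrite -h1 ltxx.
Qed.

Lemma PhiK (a z : C) : disk 0 1 a -> 1 - a^* * z != 0 -> PhiV a (Phi a z) = z.
Proof.
move=> /disk_conj_neq0 ha hz; rewrite /PhiV /Phi.
have := phase_neq0 a; set e := phase a => he.
move: (a^*) ha hz => b ha hz.
have d0 : e * (1 - b * a) != 0 by exact: mulf_neq0.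
have -> : e * ((z - a) / (1 - b * z)) + e * a
    = z * (e * (1 - b * a) / (1 - b * z)) by field.
have -> : e + b * (e * ((z - a) / (1 - b * z)))
    = e * (1 - b * a) / (1 - b * z) by field.
by rewrite mulfK // mulf_neq0 // invr_eq0.
Qed.

Lemma PhiVK (a w : C) :
  disk 0 1 a -> phase a + a^* * w != 0 -> Phi a (PhiV a w) = w.
Proof.
move=> /disk_conj_neq0 ha hw; rewrite /PhiV /Phi.
have := phase_neq0 a; set e := phase a; move: hw; rewrite -/e => hw he.
move: (a^*) ha hw => b ha hw.
have -> : (w + e * a) / (e + b * w) - a = w * (1 - b * a) / (e + b * w).
  by field.
have -> : 1 - b * ((w + e * a) / (e + b * w)) = e * (1 - b * a) / (e + b * w).
  by field.
by field; rewrite hw he ha.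
Qed.

End Definitions.

(* Main.v *)
(* Orthogonality on the unit disk minus the holes [D_j], tested against monomials
   and summed against [z^m], gives a functional equation
     [P_n(z) = z^n + sum_j T_j'(z) P_n(T_j z) + error],
   with an error of order [n (h |z|)^n] for some [h < 1], because the mean value
   property evaluates [int_(D_j) f(w) (1 - z conj(w))^-2 dA(w) = T_j'(z) f(T_j z)].
   Iterating over all words in the [T_j], with [sum |tau'|] finite, yields
     [P_n(z) = sum_tau tau'(z) tau(z)^n + O(rho^n / n^2)].
   Words whose last applied letter [j] has [|a_j| < rho] are exponentially smaller.
   For [|a_j| = rho] group the words as [T_j^v tau], [tau] not starting with [T_j]:
   since [Phi_j] conjugates [T_j] to multiplication by [sigma_j^2], the sum over [v]
   of [(T_j^v)'(T_j^v)^n] is an explicit sum along the geometric grid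
   [sigma_j^(2v)], whose terms [((1 + x / b) / (1 + b x))^n], [b = |a_j|], are compared
   with [exp(n alpha_j x)]; this produces [Theta]. At the fixed point [a_j] the block of
   the empty word is instead the geometric series of [sigma_j^(2v)]. *)
Require Import Defs.
From mathcomp Require Import all_boot all_order all_algebra.
From mathcomp Require Import all_classical all_reals all_analysis.
From mathcomp Require Import measurable_realfun showcase.summability finmap.
From mathcomp Require Import complex ring lra.
Set Implicit Arguments.
Unset Strict Implicit.
Unset Printing Implicit Defensive.
Import Order.TTheory GRing.Theory Num.Theory.
Import numFieldNormedType.Exports.
Local Open Scope classical_set_scope.
Local Open Scope complex_scope.
Local Open Scope ring_scope.

(** Two obstacles shape the argument. The error of the functional equation contains a bound for P_n
    itself on a disk |z| <= h that contains the holes; it follows from the equation by absorption,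
    because it enters with a coefficient of order n h^(2n). And estimates must be uniform in z
    although words of all lengths occur: Assumption A makes the derivatives of the words summable at
    0, Moebius distortion carries this to |z| <= 1, and a bound for one function on a disk invariant
    under all T_j is then summed against these weights. The rate n^-2 arises because the grid point
    x = sigma_j^(2v) carries an error of order x^2 (1 + n x) exp(-k n x), which sums along a
    geometric grid to O(n^-2). The grid has v >= 1 while the theta series runs over all integers,
    but the indices v <= 0 contribute only O(n^-2). Sums over words are kept finite, over length <
    N, and compared with their targets through [within], a bound for the upper limit of the
    distance. The closed holes being disjoint, distinct words give distinct maps, so that [F], a sum
    over a set of maps, is a sum over words. *)

Local Notation Re := complex.Re.
Local Notation Im := complex.Im.

(** * The complex modulus as a real number, and its topology *)

Section ComplexModulus.
Context {R : realType}.
Local Notation C := R[i].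
Implicit Types z w : C.

Lemma cmod_ge0 z : 0 <= cmod z.
Proof. by case: z => x y; exact: sqrtr_ge0. Qed.

Lemma cmodD z w : cmod (z + w) <= cmod z + cmod w.
Proof. exact: le_normcD. Qed.

Lemma cmodM z w : cmod (z * w) = cmod z * cmod w.
Proof. exact: ComplexField.Normc.normcM. Qed.

Lemma cmodN z : cmod (- z) = cmod z.
Proof. exact: normcN. Qed.

Lemma cmodB z w : cmod (z - w) = cmod (w - z).
Proof. by rewrite -cmodN opprB. Qed.

Lemma cmod0 : cmod (0 : C) = 0.
Proof. exact: ComplexField.Normc.normc0. Qed.

Lemma cmod1 : cmod (1 : C) = 1.
Proof. exact: ComplexField.Normc.normc1. Qed.

Lemma cmodV z : cmod z^-1 = (cmod z)^-1.
Proof. exact: ComplexField.Normc.normcV. Qed.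

Lemma cmod_eq0 z : (cmod z == 0) = (z == 0).
Proof.
apply/eqP/eqP => [/ComplexField.Normc.eq0_normc//|->]; exact: cmod0.
Qed.

Lemma cmod_gt0 z : (0 < cmod z) = (z != 0).
Proof. by rewrite lt_def cmod_ge0 andbT cmod_eq0. Qed.

Lemma cmodX z n : cmod (z ^+ n) = cmod z ^+ n.
Proof. by elim: n => [|n IH]; rewrite ?cmod1 // !exprS cmodM IH. Qed.

Lemma cmod_real (x : R) : cmod x%:C = `|x|.
Proof. by rewrite /= expr0n /= addr0 sqrtr_sqr. Qed.

Lemma cmod_nat n : cmod (n%:R : C) = n%:R.
Proof.
by rewrite -(rmorph_nat (real_complex R)) cmod_real ger0_norm ?ler0n.
Qed.

Lemma cmod_sqr z : cmod z ^+ 2 = Re z ^+ 2 + Im z ^+ 2.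
Proof. by case: z => x y; rewrite /= sqr_sqrtr // addr_ge0 ?sqr_ge0. Qed.

Lemma Num_conjE z : z^* = conjc z.
Proof. by []. Qed.

Lemma cmod_conj z : cmod z^* = cmod z.
Proof. by rewrite Num_conjE; case: z => x y /=; rewrite sqrrN. Qed.

Lemma mul_conj z : z * z^* = (cmod z ^+ 2)%:C.
Proof.
rewrite cmod_sqr Num_conjE; case: z => x y.
by apply/eqP; rewrite eq_complex /=; apply/andP; split; apply/eqP; ring.
Qed.

Lemma cmod_sum (I : Type) (s : seq I) (P : pred I) (f : I -> C) :
  cmod (\sum_(i <- s | P i) f i) <= \sum_(i <- s | P i) cmod (f i).
Proof.
elim/big_rec2: _ => [|i x y _ h]; first by rewrite cmod0.
by apply: le_trans (cmodD _ _) _; rewrite lerD2l.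
Qed.

Lemma cmodBr z w : cmod z - cmod w <= cmod (z - w).
Proof. by rewrite lerBlDr; apply: le_trans (cmodD _ _); rewrite subrK. Qed.

Lemma cmodDr z w : cmod z - cmod w <= cmod (z + w).
Proof. by rewrite -[w in z + w]opprK -[cmod w]cmodN cmodBr. Qed.

Lemma cmodB_le z w : cmod (z - w) <= cmod z + cmod w.
Proof. by rewrite -(cmodN w) cmodD. Qed.

Lemma Re_le_cmod z : `|Re z| <= cmod z.
Proof.
rewrite -(ler_pXn2r (n := 2)) ?nnegrE ?cmod_ge0 // cmod_sqr real_normK ?num_real //.
by rewrite lerDl sqr_ge0.
Qed.

Lemma Im_le_cmod z : `|Im z| <= cmod z.
Proof.
rewrite -(ler_pXn2r (n := 2)) ?nnegrE ?cmod_ge0 // cmod_sqr real_normK ?num_real //.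
by rewrite lerDr sqr_ge0.
Qed.

Lemma cmod_le_ReIm z : cmod z <= `|Re z| + `|Im z|.
Proof.
rewrite -(ler_pXn2r (n := 2)) ?nnegrE ?addr_ge0 ?cmod_ge0 // cmod_sqr sqrrD.
rewrite !real_normK ?num_real // addrAC.
by rewrite lerDl mulrn_wge0 ?mulr_ge0.
Qed.

Lemma ReD z w : Re (z + w) = Re z + Re w.
Proof. by case: z w => [? ?] [? ?]. Qed.

Lemma ImD z w : Im (z + w) = Im z + Im w.
Proof. by case: z w => [? ?] [? ?]. Qed.

Lemma Re_rM (x : R) z : Re (x%:C * z) = x * Re z.
Proof. by case: z => a b /=; rewrite mul0r subr0. Qed.

Lemma Im_rM (x : R) z : Im (x%:C * z) = x * Im z.
Proof. by case: z => a b /=; rewrite mul0r addr0. Qed.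

Lemma Re_sum (I : Type) (s : seq I) (P : pred I) (f : I -> C) :
  Re (\sum_(i <- s | P i) f i) = \sum_(i <- s | P i) Re (f i).
Proof. by elim/big_rec2: _ => // i x y _ <-; rewrite ReD. Qed.

Lemma Im_sum (I : Type) (s : seq I) (P : pred I) (f : I -> C) :
  Im (\sum_(i <- s | P i) f i) = \sum_(i <- s | P i) Im (f i).
Proof. by elim/big_rec2: _ => // i x y _ <-; rewrite ImD. Qed.

Lemma normC_cmod z : `|z| = (cmod z)%:C :> C.
Proof. by []. Qed.

(** The norm of [R[i]] is complex-valued, so the radius of a ball is a complex number; its
    positivity forces the imaginary part to vanish. *)
Lemma nbhs_diskP z (V : set C) :
  nbhs z V <-> exists2 e : R, 0 < e & disk z e `<=` V.
Proof.
split.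
  move=> /nbhs_ballP[[e e'] /=]; rewrite ltcE /= => /andP[/eqP -> e0] h.
  exists e => // w; rewrite /disk /= => hw; apply: h.
  by rewrite /ball /= normC_cmod ltcR cmodB.
move=> [e e0 h]; apply/nbhs_ballP; exists (e%:C) => /=; first by rewrite ltcR.
move=> w hw; apply: h; move: hw.
by rewrite /disk /ball /= normC_cmod ltcR cmodB.
Qed.

Lemma closed_away (K : set C) z : closed K -> ~ K z ->
  exists2 e : R, 0 < e & forall w, K w -> e <= cmod (w - z).
Proof.
move=> cK nK; have : nbhs z (~` K) by apply: open_nbhs_nbhs; split => //; exact: closed_openC.
move=> /nbhs_diskP[e e0 h]; exists e => // w Kw; rewrite leNgt; apply/negP => hw.
exact: (h w hw).
Qed.

Lemma closure_disk z (e : R) : 0 < e ->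
  closure (disk z e) = [set w | cmod (w - z) <= e].
Proof.
move=> e0; apply/seteqP; split => w /= h.
  rewrite leNgt; apply/negP => he.
  have /h[] : nbhs w (disk w (cmod (w - z) - e)).
    by apply/nbhs_diskP; exists (cmod (w - z) - e) => //; rewrite subr_gt0.
  move=> v; rewrite /disk /= => -[h1 h2].
  have := cmodD (w - v) (v - z); rewrite addrA subrK leNgt => /negP; apply.
  by rewrite cmodB; lra.
move=> V /nbhs_diskP[d d0 hV].
(* Points of the closed disk are approached by pulling them slightly towards [z]. *)
pose t := Num.min (1/2) (d / (2 * e)).
have t0 : 0 < t by rewrite /t lt_min; apply/andP; split; [lra|rewrite divr_gt0 // mulr_gt0].
have t1 : t <= 1/2 by rewrite /t ge_min lexx.
have te : t * e <= d / 2.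
  have -> : d / 2 = d / (2 * e) * e by field; rewrite gt_eqF.
  by rewrite ler_pM2r // /t ge_min lexx orbT.
exists (w - t%:C * (w - z)); split.
  rewrite /disk /= addrAC; have -> : w - z - t%:C * (w - z) = (1 - t)%:C * (w - z).
    by rewrite rmorphB rmorph1; ring.
  rewrite cmodM cmod_real ger0_norm ?subr_ge0; last by lra.
  have : (1 - t) * cmod (w - z) <= (1 - t) * e by rewrite ler_pM2l //; lra.
  have : 0 < t * e by rewrite mulr_gt0.
  by lra.
apply: hV; rewrite /disk /= addrAC subrr sub0r cmodN cmodM cmod_real gtr0_norm //.
have : t * cmod (w - z) <= t * e by rewrite ler_pM2l.
by lra.
Qed.

End ComplexModulus.

(** Unordered sums are limits over finite sets, whereas words are enumerated by lists; this passes
    from one to the other. *)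
Lemma fset_of_uniq (I : choiceType) (s : seq I) : uniq s ->
  exists2 J : {fset I}, J =i s &
    forall (V : zmodType) (f : I -> V), \sum_(i <- J) f i = \sum_(i <- s) f i.
Proof.
move=> us; exists (seq_fset tt s) => [i|V f]; first by rewrite seq_fsetE.
by apply: perm_big; rewrite -[X in perm_eq _ X](undup_id us); exact: seq_fset_perm.
Qed.

(** * Unordered sums: convergence and truncation *)

Section UnconditionalSums.
Context {R : realType}.
Local Notation C := R[i].

Lemma partial_sumE (I : choiceType) (V : zmodType) (f : I -> V) (J : {fset I}) :
  partial_sum f J = \sum_(i <- J) f i.
Proof. by rewrite /partial_sum big_seq_fsetE. Qed.

Lemma cvg_totallyP (I : choiceType) (f : I -> C) (l : C) :
  (forall e : R, 0 < e -> exists J0 : {fset I}, forall J : {fset I},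
     fsubset J0 J -> cmod (\sum_(i <- J) f i - l) <= e) ->
  partial_sum f @ totally --> l.
Proof.
move=> h V /nbhs_diskP[e e0 hV].
have [J0 hJ] := h (e / 2) (divr_gt0 e0 (ltr0n _ 2)).
exists J0 => // J /= /hJ hJ'; apply: hV; rewrite /disk /= partial_sumE.
by apply: le_lt_trans hJ' _; rewrite gtr_pMr // invf_lt1 // ltr1n.
Qed.

Lemma sum_eq_lim (I : choiceType) (f : I -> C) (l : C) :
  (forall e : R, 0 < e -> exists J0 : {fset I}, forall J : {fset I},
     fsubset J0 J -> cmod (\sum_(i <- J) f i - l) <= e) ->
  sum f = l.
Proof.
move=> h; apply: (cvg_lim (@norm_hausdorff _ _) (cvg_totallyP h)).
exact: totally_filter.
Qed.

Lemma fset_sum_setD (I : choiceType) (V : zmodType) (f : I -> V) (J J0 : {fset I}) :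
  fsubset J0 J -> \sum_(i <- J) f i
     = \sum_(i <- J0) f i + \sum_(i <- fsetD J J0) f i.
Proof.
move=> h; rewrite (big_fsetID _ (mem J0) J) /=; congr (_ + _); apply: eq_fbigl => i.
  rewrite !inE /=; apply/andP/idP => [[]//|iJ0]; split=> //; exact: (fsubsetP h).
by rewrite !inE /= andbC.
Qed.

(** The partial sums increase along inclusion, so their supremum is the limit. *)
Lemma nonneg_sum_conv (I : choiceType) (g : I -> R) (B : R) :
  (forall i, 0 <= g i) -> (forall J : {fset I}, \sum_(i <- J) g i <= B) ->
  exists l, forall e : R, 0 < e -> exists J0 : {fset I}, forall J : {fset I},
     fsubset J0 J -> `|\sum_(i <- J) g i - l| <= e.
Proof.
move=> g0 gB; pose E := [set \sum_(i <- J) g i | J in [set: {fset I}]].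
have hE : has_sup E.
  split; first by exists (\sum_(i <- fset0) g i), fset0.
  by exists B => _ [J _ <-].
exists (sup E) => e e0; have [_ [J0 _ <-] hJ0] := sup_adherent e0 hE.
exists J0 => J hJ; rewrite ler_distl; apply/andP; split; last first.
  apply: (@le_trans _ _ (sup E)); last by rewrite lerDl ltW.
  by apply: sup_upper_bound => //; exists J.
apply: le_trans (ltW hJ0) _; rewrite (fset_sum_setD _ hJ) lerDl.
by apply: sumr_ge0.
Qed.

(** Here f = (f + |f|) - |f| is a difference of two nonnegative families with bounded partial
    sums. *)
Lemma real_sum_conv (I : choiceType) (f : I -> R) (B : R) :
  (forall J : {fset I}, \sum_(i <- J) `|f i| <= B) ->
  exists l, forall e : R, 0 < e -> exists J0 : {fset I}, forall J : {fset I},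
     fsubset J0 J -> `|\sum_(i <- J) f i - l| <= e.
Proof.
move=> fB.
have [l1 h1] := nonneg_sum_conv (fun i => normr_ge0 (f i)) fB.
have [|J|l2 h2] := @nonneg_sum_conv _ (fun i => f i + `|f i|) (B + B).
- by move=> i /=; rewrite -lerBlDr sub0r lerNl -normrN ler_norm.
- rewrite big_split /= lerD //; apply: le_trans (fB J); apply: ler_sum => i _.
  exact: ler_norm.
exists (l2 - l1) => e e0; have e20 : 0 < e / 2 by rewrite divr_gt0.
have [J1 {}h1] := h1 _ e20; have [J2 {}h2] := h2 _ e20.
exists (fsetU J1 J2) => J; rewrite fsubUset => /andP[/h1 {}h1 /h2 {}h2].
move: h2; rewrite big_split /=; set x := \sum_(i <- J) f i; set y := \sum_(i <- J) _.
move: h1; rewrite -/y => h1 h2.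
have -> : x - (l2 - l1) = (x + y - l2) - (y - l1) by ring.
by apply: le_trans (ler_normB _ _) _; lra.
Qed.

Lemma ler_sum_uniq (I : choiceType) (F : I -> R) (J L : seq I) :
  (forall i, 0 <= F i) -> uniq J -> uniq L -> {subset J <= L} ->
  \sum_(i <- J) F i <= \sum_(i <- L) F i.
Proof.
move=> F0 uJ uL sub; rewrite [X in _ <= X](bigID (mem J)) /= -[X in _ <= X + _]big_filter.
have p : perm_eq J [seq i <- L | mem J i].
  apply: uniq_perm; rewrite ?filter_uniq // => i; rewrite mem_filter /=.
  by apply/idP/andP => [iJ|[]//]; split=> //; exact: sub.
by rewrite (perm_big _ p) lerDl sumr_ge0.
Qed.

Lemma abs_sum_conv (I : choiceType) (f : I -> C) (B : R) :
  (forall J : {fset I}, \sum_(i <- J) cmod (f i) <= B) ->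
  forall e : R, 0 < e -> exists J0 : {fset I}, forall J : {fset I},
     fsubset J0 J -> cmod (\sum_(i <- J) f i - sum f) <= e.
Proof.
move=> fB.
have [l1 h1] : exists l, forall e : R, 0 < e -> exists J0 : {fset I}, forall J : {fset I},
     fsubset J0 J -> `|\sum_(i <- J) Re (f i) - l| <= e.
  apply: (@real_sum_conv _ _ B) => J; apply: le_trans (fB J).
  by apply: ler_sum => i _; exact: Re_le_cmod.
have [l2 h2] : exists l, forall e : R, 0 < e -> exists J0 : {fset I}, forall J : {fset I},
     fsubset J0 J -> `|\sum_(i <- J) Im (f i) - l| <= e.
  apply: (@real_sum_conv _ _ B) => J; apply: le_trans (fB J).
  by apply: ler_sum => i _; exact: Im_le_cmod.
have h e : 0 < e -> exists J0 : {fset I}, forall J : {fset I},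
     fsubset J0 J -> cmod (\sum_(i <- J) f i - (l1 +i* l2)) <= e.
  move=> e0; have e20 : 0 < e / 2 by rewrite divr_gt0.
  have [J1 {}h1] := h1 _ e20; have [J2 {}h2] := h2 _ e20.
  exists (fsetU J1 J2) => J; rewrite fsubUset => /andP[/h1 {}h1 /h2 {}h2].
  apply: le_trans (cmod_le_ReIm _) _; move: h1 h2; rewrite -Re_sum -Im_sum.
  by case: (\sum_(i <- J) f i) => x y /= h1 h2; lra.
by rewrite (sum_eq_lim h); exact: h.
Qed.

(** A bound on all finite sums that avoid [J0] survives in the limit. The theta series and [F] are
    both truncated in this way. *)
Lemma abs_sum_approx (I : choiceType) (f : I -> C) (B : R) (J0 : {fset I}) (e : R) :
  (forall J : {fset I}, \sum_(i <- J) cmod (f i) <= B) ->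
  (forall J : {fset I}, fdisjoint J J0 -> \sum_(i <- J) cmod (f i) <= e) ->
  cmod (sum f - \sum_(i <- J0) f i) <= e.
Proof.
move=> fB fe; apply/ler_addgt0Pr => d d0.
have [J1 h1] := abs_sum_conv fB d0.
have {h1} := h1 (fsetU J0 J1) (fsubsetUr _ _); set J := fsetU _ _ => h1.
have := fset_sum_setD f (fsubsetUl J0 J1); rewrite -/J => eJ.
have dJ : fdisjoint (fsetD J J0) J0 by apply/fdisjointP => x; rewrite inE => /andP[].
have := fe _ dJ; set y := \sum_(i <- fsetD _ _) cmod _ => h2.
have h3 : cmod (\sum_(i <- fsetD J J0) f i) <= e.
  by apply: le_trans h2; exact: cmod_sum.
set x := \sum_(i <- J0) f i in eJ *.
rewrite cmodB; have -> : x - sum f = (\sum_(i <- J) f i - sum f) - \sum_(i <- fsetD J J0) f i.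
  by rewrite eJ; ring.
by apply: le_trans (cmodB_le _ _) _; lra.
Qed.

(** Beyond some [J0] the partial sums at [z] are within 1 of [S z]; an arbitrary [J] is compared
    with its union with [J0], the terms being nonnegative. *)
Lemma locally_uniformly_summable_bounded (T : choiceType) (A : set T)
    (f : T -> C -> R) (U : set C) (z : C) :
  locally_uniformly_summable A f U -> U z -> (forall x w, 0 <= f x w) ->
  exists B, forall J : {fset A}, \sum_(x <- J) f (val x) z <= B.
Proof.
move=> [S hS] Uz f0; have [V Vz hV] := hS z Uz.
have Vz' : V z by exact: nbhs_singleton.
have /hV : nbhs (S : {uniform` V -> R}) [set g : {uniform` V -> R} | forall x, V x -> ball (S x) 1 (g x)].
  apply/uniform_nbhs; exists [set p | ball p.1 1 p.2]; split => //.
  by rewrite -entourage_from_ballE; exists 1 => //=.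
case=> J0 _ hJ0; exists (S z + 1) => J.
have := hJ0 (fsetU J0 J) (fsubsetUl _ _) z Vz'.
rewrite /= partial_sumE (fset_sum_setD _ (fsubsetUr J0 J)) /ball /= ltr_norml => /andP[h _].
have : 0 <= \sum_(i <- fsetD (fsetU J0 J) J) f (val i) z by apply: sumr_ge0.
by lra.
Qed.

End UnconditionalSums.

(** * Disks in the plane and the modulus of Phi *)

Section DiskGeometry.
Context {R : realType}.
Local Notation C := R[i].
Implicit Types z w a c : C.

Lemma unit_direction z : exists2 u : C, cmod u = 1 & z = (cmod z)%:C * u.
Proof.
have [->|z0] := eqVneq z 0; first by exists 1; rewrite ?cmod1 // cmod0 mul0r.
have c0 : cmod z != 0 by rewrite cmod_eq0.
exists (z / (cmod z)%:C).
  by rewrite cmodM cmodV cmod_real ger0_norm ?cmod_ge0 // divff.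
by rewrite mulrC divfK //; apply: contra c0 => /eqP[->].
Qed.

(** Tested on the points of [disk c r] beyond [c] in the direction of [c - c'], which are the
    farthest from [c']. *)
Lemma disk_subset_radius c c' (r r' : R) : 0 < r ->
  disk c r `<=` disk c' r' -> cmod (c - c') + r <= r'.
Proof.
move=> r0 h; have [u u1 eu] := unit_direction (c - c').
have dist t : 0 <= t -> cmod (c + t%:C * u - c') = cmod (c - c') + t.
  move=> t0; have -> : c + t%:C * u - c' = (cmod (c - c') + t)%:C * u.
    by rewrite rmorphD mulrDl -eu; ring.
  by rewrite cmodM u1 mulr1 cmod_real ger0_norm // addr_ge0 // cmod_ge0.
have inD t : 0 <= t < r -> cmod (c - c') + t < r'.
  move=> /andP[t0 tr]; have := h (c + t%:C * u); rewrite /disk /= dist //; apply.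
  by rewrite addrAC subrr add0r cmodM u1 mulr1 cmod_real ger0_norm.
rewrite leNgt; apply/negP => lt; have := inD 0; rewrite lexx r0 => /(_ isT) h0.
have /inD : 0 <= r' - cmod (c - c') < r by apply/andP; split; lra.
by rewrite addrCA subrr addr0 ltxx.
Qed.

Lemma disk_inj c c' (r r' : R) : 0 < r -> 0 < r' ->
  disk c r = disk c' r' -> c = c' /\ r = r'.
Proof.
move=> r0 r'0 e.
have h1 : cmod (c - c') + r <= r' by apply: disk_subset_radius => //; rewrite e.
have h2 : cmod (c' - c) + r' <= r by apply: disk_subset_radius => //; rewrite e.
rewrite cmodB in h2; have := cmod_ge0 (c - c') => h3.
have : cmod (c - c') = 0 by lra.
by move=> /eqP; rewrite cmod_eq0 subr_eq0 => /eqP ->; split => //; lra.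
Qed.

Lemma closed_disk_radius c (r : R) : 0 < r ->
  closure (disk c r) `<=` disk 0 1 -> cmod c + r < 1.
Proof.
move=> r0 h; have [u u1 eu] := unit_direction c.
have := h (c + r%:C * u); rewrite closure_disk // /disk /= subr0.
rewrite addrAC subrr add0r cmodM u1 mulr1 cmod_real gtr0_norm // lexx.
have -> : c + r%:C * u = (cmod c + r)%:C * u by rewrite rmorphD mulrDl -eu.
rewrite cmodM u1 mulr1 cmod_real ger0_norm; last by rewrite addr_ge0 ?cmod_ge0 ?ltW.
exact.
Qed.

Lemma cmod_conjM_lt1 a z : cmod a * cmod z < 1 -> 1 - a^* * z != 0.
Proof.
move=> h; rewrite subr_eq0; apply: contraTneq h => e.
by rewrite -(cmod_conj a) -cmodM -e cmod1 ltxx.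
Qed.

(** For |a| < 1 the right-hand side has the sign of 1 - |z|^2, so |z - a| < |1 - conj(a) z| holds
    exactly inside the unit disk. *)
Lemma moebius_modulus a z :
  cmod (1 - a^* * z) ^+ 2 - cmod (z - a) ^+ 2 = (1 - cmod a ^+ 2) * (1 - cmod z ^+ 2).
Proof.
rewrite !cmod_sqr Num_conjE; case: a z => u v [x y] /=; ring.
Qed.

Lemma cmod_PhiE a z : cmod (Phi a z) = cmod (z - a) / cmod (1 - a^* * z).
Proof.
rewrite /Phi !cmodM cmodV; suff -> : cmod (phase a) = 1 by rewrite mul1r.
rewrite /phase; case: eqVneq => [_|a0]; first by rewrite cmod1.
rewrite cmodM cmod_conj cmodV cmod_real ger0_norm ?cmod_ge0 //.
by rewrite divff // cmod_eq0.
Qed.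

Lemma phase_conj_mul a : phase a * a = (cmod a)%:C.
Proof.
rewrite /phase; case: eqVneq => [->|a0]; first by rewrite mulr0 cmod0.
have c0 : (cmod a)%:C != 0 :> C.
  by rewrite (fmorph_eq0 (real_complex R)) cmod_eq0.
apply: (mulIf c0); rewrite mulrAC divfK // mulrC mul_conj.
by rewrite expr2 rmorphM.
Qed.

End DiskGeometry.

(** * A hole in terms of its uniformizer, and its reflection map *)

Section Uniformizer.
Context {R : realType} (c a : R[i]) (r sigma : R).
Hypothesis r_gt0 : 0 < r.
Hypothesis in_unit : cmod c + r < 1.
Hypothesis unif : is_uniformizer c r a sigma.
Local Notation C := R[i].
Implicit Types z : C.
Local Notation b := (cmod a).

Lemma uniformizer_a1 : b < 1.
Proof. by case: unif; rewrite /disk /= subr0. Qed.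

Lemma uniformizer_sigma : 0 < sigma < 1.
Proof. by case: unif. Qed.

Lemma sigma2_bounds : 0 < sigma ^+ 2 < 1.
Proof.
have /andP[h0 h1] := uniformizer_sigma.
by rewrite exprn_gt0 // expr_lt1 // ltW.
Qed.

Lemma modulus2_bounds : 0 <= b ^+ 2 < 1.
Proof. by rewrite sqr_ge0 /= expr_lt1 // ?cmod_ge0 // uniformizer_a1. Qed.

Lemma uniformizer_den : 0 < 1 - sigma ^+ 2 * b ^+ 2.
Proof.
have /andP[h0 h1] := sigma2_bounds; have /andP[h2 h3] := modulus2_bounds; nra.
Qed.

(** The condition |Phi a z| < sigma reads |z - a| < sigma |1 - conj(a) z|; completing the square
    turns it into a disk, whose centre and radius must be those of the hole. *)
Lemma uniformizer_center_radius :
  c = ((1 - sigma ^+ 2) / (1 - sigma ^+ 2 * b ^+ 2))%:C * a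
  /\ r = sigma * (1 - b ^+ 2) / (1 - sigma ^+ 2 * b ^+ 2).
Proof.
have N0 := uniformizer_den; have /andP[s0 s1] := uniformizer_sigma.
have a1 := uniformizer_a1; have /andP[b0 b1] := modulus2_bounds.
set N := 1 - _ in N0 *.
set c' := _ * a; set r' := _ / N.
have r'0 : 0 < r' by rewrite divr_gt0 // mulr_gt0 // subr_gt0.
apply: disk_inj => //.
have key z : N * (r' ^+ 2 - cmod (z - c') ^+ 2)
    = sigma ^+ 2 * cmod (1 - a^* * z) ^+ 2 - cmod (z - a) ^+ 2.
  have N0' : N != 0 by rewrite gt_eqF.
  rewrite /r' /c'; move: N0'; rewrite /N !cmod_sqr Num_conjE.
  case: (a) z => u v [x y] /= N0'; field; exact: N0'.
have inD z : disk c' r' z <-> cmod (z - a) < sigma * cmod (1 - a^* * z).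
  rewrite /disk /=.
  rewrite -(ltr_pXn2r (n := 2)) ?nnegrE ?cmod_ge0 ?ltW // -subr_gt0.
  rewrite -(pmulr_rgt0 _ N0) key.
  rewrite subr_gt0 -exprMn ltr_pXn2r ?nnegrE ?cmod_ge0 //.
  by rewrite mulr_ge0 ?cmod_ge0 // ltW.
have cD z : disk c r z -> cmod z < 1.
  rewrite /disk /= => h; have := cmodD (z - c) c; rewrite subrK => h'.
  by apply: le_lt_trans h' _; apply: lt_trans in_unit; rewrite addrC ltrD2l.
have den z : cmod z < 1 -> 0 < cmod (1 - a^* * z).
  move=> z1; rewrite cmod_gt0; apply: cmod_conjM_lt1.
  by rewrite mulr_ilt1 ?cmod_ge0.
have [_ _ im] := unif.
apply/seteqP; split=> z.
  move=> hz; apply/inD; have : disk 0 sigma (Phi a z) by rewrite -im; exists z.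
  rewrite /disk /= subr0 cmod_PhiE ltr_pdivrMr //; exact: den (cD _ hz).
move=> /inD hz.
(* Outside the unit disk |z - a| >= |1 - conj(a) z|, so the inequality can hold only inside, where
   [Phi a] is injective. *)
have z1 : cmod z < 1.
  rewrite ltNge; apply/negP => z1; move: hz; rewrite ltNge => /negP; apply.
  apply: (@le_trans _ _ (1 * cmod (1 - a^* * z))).
    by rewrite ler_wpM2r ?cmod_ge0 // ltW.
  rewrite mul1r -(ler_pXn2r (n := 2)) ?nnegrE ?cmod_ge0 // -subr_le0 moebius_modulus.
  by rewrite mulr_ge0_le0 // ?subr_le0 ?subr_ge0 ?exprn_ege1 // ltW.
have : disk 0 sigma (Phi a z).
  by rewrite /disk /= subr0 cmod_PhiE ltr_pdivrMr // den.
rewrite -im => -[z' hz' e].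
have nz z'' : cmod z'' < 1 -> 1 - a^* * z'' != 0.
  by move=> /den; rewrite cmod_gt0.
have da : disk 0 1 a by rewrite /disk /= subr0.
by rewrite -(PhiK da (nz _ z1)) -e PhiK // nz // cD.
Qed.

Lemma cmod_center : cmod c = (1 - sigma ^+ 2) / (1 - sigma ^+ 2 * b ^+ 2) * b.
Proof.
rewrite {1}(proj1 uniformizer_center_radius) cmodM cmod_real ger0_norm //.
have := uniformizer_den; have /andP[h0 h1] := sigma2_bounds => N0.
by rewrite divr_ge0 ?ltW // subr_gt0.
Qed.

(** Consequently the reflection map, with denominator 1 - conj(c) z, has no pole where |a| |z| <
    1. *)
Lemma cmod_center_le : cmod c <= b.
Proof.
rewrite cmod_center ler_piMl ?cmod_ge0 // ler_pdivrMr ?uniformizer_den // mul1r.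
have /andP[h0 h1] := sigma2_bounds; have /andP[h2 h3] := modulus2_bounds; nra.
Qed.

Lemma center_mul_lt1_of z : b * cmod z < 1 -> 1 - c^* * z != 0.
Proof.
move=> hz; apply: cmod_conjM_lt1; apply: le_lt_trans hz.
by rewrite ler_wpM2r ?cmod_ge0 // cmod_center_le.
Qed.

Local Notation S := ((sigma ^+ 2)%:C : C).
Local Notation N := (1 - S * (a * a^*)).

Let N_eq : (1 - sigma ^+ 2 * b ^+ 2)%:C = N :> C.
Proof. by rewrite mul_conj rmorphB rmorph1 rmorphM. Qed.

Let N_neq0 : N != 0.
Proof. by rewrite -N_eq (fmorph_eq0 (real_complex R)) gt_eqF // uniformizer_den. Qed.

Let center_eq : c = (1 - S) / N * a.
Proof.
rewrite {1}(proj1 uniformizer_center_radius); congr (_ * _).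
by rewrite rmorphM fmorphV /= N_eq rmorphB rmorph1.
Qed.

Let center_conj_eq : c^* = (1 - S) / N * a^*.
Proof.
rewrite {1}(proj1 uniformizer_center_radius) rmorphM /=; congr (_ * _).
have -> : ((1 - S) / N : C) = ((1 - sigma ^+ 2) / (1 - sigma ^+ 2 * b ^+ 2))%:C.
  by rewrite [in RHS]rmorphM fmorphV /= N_eq [in RHS]rmorphB rmorph1.
by rewrite Num_conjE /= oppr0.
Qed.

Let radius_eq : (r ^+ 2)%:C = S * (1 - a * a^*) ^+ 2 / N ^+ 2 :> C.
Proof.
have e3 : (1 - b ^+ 2)%:C = 1 - a * a^* :> C by rewrite mul_conj rmorphB rmorph1.
rewrite (proj2 uniformizer_center_radius) -N_eq -e3 -!rmorphXn -fmorphV -!rmorphM /=.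
by congr (_ %:C); rewrite !exprMn !exprVn.
Qed.

Let center_den z : 1 - c^* * z = (N - (1 - S) * a^* * z) / N.
Proof.
rewrite center_conj_eq; have := N_neq0; move: S (a^*) => q A N0.
by field; rewrite ?N0.
Qed.

Let center_den_neq0 z : b * cmod z < 1 -> N - (1 - S) * a^* * z != 0.
Proof.
move=> /center_mul_lt1_of; rewrite center_den; apply: contraNneq => ->.
by rewrite mul0r.
Qed.

Lemma PhiV_den z : b * cmod z < 1 ->
  phase a + a^* * (S * Phi a z) = phase a * N * (1 - c^* * z) / (1 - a^* * z).
Proof.
move=> hz; have dz := cmod_conjM_lt1 hz; rewrite center_den /Phi.
by have := N_neq0; move: S (a^*) dz => q A dz N0; field; rewrite ?dz ?N0.
Qed.

(** In the coordinate [Phi a] the unit circle and the circle of the hole are concentric, of radii 1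
    and sigma. Reflecting in the first and then in the second multiplies by sigma^2, and in the
    variable z this composite is the right-hand side. *)
Lemma reflection_eq z : b * cmod z < 1 ->
  PhiV a (S * Phi a z) = c + (r ^+ 2)%:C * z / (1 - c^* * z).
Proof.
move=> hz; have dz := cmod_conjM_lt1 hz; have cz := center_den_neq0 hz.
rewrite center_den radius_eq center_eq /PhiV PhiV_den // center_den /Phi.
have := N_neq0; have := phase_neq0 a.
move: (phase a) S (a^*) dz cz => e q A dz cz e0 N0.
by field; rewrite ?N0 ?cz ?e0 ?dz.
Qed.

Lemma Phi_reflection z : b * cmod z < 1 ->
  Phi a (c + (r ^+ 2)%:C * z / (1 - c^* * z)) = S * Phi a z.
Proof.
move=> hz; rewrite -reflection_eq // PhiVK //.
  by rewrite /disk /= subr0 uniformizer_a1.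
rewrite PhiV_den // !mulf_neq0 ?phase_neq0 ?N_neq0 ?invr_eq0 ?center_mul_lt1_of //.
exact: cmod_conjM_lt1.
Qed.

(** The chain rule for [Phi_reflection], with the derivatives of both Moebius maps written out. *)
Lemma Phi_reflection_derivative z : b * cmod z < 1 ->
  phase a * (1 - a^* * a) / (1 - a^* * (c + (r ^+ 2)%:C * z / (1 - c^* * z))) ^+ 2
    * ((r ^+ 2)%:C / (1 - c^* * z) ^+ 2)
  = S * (phase a * (1 - a^* * a) / (1 - a^* * z) ^+ 2).
Proof.
move=> hz; have dz := cmod_conjM_lt1 hz; have cz := center_den_neq0 hz.
have da : 1 - a^* * a != 0 by apply: disk_conj_neq0; rewrite /disk /= subr0 uniformizer_a1.
have -> : 1 - a^* * (c + (r ^+ 2)%:C * z / (1 - c^* * z))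
    = (1 - a^* * a) * (1 - a^* * z) / (N - (1 - S) * a^* * z).
  rewrite center_den radius_eq center_eq.
  have := N_neq0; move: S (a^*) dz cz da => q A dz cz da N0.
  by field; rewrite ?N0 ?cz ?dz.
rewrite center_den radius_eq.
have := N_neq0; move: S (a^*) dz cz da => q A dz cz da N0.
by field; rewrite ?N0 ?cz ?dz ?da.
Qed.

(** The reflection map of the hole rotated onto the nonnegative real axis. It bounds the modulus of
    the reflection by a function of |z|, and it fixes |a|. *)
Definition majorant (t : R) : R := cmod c + r ^+ 2 * t / (1 - cmod c * t).

(** The first two factors vanish at the fixed points |a| and, for a != 0, 1 / |a|; between them the
    majorant lies below the diagonal. *)
Lemma majorant_sub t : cmod c * t < 1 ->
  t - majorant t = (t - b) * (1 - b * t)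
    * ((1 - sigma ^+ 2) / ((1 - sigma ^+ 2 * b ^+ 2) * (1 - cmod c * t))).
Proof.
rewrite /majorant cmod_center (proj2 uniformizer_center_radius).
have := uniformizer_den; move: (sigma) b => q d N0 h.
have N1 : 1 - q ^+ 2 * d ^+ 2 != 0 by rewrite gt_eqF.
have D : 1 - (1 - q ^+ 2) / (1 - q ^+ 2 * d ^+ 2) * d * t
    = (1 - q ^+ 2 * d ^+ 2 - (1 - q ^+ 2) * d * t) / (1 - q ^+ 2 * d ^+ 2) by field; rewrite exprMn.
have D0 : 1 - q ^+ 2 * d ^+ 2 - (1 - q ^+ 2) * d * t != 0.
  have : 0 < 1 - (1 - q ^+ 2) / (1 - q ^+ 2 * d ^+ 2) * d * t by lra.
  by rewrite D pmulr_lgt0 ?invr_gt0 // => /gt_eqF ->.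
by rewrite D; field; rewrite ?exprMn ?N1 ?D0.
Qed.

Lemma majorant_le t t' : 0 <= t -> t <= t' -> cmod c * t' < 1 ->
  majorant t <= majorant t'.
Proof.
move=> t0 tt' h; have := cmod_ge0 c => c0.
have h' : cmod c * t < 1 by apply: le_lt_trans h; rewrite ler_wpM2l.
have e x y : r ^+ 2 * x / y = r ^+ 2 * (x / y) by rewrite mulrA.
rewrite /majorant lerD2l !e ler_wpM2l ?sqr_ge0 //.
rewrite ler_pdivrMr ?subr_gt0 // mulrAC ler_pdivlMr ?subr_gt0 //; nra.
Qed.

Lemma reflection_le_majorant z : cmod c * cmod z < 1 ->
  cmod (c + (r ^+ 2)%:C * z / (1 - c^* * z)) <= majorant (cmod z).
Proof.
move=> h; apply: le_trans (cmodD _ _) _; rewrite /majorant lerD2l.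
rewrite !cmodM cmodV cmod_real ger0_norm ?sqr_ge0 //.
rewrite ler_wpM2l ?mulr_ge0 ?cmod_ge0 ?(ltW r_gt0) //.
have h' : 1 - cmod c * cmod z <= cmod (1 - c^* * z).
  by have := cmodBr 1 (c^* * z); rewrite cmod1 cmodM cmod_conj.
by rewrite lef_pV2 // posrE ?subr_gt0 //; apply: lt_le_trans h'; rewrite subr_gt0.
Qed.

Lemma majorant_le_max t : 0 <= t -> b * t < 1 -> majorant t <= Num.max t b.
Proof.
move=> t0 bt; have cb := cmod_center_le; have := cmod_ge0 c => c0.
have ct : cmod c * t < 1 by apply: le_lt_trans bt; rewrite ler_wpM2r.
have bb : b * b < 1 by have /andP[_] := modulus2_bounds; rewrite expr2.
have cb1 : cmod c * b < 1 by apply: le_lt_trans bb; rewrite ler_wpM2r ?cmod_ge0.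
rewrite le_max; case: (leP t b) => tb; apply/orP; [right|left].
  apply: le_trans (majorant_le t0 tb cb1) _.
  by rewrite -subr_ge0 majorant_sub // subrr !mul0r.
rewrite -subr_ge0 majorant_sub //; have /andP[s0 s1] := sigma2_bounds.
apply: mulr_ge0; first by rewrite mulr_ge0 ?subr_ge0 // ltW.
apply: divr_ge0; first by rewrite subr_ge0 ltW.
apply: mulr_ge0; [exact: ltW uniformizer_den | by rewrite subr_ge0 ltW].
Qed.

Lemma majorant_lt t : b < t -> b * t < 1 -> majorant t < t.
Proof.
move=> tb bt; have t0 : 0 <= t by apply: le_trans (ltW tb); exact: cmod_ge0.
have ct : cmod c * t < 1.
  by apply: le_lt_trans bt; rewrite ler_wpM2r // cmod_center_le.
rewrite -subr_gt0 majorant_sub //; have /andP[s0 s1] := sigma2_bounds.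
apply: mulr_gt0; first by rewrite mulr_gt0 ?subr_gt0.
by rewrite divr_gt0 ?mulr_gt0 ?subr_gt0 // -subr_gt0 uniformizer_den.
Qed.

Lemma reflection_in_disk z : cmod z <= 1 ->
  cmod (c + (r ^+ 2)%:C * z / (1 - c^* * z) - c) <= r.
Proof.
move=> z1; rewrite addrAC subrr add0r !cmodM cmodV cmod_real ger0_norm ?sqr_ge0 //.
have := cmod_ge0 c => c0; have := cmod_ge0 z => z0.
have cz : cmod c * cmod z <= cmod c by rewrite ler_piMr.
have h : r <= cmod (1 - c^* * z).
  have := cmodBr 1 (c^* * z); rewrite cmod1 cmodM cmod_conj; apply: le_trans.
  rewrite lerBrDr; apply: le_trans (ltW in_unit); rewrite addrC lerD2r //.
rewrite ler_pdivrMr; last by apply: lt_le_trans h.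
rewrite expr2 -mulrA ler_pM2l //; apply: le_trans h.
by rewrite ler_piMr // ltW.
Qed.

(** The two sides are in the ratio sigma |a|. The fixed point of the reflection thus lies inside its
    own hole and, the holes being disjoint, at positive distance from the others. *)
Lemma center_dist_fixpoint : cmod (a - c) < r.
Proof.
have [-> ->] := uniformizer_center_radius; have N0 := uniformizer_den.
have /andP[s0 s1] := uniformizer_sigma; have /andP[b0 b1] := modulus2_bounds.
set N := 1 - _ in N0 *.
have -> : a - ((1 - sigma ^+ 2) / N)%:C * a
    = (sigma ^+ 2 * (1 - b ^+ 2) / N)%:C * a.
  have -> : sigma ^+ 2 * (1 - b ^+ 2) / N = 1 - (1 - sigma ^+ 2) / N.
    by rewrite /N; field; rewrite exprMn; exact: (lt0r_neq0 N0).
  by move: ((1 - sigma ^+ 2) / N) => X; rewrite rmorphB rmorph1; ring.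
have k0 : 0 < (1 - b ^+ 2) / N by rewrite divr_gt0 // subr_gt0.
set k := _ / N in k0.
have -> : sigma ^+ 2 * (1 - b ^+ 2) / N = sigma * (sigma * k) by rewrite /k; ring.
have -> : sigma * (1 - b ^+ 2) / N = sigma * k by rewrite /k; ring.
rewrite cmodM cmod_real gtr0_norm; last first.
  by apply: mulr_gt0 => //; apply: mulr_gt0.
have -> : sigma * (sigma * k) * b = (sigma * k) * (sigma * b) by ring.
rewrite gtr_pMr; last exact: mulr_gt0.
apply: mulr_ilt1; rewrite ?cmod_ge0 ?(ltW s0) //.
exact: uniformizer_a1.
Qed.

End Uniformizer.

(** * Derivatives of Moebius maps *)

Section Derivatives.
Context {R : realType}.
Local Notation C := R[i].

(** The formula for [f] is assumed on a disk only: words are compositions made total by division by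
    zero, and agree with a Moebius map away from the poles. *)
Lemma derive1_moebius (f : C -> C) (A B p z : C) (e : R) :
  (forall w, cmod w < e -> f w = (A * w + B) / (1 - p * w)) ->
  (forall w, cmod w < e -> 1 - p * w != 0) -> cmod z < e ->
  derive1 f z = (A + B * p) / (1 - p * z) ^+ 2.
Proof.
move=> hf hp ze; set L := _ / _; rewrite derive1E /derive.
have m0 : 0 < cmod (1 - p * z) by rewrite cmod_gt0 hp.
apply: (cvg_lim (@norm_hausdorff _ _)) => V /nbhs_diskP[e1 e10 hV].
set m := cmod (1 - p * z) in m0.
pose K := cmod L * cmod p * 2 / m.
have K0 : 0 <= K by rewrite !mulr_ge0 ?cmod_ge0 ?invr_ge0 ?ltW.
(* The difference quotient misses [L] by exactly L p h / (1 - p (z + h)). The first bound keeps z +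
   h in the disk, the second keeps the denominator above m / 2, the third makes the error, at most K
   |h|, smaller than [e1]. *)
pose d := Num.min (e - cmod z) (Num.min (m / (2 * (cmod p + 1))) (e1 / (K + 1))).
have p1 : 0 < cmod p + 1 by rewrite ltr_wpDl ?cmod_ge0.
have K1 : 0 < K + 1 by rewrite ltr_wpDl.
have d0 : 0 < d.
  by rewrite /d !lt_min subr_gt0 ze /= !divr_gt0 // mulr_gt0.
rewrite /= nbhs_simpl /dnbhs /within /=; apply/nbhs_diskP; exists d => // h.
rewrite /disk /= subr0 /d !lt_min => /and3P[h1 h2 h3] h0.
apply: hV; rewrite (_ : h%:A = h); last exact: mulr1.
rewrite /disk /=.
have zh : cmod (h + z) < e by apply: le_lt_trans (cmodD _ _) _; lra.
have D0 := hp _ ze; have D1 := hp _ zh.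
rewrite (hf _ ze) (hf _ zh).
have -> : h^-1 *: ((A * (h + z) + B) / (1 - p * (h + z)) - (A * z + B) / (1 - p * z)) - L
     = L * p * h / (1 - p * (h + z)).
  transitivity (h^-1 * ((A * (h + z) + B) / (1 - p * (h + z)) - (A * z + B) / (1 - p * z)) - L).
    by [].
  by rewrite /L; field; rewrite ?D0 ?D1 ?h0.
have ph : cmod p * cmod h <= m / 2.
  apply: le_trans (_ : (cmod p + 1) * (m / (2 * (cmod p + 1))) <= _); last first.
    by rewrite le_eqVlt; apply/orP; left; apply/eqP; field; rewrite gt_eqF.
  by apply: ler_pM; rewrite ?cmod_ge0 ?lerDl // ltW.
have mD : m / 2 <= cmod (1 - p * (h + z)).
  have -> : 1 - p * (h + z) = (1 - p * z) - p * h by ring.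
  by have := cmodBr (1 - p * z) (p * h); rewrite cmodM -/m; lra.
rewrite (cmodM (L * p * h)) (cmodM (L * p)) (cmodM L) cmodV.
apply: le_lt_trans (_ : K * cmod h < _).
  have -> : K * cmod h = cmod L * cmod p * cmod h * (m / 2)^-1.
    by rewrite /K invf_div mulrAC -!mulrA; congr (_ * _); ring.
  rewrite ler_wpM2l ?mulr_ge0 ?cmod_ge0 // lef_pV2 // posrE ?divr_gt0 //.
  by apply: lt_le_trans mD; rewrite divr_gt0.
apply: le_lt_trans (_ : (K + 1) * cmod h < _); first by rewrite ler_wpM2r ?cmod_ge0 ?lerDl.
by rewrite mulrC -ltr_pdivlMr.
Qed.

Lemma derive1_Phi (a z : C) (e : R) : cmod a * e <= 1 -> cmod z < e ->
  derive1 (Phi a) z = phase a * (1 - a^* * a) / (1 - a^* * z) ^+ 2.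
Proof.
move=> ae ze; have e0 : 0 < e by apply: le_lt_trans ze; exact: cmod_ge0.
rewrite (@derive1_moebius _ (phase a) (- (phase a * a)) (a^*) z e) //.
- by congr (_ / _); ring.
- by move=> w _; rewrite /Phi mulrA mulrBr.
move=> w we; apply: cmod_conjM_lt1.
have [->|a0] := eqVneq a 0; first by rewrite cmod0 mul0r.
by apply: lt_le_trans ae; rewrite ltr_pM2l // cmod_gt0.
Qed.

End Derivatives.

(** * Words in the maps T_j *)

Section Words.
Context {R : realType} {s : nat}.
Context (c : 'I_s -> R[i]) (r : 'I_s -> R) (a : 'I_s -> R[i]) (sigma : 'I_s -> R).
Hypothesis cm : is_cmcd c r.
Hypothesis un : forall j, is_uniformizer (c j) (r j) (a j) (sigma j).
Hypothesis rho_gt0 : 0 < rho a.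
Local Notation C := R[i].
Local Notation T := (Tmap a sigma).
Implicit Types (z : C) (w : seq 'I_s) (j k : 'I_s).

Lemma radius_gt0 j : 0 < r j.
Proof. by case: cm. Qed.

Lemma center_radius_lt1 j : cmod (c j) + r j < 1.
Proof. by case: cm => _ h0 h1 _; exact: closed_disk_radius. Qed.
Local Notation rj0 := (radius_gt0 _).
Local Notation cr1 := (center_radius_lt1 _).

Lemma le_rho j : cmod (a j) <= rho a.
Proof. exact: le_bigmax. Qed.

Lemma rho_lt1 : rho a < 1.
Proof.
apply/bigmax_ltP; split=> // j _; exact: (uniformizer_a1 (un j)).
Qed.

Lemma rho_lt_inv : rho a < (rho a)^-1.
Proof.
apply: lt_trans rho_lt1 _; by rewrite invf_gt1 // rho_lt1.
Qed.

Lemma rho_mul_lt1 z : (cmod z < (rho a)^-1) = (rho a * cmod z < 1).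
Proof. by rewrite -[(rho a)^-1]mul1r ltr_pdivlMr // mulrC. Qed.

Lemma le1_in_domain z : cmod z <= 1 -> cmod z < (rho a)^-1.
Proof. by move=> h; apply: le_lt_trans h _; rewrite invf_gt1 // rho_lt1. Qed.

Lemma le_rho_in_domain z : cmod z <= rho a -> cmod z < (rho a)^-1.
Proof. by move=> h; apply: le1_in_domain; apply: le_trans h (ltW rho_lt1). Qed.

Lemma modulus_mul_lt1 j z : cmod z < (rho a)^-1 -> cmod (a j) * cmod z < 1.
Proof.
rewrite rho_mul_lt1; apply: le_lt_trans; by rewrite ler_wpM2r ?cmod_ge0 // le_rho.
Qed.

Lemma center_mul_lt1 j z : cmod z < (rho a)^-1 -> cmod (c j) * cmod z < 1.
Proof.
move=> /(modulus_mul_lt1 j); apply: le_lt_trans; rewrite ler_wpM2r ?cmod_ge0 //.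
exact: (cmod_center_le rj0 cr1 (un j)).
Qed.

Lemma TmapE j z : cmod z < (rho a)^-1 ->
  T j z = c j + (r j ^+ 2)%:C * z / (1 - (c j)^* * z).
Proof.
by move=> h; apply: (reflection_eq rj0 cr1 (un j)); exact: modulus_mul_lt1.
Qed.

Lemma Tmap_le_max j z : cmod z < (rho a)^-1 ->
  cmod (T j z) <= Num.max (cmod z) (cmod (a j)).
Proof.
move=> h; rewrite TmapE //; apply: le_trans (reflection_le_majorant rj0 _) _.
  exact: center_mul_lt1.
by apply: (majorant_le_max rj0 cr1 (un j)); rewrite ?cmod_ge0 ?modulus_mul_lt1.
Qed.

(** The bound is the majorant at rho, which lies strictly below rho because |a_j| < rho and |a_j|
    rho < 1. *)
Lemma Tmap_contracts j : cmod (a j) < rho a -> exists2 g, 0 <= g < rho a &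
  forall z, cmod z <= rho a -> cmod (T j z) <= g.
Proof.
move=> aj; have dr : cmod (rho a)%:C < (rho a)^-1.
  by apply: le_rho_in_domain; rewrite cmod_real ger0_norm // ltW.
have rr : cmod (rho a)%:C = rho a by rewrite cmod_real gtr0_norm.
exists (majorant (c j) (r j) (rho a)) => [|z hz].
  apply/andP; split.
    have := center_mul_lt1 j dr; rewrite rr => h.
    rewrite /majorant addr_ge0 ?cmod_ge0 // divr_ge0 ?subr_ge0 ?ltW //.
    by rewrite mulr_gt0 // exprn_gt0 // radius_gt0.
  apply: (majorant_lt rj0 cr1 (un j)) => //.
  by have := modulus_mul_lt1 j dr; rewrite rr.
have dz := le_rho_in_domain hz.
rewrite TmapE //; apply: le_trans (reflection_le_majorant rj0 _) _.
  exact: center_mul_lt1.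
apply: majorant_le => //; first exact: cmod_ge0.
by have := center_mul_lt1 j dr; rewrite rr.
Qed.

Lemma Tmap_in_disk j z : cmod z <= 1 -> cmod (T j z - c j) <= r j.
Proof.
by move=> h; rewrite TmapE ?le1_in_domain //; exact: (reflection_in_disk rj0 cr1).
Qed.

Lemma Tmap_inj j z z' : cmod z < (rho a)^-1 -> cmod z' < (rho a)^-1 ->
  T j z = T j z' -> z = z'.
Proof.
move=> h h'; rewrite !TmapE // => /addrI; rewrite -!mulrA.
have r0 : (r j ^+ 2)%:C != 0 :> C.
  by rewrite (fmorph_eq0 (real_complex R)) expf_neq0 // gt_eqF // radius_gt0.
move=> /(mulfI r0).
have d := cmod_conjM_lt1 (center_mul_lt1 j h).
have d' := cmod_conjM_lt1 (center_mul_lt1 j h').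
move=> /eqP; rewrite eqr_div // => /eqP e.
have : z - z' = z * (1 - (c j)^* * z') - z' * (1 - (c j)^* * z) by ring.
by rewrite e subrr => /eqP; rewrite subr_eq0 => /eqP.
Qed.

Lemma disk_disjoint j k z : cmod (z - c j) <= r j -> cmod (z - c k) <= r k -> j = k.
Proof.
move=> hj hk; apply/eqP; apply: contraT => jk; case: cm => _ r0 _ dis.
have : (closure (disk (c j) (r j)) `&` closure (disk (c k) (r k))) z.
  by rewrite !closure_disk.
by rewrite dis.
Qed.

Definition tau w : C -> C := foldr (fun j f => T j \o f) id w.

(** The derivative of [tau w] as a chain-rule product of explicit factors; it is identified with
    [derive1] on |z| < 1 / rho. *)
Fixpoint dtau w z : C :=
  if w is j :: w' then
    (r j ^+ 2)%:C / (1 - (c j)^* * tau w' z) ^+ 2 * dtau w' z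
  else 1.

Lemma tau_cons j w z : tau (j :: w) z = T j (tau w z).
Proof. by []. Qed.

Lemma tau_le_max w z : cmod z < (rho a)^-1 -> cmod (tau w z) <= Num.max (cmod z) (rho a).
Proof.
move=> h; elim: w => [|j w IH]; first by rewrite /= le_max lexx.
have h' : cmod (tau w z) < (rho a)^-1.
  by apply: le_lt_trans IH _; rewrite gt_max h rho_lt_inv.
rewrite tau_cons; apply: le_trans (Tmap_le_max j h') _.
by rewrite ge_max IH le_max le_rho orbT.
Qed.

Lemma tau_domain w z : cmod z < (rho a)^-1 -> cmod (tau w z) < (rho a)^-1.
Proof.
by move=> h; apply: le_lt_trans (tau_le_max w h) _; rewrite gt_max h rho_lt_inv.
Qed.

Lemma tau_le_rho w z : cmod z <= rho a -> cmod (tau w z) <= rho a.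
Proof.
move=> h; apply: le_trans (tau_le_max w (le_rho_in_domain h)) _.
by rewrite ge_max h lexx.
Qed.

Lemma tau_le1 w z : cmod z <= 1 -> cmod (tau w z) <= 1.
Proof.
move=> h; apply: le_trans (tau_le_max w (le1_in_domain h)) _.
by rewrite ge_max h ltW // rho_lt1.
Qed.

Lemma tau_cons_in_disk j w z : cmod z <= 1 -> cmod (tau (j :: w) z - c j) <= r j.
Proof. by move=> h; rewrite tau_cons Tmap_in_disk // tau_le1. Qed.

(** Compositions keep the form (A z + B) / (1 - p z) because 0 is never a pole; |p| <= rho says that
    no pole enters the domain |z| < 1 / rho. *)
Lemma tau_moebius w : exists A B p : C, cmod p <= rho a /\
  forall z, cmod z < (rho a)^-1 ->
    tau w z = (A * z + B) / (1 - p * z) /\ dtau w z = (A + B * p) / (1 - p * z) ^+ 2.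
Proof.
have den p z : cmod p <= rho a -> cmod z < (rho a)^-1 -> 1 - p * z != 0.
  move=> hp; rewrite rho_mul_lt1 => hz.
  have := @cmod_conjM_lt1 _ (p^*) z; rewrite conjCK; apply; rewrite cmod_conj.
  by apply: le_lt_trans hz; rewrite ler_wpM2r ?cmod_ge0.
elim: w => [|j w [A [B [p [hp IH]]]]].
  exists 1, 0, 0; rewrite cmod0 ltW //; split=> // z _.
  by rewrite /= !(mul0r, mul1r, addr0, subr0, divr1, expr1n).
pose k := (r j ^+ 2)%:C - c j * (c j)^*.
have z0 : cmod (0 : C) < (rho a)^-1 by rewrite cmod0 invr_gt0.
have tau0 : tau w 0 = B by rewrite (proj1 (IH 0 z0)) !mulr0 add0r subr0 divr1.
pose D := 1 - (c j)^* * B.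
have D0 : D != 0.
  by rewrite /D -tau0 cmod_conjM_lt1 // center_mul_lt1 // tau_domain.
exists ((k * A - c j * p) / D), ((c j + k * B) / D), ((p + (c j)^* * A) / D).
have key z : cmod z < (rho a)^-1 ->
    1 - (c j)^* * tau w z = D * (1 - (p + (c j)^* * A) / D * z) / (1 - p * z).
  move=> hz; have := den _ _ hp hz => dz.
  by rewrite (proj1 (IH z hz)); move: (D0); rewrite /D => D0'; field; rewrite ?dz ?D0'.
have tD z : cmod z < (rho a)^-1 -> 1 - (c j)^* * tau w z != 0.
  by move=> hz; rewrite cmod_conjM_lt1 // center_mul_lt1 // tau_domain.
split.
  (* Otherwise 1 / p' would lie in the domain and be a zero of 1 - conj(c_j) tau, which does not
     vanish there. *)
  rewrite leNgt; apply/negP => lt.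
  set p' := _ / D in lt key *.
  have p'0 : p' != 0 by rewrite -cmod_gt0; apply: lt_trans lt.
  have hz : cmod p'^-1 < (rho a)^-1 by rewrite cmodV ltf_pV2 // posrE cmod_gt0.
  by have := tD _ hz; rewrite key // divff // subrr mulr0 mul0r eqxx.
move=> z hz; have [e1 e2] := IH z hz; have dz := den _ _ hp hz.
have tz := tD z hz; have kz := key z hz.
have q0 : 1 - (p + (c j)^* * A) / D * z != 0.
  by apply: contraNneq tz => q0; rewrite kz q0 mulr0 mul0r.
have q1 : D - (p + (c j)^* * A) * z != 0.
  have -> : D - (p + (c j)^* * A) * z = D * (1 - (p + (c j)^* * A) / D * z) by field.
  by rewrite mulf_neq0.
split.
  rewrite tau_cons TmapE ?tau_domain // kz e1.
  have q1' := q1; rewrite /D in q1' D0 *; rewrite /k; move: (_%:C) => rr.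
  by field; rewrite ?D0 ?dz ?q1'.
rewrite /= kz e2; have q1' := q1; have D0' := D0; rewrite /D in q1' D0' *; rewrite /k; move: (_%:C) => rr.
by field; rewrite ?D0' ?dz ?q1'.
Qed.

Lemma derive1_tau w z : cmod z < (rho a)^-1 -> derive1 (tau w) z = dtau w z.
Proof.
move=> hz; have [A [B [p [hp h]]]] := tau_moebius w.
rewrite (@derive1_moebius _ _ A B p z (rho a)^-1) //.
- by rewrite (proj2 (h z hz)).
- by move=> v hv; rewrite (proj1 (h v hv)).
move=> v; rewrite rho_mul_lt1 => hv.
have := @cmod_conjM_lt1 _ (p^*) v; rewrite conjCK; apply; rewrite cmod_conj.
by apply: le_lt_trans hv; rewrite ler_wpM2r ?cmod_ge0.
Qed.

(* [tau w] is a Moebius map whose pole has modulus at least [1 / rho]. *)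
Lemma dtau_distortion w z : cmod z < (rho a)^-1 ->
  cmod (dtau w z) <= cmod (dtau w 0) / (1 - rho a * cmod z) ^+ 2.
Proof.
move=> hz; have [A [B [p [hp h]]]] := tau_moebius w.
have z0 : cmod (0 : C) < (rho a)^-1 by rewrite cmod0 invr_gt0.
rewrite (proj2 (h z hz)) (proj2 (h 0 z0)) mulr0 subr0 expr1n divr1.
rewrite cmodM cmodV cmodX ler_wpM2l ?cmod_ge0 //.
have hz' := hz; rewrite rho_mul_lt1 in hz'.
have h1 : 1 - rho a * cmod z <= cmod (1 - p * z).
  have := cmodBr 1 (p * z); rewrite cmod1 cmodM; apply: le_trans.
  by rewrite lerD2l lerN2 ler_wpM2r ?cmod_ge0.
have h0 : 0 < 1 - rho a * cmod z by rewrite subr_gt0.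
have h2 : 0 < cmod (1 - p * z) by apply: lt_le_trans h1.
by rewrite lef_pV2 ?posrE ?exprn_gt0 // ler_pXn2r // nnegrE ltW.
Qed.

(** Evaluation at the boundary point 1: a nonempty word sends it into a closed hole, hence not to 1,
    and since the holes are disjoint the image reveals the outermost letter, which is then cancelled
    by injectivity. *)
Lemma tau_inj w w' : (forall z, cmod z < (rho a)^-1 -> tau w z = tau w' z) -> w = w'.
Proof.
have c1 : cmod (1 : C) <= 1 by rewrite cmod1.
have fix1 j v : tau (j :: v) 1 <> 1.
  move=> e; have := tau_cons_in_disk j v c1; rewrite e => h.
  have := cmodD (1 - c j) (c j); rewrite subrK cmod1 leNgt => /negP; apply.
  by apply: le_lt_trans (center_radius_lt1 j); rewrite addrC lerD2l.
elim: w w' => [|j w IH] [|k w'] // h.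
- by case: (fix1 k w'); rewrite -h // le1_in_domain.
- by case: (fix1 j w); rewrite h // le1_in_domain.
have jk : j = k.
  apply: (@disk_disjoint j k (tau (j :: w) 1)); first exact: tau_cons_in_disk.
  by rewrite h ?le1_in_domain //; exact: tau_cons_in_disk.
rewrite -jk in h *; congr (_ :: _); apply: IH => z hz.
by apply: (@Tmap_inj j); rewrite ?tau_domain //; exact: h.
Qed.

Lemma Tcal_tau w : Tcal a sigma (tau w).
Proof. by exists w. Qed.

(** Summability is extracted at the single point 0; [dtau_distortion] carries it to the unit
    disk. *)
Lemma dtau_summable0 : Tcal_derivatives_summable a sigma ->
  exists2 S, 0 <= S & forall ws : seq (seq 'I_s), uniq ws ->
    \sum_(w <- ws) cmod (dtau w 0) <= S.
Proof.
move=> hs; have z0 : cmod (0 : C) < (rho a)^-1 by rewrite cmod0 invr_gt0.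
have U0 : disk 0 (rho a)^-1 (0 : C) by rewrite /disk /= subrr.
have [S hS] := locally_uniformly_summable_bounded hs U0 (fun _ _ => cmod_ge0 _).
have bd : forall ws : seq (seq 'I_s), uniq ws -> \sum_(w <- ws) cmod (dtau w 0) <= S.
  move=> ws uws; pose el w : Tcal a sigma := SigSub (mem_set (Tcal_tau w)).
  have uel : uniq (map el ws).
    rewrite map_inj_uniq // => w w' /(congr1 val) /= e.
    by apply: tau_inj => z _; rewrite e.
  have [J _ hJ] := fset_of_uniq uel.
  have := hS J; rewrite hJ big_map; apply: le_trans.
  by apply: ler_sum => w _; rewrite /= derive1_tau.
exists S => //; have := bd [::] isT; by rewrite big_nil.
Qed.

End Words.

(** * Taylor bounds for the complex exponential *)

Section ComplexExponential.
Context {R : realType}.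
Local Notation C := R[i].

Lemma lipschitz_at0 (f df : R -> R) (y M : R) :
  (forall x : R, is_derive x 1 f (df x)) -> (forall x, `|x| <= `|y| -> `|df x| <= M) ->
  `|f y - f 0| <= M * `|y|.
Proof.
move=> hd hM.
have cf : continuous f by move=> x; apply: differentiable_continuous; apply/derivable1_diffP; have [] := hd x.
have cfw A : {within A, continuous f} by exact: continuous_subspaceT.
have [y0|y0] := leP 0 y.
  have [x] := MVT_segment y0 (fun x _ => hd x) (cfw _).
  rewrite in_itv /= => /andP[x0 xy] ->; rewrite subr0 normrM ler_wpM2r // hM //.
  by rewrite !ger0_norm.
have [x] := MVT_segment (ltW y0) (fun x _ => hd x) (cfw _).
rewrite in_itv /= => /andP[xy x0] e; rewrite distrC e sub0r normrM normrN ler_wpM2r // hM //.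
by rewrite !ler0_norm ?lerN2 // ltW.
Qed.

Lemma abs_sin_le (y : R) : `|sin y| <= `|y|.
Proof.
have := @lipschitz_at0 sin cos y 1 _ _; rewrite sin0 subr0 mul1r; apply.
by move=> x _; rewrite ler_norml cos_geN1 cos_le1.
Qed.

Lemma abs_cos_sub1_le (y : R) : `|cos y - 1| <= `|y| * `|y|.
Proof.
have := @lipschitz_at0 cos (fun x => - sin x) y `|y| _ _; rewrite cos0; apply.
by move=> x hx; rewrite normrN; apply: le_trans (abs_sin_le x) _.
Qed.

Lemma abs_cos_sub1_le1 (y : R) : `|cos y - 1| <= `|y|.
Proof.
have := @lipschitz_at0 cos (fun x => - sin x) y 1 _ _; rewrite cos0 mul1r; apply.
by move=> x _; rewrite normrN ler_norml sin_geN1 sin_le1.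
Qed.

Lemma abs_sin_sub_le (y : R) : `|sin y - y| <= `|y| * `|y|.
Proof.
have := @lipschitz_at0 (fun x => sin x - x) (fun x => cos x - 1) y `|y| _ _.
rewrite sin0 !subr0; apply.
by move=> x hx; apply: le_trans (abs_cos_sub1_le1 x) _.
Qed.

Lemma expR_sub1_le (x : R) : x <= 0 -> `|expR x - 1| <= `|x|.
Proof.
move=> x0; have h := expR_ge1Dx x; have h1 : expR x <= 1 by rewrite -expR0 ler_expR.
by rewrite !ler0_norm //; lra.
Qed.

Lemma expR_sub1x_le (x : R) : x <= 0 -> `|expR x - 1 - x| <= `|x| * `|x|.
Proof.
move=> x0; have h := expR_ge1Dx x; rewrite ger0_norm; last by lra.
rewrite ler0_norm // mulrNN.
have h1 := expR_ge1Dx (- x); have e0 := expR_gt0 x.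
have e1 : expR x * expR (- x) = 1 by rewrite expRN divff // gt_eqF.
have : expR x * (1 + - x) <= 1 by rewrite -[X in _ <= X]e1 ler_pM2l.
nra.
Qed.

(** On the closed left half-plane exp(Re t) <= 1, which keeps the error quadratic with an absolute
    constant. *)
Lemma cexp_taylor2 (t : C) : Re t <= 0 ->
  cmod (cexp t - 1 - t) <= 3 * cmod t ^+ 2.
Proof.
rewrite cmod_sqr => x0; apply: le_trans (cmod_le_ReIm _) _.
case: t x0 => x y /= x0; rewrite !mul0r !subr0 !addr0.
have h1 := expR_sub1x_le x0; have h2 := abs_cos_sub1_le y.
have h3 := expR_sub1_le x0; have h4 := abs_sin_le y; have h5 := abs_sin_sub_le y.
have e1 : 0 < expR x <= 1 by rewrite expR_gt0 -expR0 ler_expR.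
have i1 : `|expR x * cos y - 1 - x| <= `|x| * `|x| + `|y| * `|y|.
  have -> : expR x * cos y - 1 - x = (expR x - 1 - x) + expR x * (cos y - 1) by ring.
  apply: le_trans (ler_normD _ _) _; apply: lerD => //; case/andP: e1 => e0 e1.
  rewrite normrM gtr0_norm //; apply: le_trans h2; rewrite ler_piMl //.
have i2 : `|expR x * sin y - y| <= `|x| * `|y| + `|y| * `|y|.
  have -> : expR x * sin y - y = (expR x - 1) * sin y + (sin y - y) by ring.
  by apply: le_trans (ler_normD _ _) _; apply: lerD => //; rewrite normrM ler_pM.
rewrite -[x ^+ 2]real_normK ?num_real // -[y ^+ 2]real_normK ?num_real //.
apply: le_trans (lerD i1 i2) _; move: `|x| `|y| (normr_ge0 x) (normr_ge0 y) => p q p0 q0.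
have : 0 <= (p - q) ^+ 2 by exact: sqr_ge0.
nra.
Qed.

Lemma cmod_cexp (t : C) : cmod (cexp t) = expR (Re t).
Proof.
rewrite /cexp cmodM cmod_real gtr0_norm ?expR_gt0 //.
suff -> : cmod (cos (Im t) +i* sin (Im t)) = 1 by rewrite mulr1.
by rewrite /= cos2Dsin2 sqrtr1.
Qed.

Lemma cexpD (t u : C) : cexp (t + u) = cexp t * cexp u.
Proof.
rewrite /cexp ReD ImD expRD cosD sinD rmorphM mulrACA; congr (_ * _).
by apply/eqP; rewrite eq_complex /=; apply/andP; split; apply/eqP; ring.
Qed.

Lemma cexpX (t : C) n : cexp (n%:R * t) = cexp t ^+ n.
Proof.
elim: n => [|n IH]; last by rewrite -natr1 mulrDl mul1r cexpD IH exprSr.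
by rewrite mul0r expr0 /cexp /= expR0 cos0 sin0 mul1r.
Qed.

Lemma cmod_subX (x y : C) (m : R) n : cmod x <= m -> cmod y <= m ->
  cmod (x ^+ n - y ^+ n) <= n%:R * cmod (x - y) * m ^+ n.-1.
Proof.
move=> hx hy; have m0 : 0 <= m by apply: le_trans hx; exact: cmod_ge0.
rewrite subrXX cmodM [n%:R * _]mulrC -mulrA ler_wpM2l ?cmod_ge0 //.
apply: le_trans (cmod_sum _ _ _) _.
apply: (@le_trans _ _ (\sum_(i < n) m ^+ n.-1)); last by rewrite sumr_const card_ord mulr_natl lexx.
apply: ler_sum => i _; rewrite cmodM !cmodX.
have -> : n.-1 = (n.-1 - i + i)%N by rewrite subnK //; case: n i => [[]//|n i]; rewrite -ltnS.
rewrite addnK exprD; apply: ler_pM; rewrite ?exprn_ge0 ?cmod_ge0 //.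
  by rewrite lerXn2r ?nnegrE ?cmod_ge0.
by rewrite lerXn2r ?nnegrE ?cmod_ge0.
Qed.

End ComplexExponential.

(** * Sums along geometric grids *)

Section GeometricGrid.
Context {R : realType}.

(* [t / (1 + t)] telescopes along a geometric grid. *)
Lemma geometric_grid_sum (theta t : R) V : 0 < theta < 1 -> 0 <= t ->
  \sum_(v < V) theta ^+ v * t / (1 + theta ^+ v * t) ^+ 2 <= (1 - theta)^-1.
Proof.
move=> /andP[h0 h1] t0.
have th : 0 < 1 - theta by rewrite subr_gt0.
rewrite -[_^-1]mul1r ler_pdivlMr // mulrC big_distrr /=.
pose g v := theta ^+ v * t / (1 + theta ^+ v * t).
have gV v : 0 <= theta ^+ v * t by rewrite mulr_ge0 // exprn_ge0 // ltW.
apply: (@le_trans _ _ (\sum_(v < V) (g v - g v.+1))).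
  apply: ler_sum => v _; rewrite /g.
  have -> : theta ^+ v.+1 * t = theta * (theta ^+ v * t) by rewrite exprS -mulrA.
  move: (gV v); set y := theta ^+ v * t => y0.
  have y1 : 0 < 1 + y by lra.
  have ty : 0 <= theta * y by rewrite mulr_ge0 // ltW.
  have y2 : 0 < 1 + theta * y by lra.
  have -> : y / (1 + y) - theta * y / (1 + theta * y) = (1 - theta) * y / ((1 + y) * (1 + theta * y)).
    by field; rewrite !gt_eqF.
  rewrite -[X in _ <= X]mulrA ler_wpM2l ?(ltW th) // ler_wpM2l // expr2 lef_pV2 ?posrE ?mulr_gt0 //.
  by rewrite ler_pM2l // lerD2l ler_piMl // ltW.
have -> : \sum_(v < V) (g v - g v.+1) = g 0%N - g V.
  elim: V => [|V IH]; first by rewrite big_ord0 subrr.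
  by rewrite big_ord_recr /= IH; ring.
rewrite /g; have := gV V; have := gV 0%N; rewrite expr0 mul1r => _.
set y := theta ^+ V * t => y0.
have k0 : 0 <= y / (1 + y) by rewrite divr_ge0 //; lra.
have k1 : t / (1 + t) <= 1 by rewrite ler_pdivrMr; lra.
by lra.
Qed.

(** Here exp(k t) = exp(k t / 4)^4 >= (1 + k t / 4)^4, and 1 + t <= (1 + 4 / k) (1 + k t / 4). Four
    powers are what the comparison of a grid term with an exponential consumes. *)
Lemma expR_dominates4 (k : R) : 0 < k -> exists2 K, 0 < K &
  forall t, 0 <= t -> (1 + t) ^+ 4 * expR (- (k * t)) <= K.
Proof.
move=> k0; pose m := 1 + 4 / k.
have m0 : 0 < m by rewrite addr_gt0 // divr_gt0.
exists (m ^+ 4); first by rewrite exprn_gt0.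
move=> t t0; rewrite expRN ler_pdivrMr ?expR_gt0 //.
have -> : k * t = 4%:R * (k / 4 * t) by field.
rewrite expRM_natl -exprMn; apply: lerXn2r; rewrite ?nnegrE ?mulr_ge0 ?expR_ge0 ?(ltW m0) ?addr_ge0 //.
apply: le_trans (_ : m * (1 + k / 4 * t) <= _); last by rewrite ler_wpM2l ?expR_ge1Dx ?ltW.
have -> : m * (1 + k / 4 * t) = 1 + 4 / k + k / 4 * t + t by rewrite /m; field; rewrite gt_eqF.
have : 0 <= 4 / k by rewrite divr_ge0 // ltW.
have : 0 <= k / 4 * t by rewrite mulr_ge0 // divr_ge0 // ltW.
by lra.
Qed.

(** [Negz v] is -(v + 1), so the two one-sided bounds cover the indices >= 0 and < 0. *)
Lemma int_fset_sum_le (F : int -> R) (p q : R) :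
  (forall z, 0 <= F z) ->
  (forall M, \sum_(v < M) F (Posz v) <= p) -> (forall M, \sum_(v < M) F (Negz v) <= q) ->
  forall J : {fset int}, \sum_(z <- J) F z <= p + q.
Proof.
move=> F0 hp hq J; pose M := (\max_(z <- J) `|z|%N).+1.
have JM z : z \in J -> (`|z| < M)%N.
  by move=> zJ; rewrite /M ltnS (big_rem z) //= leq_max leqnn.
pose L := [seq Posz (v : 'I_M) | v <- index_enum 'I_M] ++ [seq Negz (v : 'I_M) | v <- index_enum 'I_M].
have injP : injective (fun v : 'I_M => Posz v) by move=> x y [e]; exact: val_inj.
have injN : injective (fun v : 'I_M => Negz v) by move=> x y [e]; exact: val_inj.
have uL : uniq L.
  rewrite cat_uniq (map_inj_uniq injP) (map_inj_uniq injN) !index_enum_uniq /=.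
  by rewrite andbT; apply/hasPn => z /mapP[v _ ->]; apply/mapP => -[].
have sub : {subset J <= L}.
  move=> z /JM; case: z => v /= vM; rewrite mem_cat; apply/orP; [left|right].
    by apply/mapP; exists (Ordinal vM); rewrite ?mem_index_enum.
  by apply/mapP; exists (Ordinal (ltnW vM)); rewrite ?mem_index_enum.
apply: le_trans (ler_sum_uniq F0 (fset_uniq J) uL sub) _.
by rewrite big_cat !big_map /=; apply: lerD; [exact: hp|exact: hq].
Qed.

Lemma sum_expr_le (theta : R) V : 0 < theta < 1 -> \sum_(v < V) theta ^+ v <= (1 - theta)^-1.
Proof.
move=> /andP[t0 t1]; have h : 0 < 1 - theta by rewrite subr_gt0.
rewrite -[_^-1]mul1r ler_pdivlMr // mulrC -opprB mulNr -subrX1 opprB lerBlDr lerDl.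
by rewrite exprn_ge0 // ltW.
Qed.

Lemma tail_sum_expr_le (theta : R) V M : 0 < theta < 1 ->
  \sum_(v < M) (if (V < v)%N then theta ^+ v else 0) <= theta ^+ V / (1 - theta).
Proof.
move=> ht; have /andP[t0 t1] := ht; pose F (v : nat) := if (V < v)%N then theta ^+ v else 0.
have F0 v : 0 <= F v by rewrite /F; case: ifP => // _; rewrite exprn_ge0 // ltW.
apply: (@le_trans _ _ (\sum_(v < M + V.+1) F v)).
  by rewrite big_split_ord /= lerDl sumr_ge0.
rewrite addnC big_split_ord /= big1 ?add0r; last first.
  by move=> v _; rewrite /F ltnNge -ltnS ltn_ord.
apply: (@le_trans _ _ (\sum_(v < M) theta ^+ V * theta ^+ v)).
  apply: ler_sum => v _; rewrite /F -exprD.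
  have -> : (V < V.+1 + v)%N by rewrite addSn ltnS leq_addr.
  by rewrite ler_wiXn2l ?(ltW t0) ?(ltW t1) // addSn.
by rewrite -mulr_sumr ler_wpM2l ?exprn_ge0 ?(ltW t0) // sum_expr_le.
Qed.

Lemma expR_dominates3 (t : R) : 0 < t -> expR (- t) <= 27 / t ^+ 3.
Proof.
move=> t0; rewrite expRN -[27 / _]invrK lef_pV2 ?posrE ?expR_gt0 //; last first.
  by rewrite invr_gt0 divr_gt0 // exprn_gt0.
rewrite invf_div; have -> : t = 3%:R * (t / 3) by field.
rewrite expRM_natl; have -> : (3 * (t / 3)) ^+ 3 / 27 = (t / 3) ^+ 3 by field.
rewrite lerXn2r ?nnegrE ?expR_ge0 //; first by rewrite divr_ge0 // ltW.
by apply: le_trans (expR_ge1Dx _); rewrite lerDr.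
Qed.

End GeometricGrid.

(** * The sum over the powers of one map, compared with the theta series *)

Section InnerSum.
Context {R : realType} (a : R[i]) (theta delta : R).
Local Notation C := R[i].
Local Notation b := (cmod a).
Local Notation al := ((cmod a)^-1 - cmod a).
Hypothesis b_bounds : 0 < b < 1.
Hypothesis theta_bounds : 0 < theta < 1.
Hypothesis delta_gt0 : 0 < delta.

(* [PhiV a u = a * PhiV_ratio u] for [a != 0]. *)
Definition PhiV_ratio (u : C) : C := (1 + (b^-1)%:C * u) / (1 + b%:C * u).

(* For [w = Phi a z] the first inequality says that [|z| <= |a|]. *)
Definition far_left (w : C) := 2 * Re w + cmod w ^+ 2 * (b^-1 + b) <= 0
  /\ Re w <= - delta.

Let b0 : 0 < b. Proof. by case/andP: b_bounds. Qed.
Let b1 : b < 1. Proof. by case/andP: b_bounds. Qed.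
Let t0 : 0 < theta. Proof. by case/andP: theta_bounds. Qed.
Let t1 : theta < 1. Proof. by case/andP: theta_bounds. Qed.

Let al0 : 0 < al.
Proof. by rewrite subr_gt0; apply: lt_trans b1 _; rewrite invf_gt1. Qed.

Lemma far_left_le1 w : far_left w -> cmod w <= 1.
Proof.
move=> [h _]; have := Re_le_cmod w; rewrite ler_norml => /andP[h1 _].
have h2 : 2 <= b^-1 + b.
  rewrite -subr_ge0; have -> : b^-1 + b - 2 = (1 - b) ^+ 2 / b by field; rewrite gt_eqF.
  by rewrite divr_ge0 ?sqr_ge0 // ltW.
have c0 := cmod_ge0 w; rewrite leNgt; apply/negP => c1.
have : cmod w < cmod w ^+ 2 by rewrite expr2 ltr_pMr // (lt_trans ltr01).
have : cmod w ^+ 2 * 2 <= cmod w ^+ 2 * (b^-1 + b) by rewrite ler_wpM2l ?sqr_ge0.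
by lra.
Qed.

Let den_ge x w : 0 <= x <= 1 -> far_left w -> 1 - b <= cmod (1 + b%:C * (x%:C * w)) <= 2.
Proof.
move=> /andP[x0 x1] /far_left_le1 w1; have w0 := cmod_ge0 w.
have h : cmod (b%:C * (x%:C * w)) <= b.
  rewrite !cmodM !cmod_real !ger0_norm ?(ltW b0) // ler_piMr ?(ltW b0) //.
  by rewrite mulr_ile1.
apply/andP; split.
  by have := cmodDr 1 (b%:C * (x%:C * w)); rewrite cmod1; lra.
apply: le_trans (cmodD _ _) _; rewrite cmod1.
by apply: le_trans (lerD (lexx 1) (le_trans h (ltW b1))) _; lra.
Qed.

(** A rate at which |[PhiV_ratio] (x w)| decays in x. The factor 1 - theta is available because the
    grid starts at theta: at x = 1 the ratio has modulus |z| / |a|, which may equal 1. The 4 bounds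
    |1 + b x w|^2. *)
Definition decay := al * delta * (1 - theta) / 4.

Lemma decay_gt0 : 0 < decay.
Proof. by rewrite divr_gt0 // mulr_gt0 ?subr_gt0 // mulr_gt0. Qed.

Lemma ratio_decay x w : 0 <= x <= theta -> far_left w ->
  cmod (PhiV_ratio (x%:C * w)) <= expR (- (decay * x)).
Proof.
move=> /andP[x0 xt] hw; have x1 : x <= 1 by apply: le_trans xt (ltW t1).
have x01 : 0 <= x <= 1 by rewrite x0.
have /andP[d1 d2] := den_ge x01 hw.
have d0 : 0 < cmod (1 + b%:C * (x%:C * w)) by apply: lt_le_trans d1; rewrite subr_gt0.
have [hw1 hw2] := hw.
rewrite -(ler_pXn2r (n := 2)) ?nnegrE ?cmod_ge0 ?expR_ge0 //.
rewrite -expRM_natl; apply: le_trans (expR_ge1Dx _).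
rewrite /PhiV_ratio cmodM cmodV exprMn exprVn ler_pdivrMr ?exprn_gt0 //.
set D := cmod (1 + b%:C * _) in d0 d1 d2 *.
(* In this difference of squared moduli [far_left] bounds the part quadratic in w by -2 x Re w,
   which leaves at most 2 Re w (1 - x) in the inner factor. *)
have key : cmod (1 + (b^-1)%:C * (x%:C * w)) ^+ 2 - D ^+ 2
     = al * (x * (2 * Re w + x * (cmod w ^+ 2 * (b^-1 + b)))).
  rewrite /D !cmod_sqr; have := b0; move: (b) => B B0.
  by case: (w) => u v /=; field; rewrite gt_eqF.
have h1 : 2 * Re w + x * (cmod w ^+ 2 * (b^-1 + b)) <= - (2 * delta * (1 - theta)).
  apply: (@le_trans _ _ (2 * Re w * (1 - x))).
    have : x * (cmod w ^+ 2 * (b^-1 + b)) <= x * - (2 * Re w).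
      by rewrite ler_wpM2l //; lra.
    by lra.
  have : (1 - theta) * delta <= (1 - x) * - Re w.
    by apply: ler_pM; [rewrite subr_ge0 ltW|exact: ltW|rewrite lerD2l lerN2|lra].
  by lra.
have h2 : al * (x * (2 * Re w + x * (cmod w ^+ 2 * (b^-1 + b))))
    <= al * (x * - (2 * delta * (1 - theta))).
  by rewrite ler_pM2l // ler_wpM2l.
have D4 : D ^+ 2 <= 4.
  have -> : 4 = 2 ^+ 2 :> R by rewrite expr2; lra.
  by rewrite lerXn2r ?nnegrE // ltW.
have kx : 0 <= decay * x by rewrite mulr_ge0 // ltW // decay_gt0.
have h3 : 2 * (decay * x) * D ^+ 2 <= 2 * (decay * x) * 4 by rewrite ler_wpM2l // mulr_ge0.
have h4 : 2 * (decay * x) * 4 = al * (x * (2 * delta * (1 - theta))).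
  by rewrite /decay; field; rewrite gt_eqF.
by lra.
Qed.

Lemma exp_decay x w : 0 <= x -> far_left w ->
  cmod (cexp (al%:C * (x%:C * w))) <= expR (- (decay * x)).
Proof.
move=> x0 [_ hw]; rewrite cmod_cexp !Re_rM ler_expR.
have h : decay <= al * delta.
  rewrite /decay -mulrA ler_piMr ?mulr_ge0 ?(ltW al0) ?(ltW delta_gt0) //.
  have := t0; lra.
have : al * (x * Re w) <= al * (x * - delta) by rewrite ler_pM2l // ler_wpM2l.
have : decay * x <= al * delta * x by rewrite ler_wpM2r.
by lra.
Qed.

(** Both functions are 1 + alpha u + O(u^2) at u = 0, with alpha = 1 / |a| - |a| the derivative of
    the ratio at 0; this is the origin of alpha in the exponent. *)
Lemma ratio_exp_close : exists2 K, 0 <= K & forall x w, 0 <= x <= 1 -> far_left w ->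
  cmod (PhiV_ratio (x%:C * w) - cexp (al%:C * (x%:C * w))) <= K * x ^+ 2.
Proof.
exists (al * b / (1 - b) + 3 * al ^+ 2).
  by rewrite addr_ge0 ?mulr_ge0 ?sqr_ge0 ?invr_ge0 ?(ltW al0) ?(ltW b0) // subr_ge0 ltW.
move=> x w hx hw; have /andP[x0 x1] := hx.
have /andP[d1 _] := den_ge hx hw; have w1 := far_left_le1 hw.
set u := x%:C * w in d1 *.
have d0 : 0 < cmod (1 + b%:C * u) by apply: lt_le_trans d1; rewrite subr_gt0.
have ux : cmod u <= x by rewrite cmodM cmod_real ger0_norm // ler_piMr.
have u2 : cmod u ^+ 2 <= x ^+ 2 by rewrite lerXn2r ?nnegrE ?cmod_ge0.
have bC : b%:C != 0 :> C by rewrite (fmorph_eq0 (real_complex R)) gt_eqF.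
have -> : PhiV_ratio u - cexp (al%:C * u)
   = - (al%:C * b%:C * u ^+ 2 / (1 + b%:C * u)) - (cexp (al%:C * u) - 1 - al%:C * u).
  rewrite /PhiV_ratio rmorphB fmorphV /=; move: d0; rewrite cmod_gt0 => d0.
  by field; rewrite d0 bC.
apply: le_trans (cmodB_le _ _) _; rewrite mulrDl; apply: lerD.
  rewrite cmodN (cmodM (_ * _)) (cmodM (al%:C * b%:C)) (cmodM al%:C) cmodV cmodX.
  rewrite !cmod_real !gtr0_norm //.
  rewrite mulrAC ler_pM ?mulr_ge0 ?exprn_ge0 ?cmod_ge0 ?invr_ge0 ?(ltW al0) ?(ltW b0) ?(ltW d0) //.
  by rewrite ler_wpM2l ?mulr_ge0 ?(ltW al0) ?(ltW b0) // lef_pV2 // posrE subr_gt0.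
apply: le_trans (cexp_taylor2 _) _.
  by have [_ h] := hw; rewrite !Re_rM; have := al0; have := delta_gt0 => ? ?; rewrite pmulr_rle0 // mulr_ge0_le0 //; lra.
rewrite (cmodM al%:C) cmod_real gtr0_norm // exprMn mulrA ler_wpM2l //.
by rewrite mulr_ge0 // sqr_ge0.
Qed.

Lemma inv_den_sqr_close x w : 0 <= x <= 1 -> far_left w ->
  cmod ((1 + b%:C * (x%:C * w)) ^- 2 - 1) <= 3 * b / (1 - b) ^+ 2 * x.
Proof.
move=> hx hw; have /andP[x0 x1] := hx.
have /andP[d1 _] := den_ge hx hw; have w1 := far_left_le1 hw.
have bx : cmod (b%:C * (x%:C * w)) <= b * x.
  rewrite !cmodM !cmod_real !ger0_norm ?(ltW b0) // ler_pM2l // ler_piMr //.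
set u := b%:C * _ in bx d1 *.
have d0 : 0 < cmod (1 + u) by apply: lt_le_trans d1; rewrite subr_gt0.
have -> : (1 + u) ^- 2 - 1 = - (u * (2 + u)) / (1 + u) ^+ 2.
  by move: d0; rewrite cmod_gt0 => d0; field.
rewrite cmodM cmodN cmodM cmodV cmodX.
have u1 : cmod u <= 1.
  by apply: le_trans bx _; rewrite mulr_ile1 // ltW.
have h2 : cmod (2 + u) <= 3.
  by apply: le_trans (cmodD _ _) _; rewrite (cmod_nat 2); lra.
have -> : 3 * b / (1 - b) ^+ 2 * x = (b * x) * 3 / (1 - b) ^+ 2 by ring.
rewrite ler_pM ?mulr_ge0 ?cmod_ge0 ?invr_ge0 ?exprn_ge0 ?(ltW d0) //.
  by rewrite ler_pM ?cmod_ge0.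
have p : 0 < 1 - b by rewrite subr_gt0.
by rewrite lef_pV2 ?posrE ?exprn_gt0 // lerXn2r ?nnegrE ?cmod_ge0 ?(ltW p).
Qed.

(** The exponential decay of the N-th power, N = n + 1, is traded for two powers of 1 + N x, which
    yields a summand of [geometric_grid_sum]. *)
Lemma inner_term_small : exists2 K, 0 <= K & forall n x w, 0 <= x <= theta -> far_left w ->
  x * cmod (PhiV_ratio (x%:C * w) ^+ n.+1 * (1 + b%:C * (x%:C * w)) ^- 2)
    <= K / n.+1%:R * ((n.+1%:R * x) / (1 + n.+1%:R * x) ^+ 2).
Proof.
have [K K0 hK] := expR_dominates4 decay_gt0.
have p : 0 < 1 - b by rewrite subr_gt0.
exists (K / (1 - b) ^+ 2) => [|n x w hx hw].
  by rewrite divr_ge0 ?sqr_ge0 // ltW.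
have /andP[x0 xt] := hx; have x1 : x <= 1 by apply: le_trans xt (ltW t1).
have x01 : 0 <= x <= 1 by rewrite x0.
have n0 : 0 < n.+1%:R :> R by [].
rewrite cmodM cmodV !cmodX.
have /andP[d1 _] := den_ge x01 hw; have dK := ratio_decay hx hw.
set D := cmod (1 + _) in d1 *.
have t0' : 0 <= n.+1%:R * x by rewrite mulr_ge0 // ltW.
have h1 : cmod (PhiV_ratio (x%:C * w)) ^+ n.+1 <= K / (1 + n.+1%:R * x) ^+ 2.
  rewrite ler_pdivlMr ?exprn_gt0 ?ltr_wpDr //.
  apply: le_trans (hK _ t0'); rewrite mulrC.
  have -> : decay * (n.+1%:R * x) = n.+1%:R * (decay * x) by ring.
  rewrite -mulrN expRM_natl; apply: ler_pM; rewrite ?exprn_ge0 ?cmod_ge0 ?addr_ge0 //.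
    by rewrite ler_weXn2l // lerDl.
  by rewrite lerXn2r ?nnegrE ?cmod_ge0 ?expR_ge0.
have h2 : D ^- 2 <= (1 - b) ^- 2.
  by rewrite lef_pV2 ?posrE ?exprn_gt0 ?(lt_le_trans p) // lerXn2r ?nnegrE ?(ltW p) // (le_trans (ltW p)).
apply: le_trans (_ : x * (K / (1 + n.+1%:R * x) ^+ 2 * (1 - b) ^- 2) <= _).
  by rewrite ler_wpM2l // ler_pM ?exprn_ge0 ?invr_ge0 ?exprn_ge0 ?cmod_ge0.
rewrite le_eqVlt; apply/orP; left; apply/eqP; field.
have -> : 1 + n%:R = n.+1%:R :> R by rewrite addrC natr1.
by rewrite (gt_eqF p) (gt_eqF n0) gt_eqF // ltr_wpDr.
Qed.

(** Replacing the squared denominator by 1 costs O(x); replacing the ratio by the exponential costs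
    O(N x^2) in the N-th powers, N = n + 1. The decay pays for four powers of 1 + N x, which
    converts the total into N^-2 times a summand of [geometric_grid_sum]. *)
Lemma inner_term_close : exists2 K, 0 <= K & forall n x w, 0 <= x <= theta -> far_left w ->
  x * cmod (PhiV_ratio (x%:C * w) ^+ n.+1 * (1 + b%:C * (x%:C * w)) ^- 2
            - cexp (al%:C * (x%:C * w)) ^+ n.+1)
    <= K / n.+1%:R ^+ 2 * ((n.+1%:R * x) / (1 + n.+1%:R * x) ^+ 2).
Proof.
have [K K0 hK] := expR_dominates4 decay_gt0; have [K1 K10 hK1] := ratio_exp_close.
have p : 0 < 1 - b by rewrite subr_gt0.
set K2 := 3 * b / (1 - b) ^+ 2.
have K20 : 0 <= K2 by rewrite divr_ge0 ?sqr_ge0 // mulr_ge0 // ltW.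
pose K3 := K2 + expR decay * K1.
have K30 : 0 <= K3 by rewrite addr_ge0 // mulr_ge0 // expR_ge0.
exists (K3 * K) => [|n x w hx hw]; first by rewrite mulr_ge0 // ltW.
have /andP[x0 xt] := hx; have x1 : x <= 1 by apply: le_trans xt (ltW t1).
have x01 : 0 <= x <= 1 by rewrite x0.
have n0 : 0 < n.+1%:R :> R by [].
set N := n.+1%:R in n0 *.
have dR := ratio_decay hx hw; have dE := exp_decay x0 hw.
set X := PhiV_ratio _ in dR *; set Y := cexp _ in dE *.
pose D : C := (1 + b%:C * (x%:C * w)) ^- 2; rewrite -/D.
set m := expR _ in dR dE; have m0 : 0 < m by rewrite expR_gt0.
have mN k : m ^+ k = expR (- (decay * (k%:R * x))).
  by rewrite -expRM_natl; congr expR; ring.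
have h1 : cmod (X ^+ n.+1 * (D - 1)) <= m ^+ n.+1 * (K2 * x).
  rewrite cmodM cmodX ler_pM ?exprn_ge0 ?cmod_ge0 //.
    by rewrite lerXn2r ?nnegrE ?cmod_ge0 ?(ltW m0).
  exact: inv_den_sqr_close.
(* [cmod_subX] leaves a power N - 1; the missing factor is restored at the cost of exp(decay), since
   x <= 1. *)
have h2 : cmod (X ^+ n.+1 - Y ^+ n.+1) <= N * (K1 * x ^+ 2) * (expR decay * m ^+ n.+1).
  apply: le_trans (cmod_subX n.+1 dR dE) _; rewrite /=.
  apply: ler_pM; rewrite ?mulr_ge0 ?cmod_ge0 ?exprn_ge0 ?(ltW n0) ?(ltW m0) //.
    by rewrite ler_wpM2l ?(ltW n0) // hK1.
  rewrite exprS mulrA ler_peMl ?exprn_ge0 ?(ltW m0) // -expRD -[X in X <= _]expR0 ler_expR.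
  by rewrite subr_ge0 ler_piMr // ltW // decay_gt0.
have h3 : cmod (X ^+ n.+1 * D - Y ^+ n.+1) <= K3 * (x * (1 + N * x)) * m ^+ n.+1.
  have -> : X ^+ n.+1 * D - Y ^+ n.+1 = X ^+ n.+1 * (D - 1) + (X ^+ n.+1 - Y ^+ n.+1) by ring.
  apply: le_trans (cmodD _ _) _; apply: le_trans (lerD h1 h2) _.
  have -> : m ^+ n.+1 * (K2 * x) + N * (K1 * x ^+ 2) * (expR decay * m ^+ n.+1)
     = (K2 * x + expR decay * K1 * (x * (N * x))) * m ^+ n.+1 by ring.
  rewrite ler_wpM2r ?exprn_ge0 ?(ltW m0) //.
  have a1 : K2 * x <= K2 * (x * (1 + N * x)).
    by rewrite ler_wpM2l // ler_peMr // lerDl mulr_ge0 // ltW.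
  have a2 : 0 <= expR decay * K1 * x by rewrite !mulr_ge0 ?expR_ge0.
  by rewrite /K3; lra.
apply: le_trans (ler_wpM2l x0 h3) _.
have Nx : 0 <= N * x by rewrite mulr_ge0 // ltW.
have Nx1 : 0 < 1 + N * x by rewrite ltr_wpDr.
have h4 : (1 + N * x) * m ^+ n.+1 <= K / (1 + N * x) ^+ 3.
  rewrite ler_pdivlMr ?exprn_gt0 // mulrAC -exprS mN.
  exact: hK.
have -> : x * (K3 * (x * (1 + N * x)) * m ^+ n.+1) = K3 * x ^+ 2 * ((1 + N * x) * m ^+ n.+1) by ring.
apply: le_trans (_ : K3 * x ^+ 2 * (K / (1 + N * x) ^+ 3) <= _).
  by rewrite ler_wpM2l // mulr_ge0 // exprn_ge0.
have fe (M : R) : M != 0 -> 1 + M * x != 0 -> K3 * x ^+ 2 * (K / (1 + M * x) ^+ 3)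
   = K3 * K / M ^+ 2 * (M * x / (1 + M * x) ^+ 2) * (M * x / (1 + M * x)).
  by move=> M0 M1; field; rewrite M0 M1.
rewrite (fe N) ?gt_eqF //.
rewrite ler_piMr ?mulr_ge0 ?invr_ge0 ?exprn_ge0 ?(ltW K0) ?(ltW Nx1) ?(ltW n0) //.
by rewrite ler_pdivrMr // mul1r lerDr.
Qed.

Local Notation grid_term n w v :=
  (PhiV_ratio ((theta ^+ v)%:C * w) ^+ n * (1 + b%:C * ((theta ^+ v)%:C * w)) ^- 2).

Let grid_le v : 0 <= theta ^+ v.+1 <= theta.
Proof.
by rewrite exprn_ge0 ?(ltW t0) // exprS ler_piMr ?(ltW t0) // exprn_ile1 ?(ltW t0) ?(ltW t1).
Qed.

Let grid_sum n V :
  \sum_(v < V) ((n.+1%:R * theta ^+ v.+1) / (1 + n.+1%:R * theta ^+ v.+1) ^+ 2) <= (1 - theta)^-1.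
Proof.
have h : 0 <= n.+1%:R * theta by rewrite mulr_ge0 // ltW.
apply: le_trans (geometric_grid_sum V theta_bounds h); apply: ler_sum => v _.
by have -> : n.+1%:R * theta ^+ v.+1 = theta ^+ v * (n.+1%:R * theta) by rewrite exprS; ring.
Qed.

Lemma inner_sum_small : exists2 K, 0 <= K & forall n V w, far_left w ->
  \sum_(v < V) theta ^+ v.+1 * cmod (grid_term n.+1 w v.+1) <= K / n.+1%:R.
Proof.
have [K K0 hK] := inner_term_small; exists (K / (1 - theta)) => [|n V w hw].
  by rewrite divr_ge0 // subr_ge0 ltW.
apply: (@le_trans _ _ (\sum_(v < V) K / n.+1%:R * ((n.+1%:R * theta ^+ v.+1) / (1 + n.+1%:R * theta ^+ v.+1) ^+ 2))).
  by apply: ler_sum => v _; apply: hK.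
have -> : K / (1 - theta) / n.+1%:R = K / n.+1%:R * (1 - theta)^-1 by ring.
by rewrite -mulr_sumr ler_wpM2l ?divr_ge0.
Qed.

Lemma theta_term_bound n w (v : int) : far_left w ->
  cmod ((theta ^ v)%:C * cexp ((theta ^ v)%:C * (n.+1%:R * al%:C * w)))
    <= theta ^ v * expR (- (al * delta * n.+1%:R * theta ^ v)).
Proof.
move=> [_ hw]; have x0 : 0 < theta ^ v by rewrite exprz_gt0.
rewrite cmodM cmod_real gtr0_norm // cmod_cexp ler_pM2l // ler_expR.
have -> : (theta ^ v)%:C * (n.+1%:R * al%:C * w) = (theta ^ v * n.+1%:R * al)%:C * w.
  by rewrite !rmorphM rmorph_nat; ring.
rewrite Re_rM; have y0 : 0 < theta ^ v * n.+1%:R * al by rewrite !mulr_gt0.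
have := ler_wpM2l (ltW y0) hw; lra.
Qed.

(** The exempted indices are 1, ..., V. Beyond V the factor theta^v alone gives theta^V / (1 -
    theta). For v <= 0 the point x = theta^v is at least 1, and exp(-t) <= 27 / t^3 at t = k N x,
    with N = n + 1, gives a multiple of N^-2 x^-2, geometric in v. *)
Lemma theta_sum_tail : exists2 K, 0 <= K & forall n V w, far_left w ->
  forall J : {fset int},
  \sum_(z <- J) (if z \in [seq Posz v.+1 | v <- iota 0 V] then 0 else
     cmod ((theta ^ z)%:C * cexp ((theta ^ z)%:C * (n.+1%:R * al%:C * w))))
    <= K / n.+1%:R ^+ 2 + theta ^+ V * K.
Proof.
pose k := al * delta; have k0 : 0 < k by rewrite mulr_gt0.
have th : 0 < 1 - theta by rewrite subr_gt0.
pose A := 27 / k ^+ 3; have A0 : 0 <= A by rewrite divr_ge0 // exprn_ge0 // ltW.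
pose K := A + A / (1 - theta) + (1 - theta)^-1.
have A1 : 0 <= A / (1 - theta) by rewrite divr_ge0 // ltW.
have th' : 0 <= (1 - theta)^-1 by rewrite invr_ge0 ltW.
exists K; first by rewrite !addr_ge0.
move=> n V w hw J.
pose F (z : int) : R := if z \in [seq Posz v.+1 | v <- iota 0 V] then 0 else
  cmod ((theta ^ z)%:C * cexp ((theta ^ z)%:C * (n.+1%:R * al%:C * w))).
change (\sum_(z <- J) F z <= K / n.+1%:R ^+ 2 + theta ^+ V * K).
have N0 : 0 < n.+1%:R :> R by [].
have N2 : 0 <= (n.+1%:R ^+ 2)^-1 :> R by rewrite invr_ge0 exprn_ge0.
have F0 z : 0 <= F z by rewrite /F; case: ifP => // _; exact: cmod_ge0.
have big_x (x : R) : 1 <= x -> x * expR (- (k * n.+1%:R * x)) <= A / n.+1%:R ^+ 2 / x ^+ 2.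
  move=> x1; have x0 : 0 < x by apply: lt_le_trans x1.
  have s0 : 0 < k * n.+1%:R * x by rewrite !mulr_gt0.
  apply: le_trans (ler_wpM2l (ltW x0) (expR_dominates3 s0)) _.
  have -> : x * (27 / (k * n.+1%:R * x) ^+ 3) = A / n.+1%:R ^+ 2 / x ^+ 2 / n.+1%:R.
    rewrite /A; field; rewrite (gt_eqF x0) (gt_eqF k0) /= andbT.
    by have -> : 1 + n%:R = n.+1%:R :> R by rewrite addrC natr1.
  rewrite ler_pdivrMr // ler_peMr ?ler1n //.
  by apply: divr_ge0; [apply: divr_ge0 => //|]; rewrite exprn_ge0 // ltW.
have bound : \sum_(z <- J) F z <= (A / n.+1%:R ^+ 2 + theta ^+ V / (1 - theta)) + A / n.+1%:R ^+ 2 / (1 - theta).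
  apply: int_fset_sum_le => // M.
    apply: (@le_trans _ _ (\sum_(v < M) ((if (v == 0 :> nat)%N then A / n.+1%:R ^+ 2 else 0)
        + (if (V < v)%N then theta ^+ v else 0)))).
      apply: ler_sum => v _; rewrite /F.
      have t2 : 0 <= theta ^+ v by rewrite exprn_ge0 // ltW.
      case: ifPn => [_|vV].
        by rewrite addr_ge0 //; case: ifP => // _; rewrite mulr_ge0.
      apply: le_trans (theta_term_bound n v hw) _; rewrite -/k -exprnP.
      case: eqP => [v0|/eqP v0].
        rewrite v0 expr0; have := big_x 1 (lexx 1); rewrite expr1n divr1 => h.
        by rewrite ltn0 addr0.
      have -> : (V < v)%N.
        rewrite ltnNge; apply: contra vV => vV; apply/mapP; exists v.-1.
          by rewrite mem_iota add0n prednK ?lt0n //= leq0n.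
        by rewrite prednK // lt0n.
      rewrite add0r ler_piMr // -expR0 ler_expR oppr_le0.
      by rewrite !mulr_ge0 // ltW.
    rewrite big_split /= lerD ?tail_sum_expr_le //.
    have B0 : 0 <= A / n.+1%:R ^+ 2 by rewrite mulr_ge0.
    case: M => [|M]; first by rewrite big_ord0.
    by rewrite big_ord_recl /= big1 ?addr0.
  apply: (@le_trans _ _ (\sum_(v < M) A / n.+1%:R ^+ 2 * theta ^+ v)).
    apply: ler_sum => v _; rewrite /F; case: ifPn => [_|_].
      by apply: mulr_ge0; [exact: mulr_ge0 | rewrite exprn_ge0 // ltW].
    apply: le_trans (theta_term_bound n _ hw) _; rewrite -/k NegzE.
    have -> : theta ^ (- v.+1%:Z) = (theta ^+ v.+1)^-1 by rewrite -exprnN.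
    have q0 : 0 < theta ^+ v.+1 by rewrite exprn_gt0.
    apply: le_trans (big_x _ _) _.
      by rewrite invf_ge1 // exprn_ile1 ?(ltW t0) ?(ltW t1).
    have -> : (theta ^- v.+1 ^+ 2)^-1 = theta ^+ (v.+1 * 2) by rewrite exprVn invrK exprM.
    apply: ler_wpM2l; first exact: mulr_ge0.
    by rewrite ler_wiXn2l ?(ltW t0) ?(ltW t1) // muln2 -addnn addSn ltnW // ltnS leq_addr.
  rewrite -mulr_sumr; apply: ler_wpM2l; first exact: mulr_ge0.
  exact: sum_expr_le.
apply: le_trans bound _.
have V0 : 0 <= theta ^+ V by rewrite exprn_ge0 // ltW.
have -> : K / n.+1%:R ^+ 2 = A / n.+1%:R ^+ 2 + A / n.+1%:R ^+ 2 / (1 - theta) + (1 - theta)^-1 / n.+1%:R ^+ 2.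
  by rewrite /K; ring.
have i1 : 0 <= (1 - theta)^-1 / n.+1%:R ^+ 2 by rewrite mulr_ge0.
have i2 : theta ^+ V / (1 - theta) <= theta ^+ V * K.
  by rewrite ler_wpM2l // /K lerDr addr_ge0.
by rewrite addrAC; apply: lerD => //; rewrite lerDl.
Qed.

(** Truncation at [V] is kept as a separate error theta^V K with K free of V, so that it can be made
    negligible after the sums over words have been bounded. *)
Lemma inner_sum_approx : exists2 K, 0 <= K & forall n V w, far_left w ->
  cmod (\sum_(v < V) (theta ^+ v.+1)%:C * grid_term n.+1 w v.+1
        - sum (fun v : int => (theta ^ v)%:C * cexp ((theta ^ v)%:C * (n.+1%:R * al%:C * w)) : C))
    <= K / n.+1%:R ^+ 2 + theta ^+ V * K.
Proof.
have [K1 K10 h1] := inner_term_close; have [K2 K20 h2] := theta_sum_tail.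
have th : 0 < 1 - theta by rewrite subr_gt0.
exists (K1 / (1 - theta) + K2); first by rewrite addr_ge0 // divr_ge0 // ltW.
move=> n V w hw; set g := fun v : int => _ : C.
have uV : uniq [seq Posz v.+1 | v <- iota 0 V].
  by rewrite map_inj_uniq ?iota_uniq // => x y [].
have [J0 hJ0 sJ0] := fset_of_uniq uV.
(* With V = 0 no index is exempt, so the tail bound controls the whole series. *)
have gB (J : {fset int}) : \sum_(z <- J) cmod (g z) <= K2 / n.+1%:R ^+ 2 + theta ^+ 0 * K2.
  by apply: le_trans (h2 n 0%N w hw J).
have gT (J : {fset int}) : fdisjoint J J0 -> \sum_(z <- J) cmod (g z) <= K2 / n.+1%:R ^+ 2 + theta ^+ V * K2.
  move=> dJ; apply: le_trans (h2 n V w hw J); rewrite big_seq [X in _ <= X]big_seq.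
  apply: ler_sum => z zJ; rewrite ifN //; rewrite -hJ0.
  by move/fdisjointP: dJ; apply.
have e1 := abs_sum_approx gB gT.
have e2 : \sum_(z <- J0) g z = \sum_(v < V) (theta ^+ v.+1)%:C * cexp (al%:C * ((theta ^+ v.+1)%:C * w)) ^+ n.+1.
  rewrite sJ0 big_map -{1}[V]subn0 -/(index_iota 0 V) big_mkord; apply: eq_bigr => v _.
  rewrite /g -exprnP -cexpX; congr (_ * cexp _); ring.
set S := \sum_(v < V) _.
have -> : S - sum g = (S - \sum_(z <- J0) g z) - (sum g - \sum_(z <- J0) g z) by ring.
apply: le_trans (cmodB_le _ _) _.
have e3 : cmod (S - \sum_(z <- J0) g z) <= K1 / (1 - theta) / n.+1%:R ^+ 2.
  rewrite e2 -sumrB; apply: le_trans (cmod_sum _ _ _) _.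
  apply: (@le_trans _ _ (\sum_(v < V) K1 / n.+1%:R ^+ 2 * ((n.+1%:R * theta ^+ v.+1) / (1 + n.+1%:R * theta ^+ v.+1) ^+ 2))).
    apply: ler_sum => v _; rewrite -mulrBr cmodM cmod_real ger0_norm; last by have /andP[] := grid_le v.
    exact: h1.
  have -> : K1 / (1 - theta) / n.+1%:R ^+ 2 = K1 / n.+1%:R ^+ 2 * (1 - theta)^-1 by ring.
  by rewrite -mulr_sumr ler_wpM2l ?divr_ge0 ?exprn_ge0.
apply: le_trans (lerD e3 e1) _.
have V0 : 0 <= theta ^+ V by rewrite exprn_ge0 // ltW.
have i1 : 0 <= theta ^+ V * (K1 / (1 - theta)) by rewrite mulr_ge0 // divr_ge0 // ltW.
rewrite -subr_ge0; set d := (X in 0 <= X).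
by have -> : d = theta ^+ V * (K1 / (1 - theta)) by rewrite /d; ring.
Qed.

End InnerSum.

(** A list nearly attaining the supremum of the sums leaves at most [e] for any list disjoint from
    it, and a list of items all larger than its members is disjoint. *)
Lemma bounded_uniq_sums_tail (R : realType) (I : choiceType) (f : I -> R) (S : R) (size_of : I -> nat) :
  (forall i, 0 <= f i) -> (forall ws : seq I, uniq ws -> \sum_(w <- ws) f w <= S) ->
  forall e : R, 0 < e -> exists N, forall ws : seq I, uniq ws ->
    (forall w, w \in ws -> (N <= size_of w)%N) -> \sum_(w <- ws) f w <= e.
Proof.
move=> f0 fS e e0.
pose E := [set \sum_(w <- ws) f w | ws in [set ws : seq I | uniq ws]].
have hE : has_sup E.
  split; first by exists (\sum_(w <- [::]) f w), [::].
  by exists S => _ [ws uws <-]; exact: fS.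
have [_ [ws0 u0 <-] h0] := sup_adherent e0 hE.
exists (\max_(w <- ws0) size_of w).+1 => ws uws hws.
have dis w : w \in ws -> w \notin ws0.
  move=> /hws; rewrite ltnNge; apply: contra => w0.
  by rewrite (big_rem w) //= leq_max leqnn.
have u : uniq (ws0 ++ ws).
  by rewrite cat_uniq u0 uws andbT; apply/hasPn => w /dis.
have : \sum_(w <- ws0 ++ ws) f w <= sup E by apply: sup_upper_bound => //; exists (ws0 ++ ws).
by rewrite big_cat /=; lra.
Qed.

(** * Enumerating words by length *)

Section Levels.
Context {s : nat}.

Fixpoint level N : seq (seq 'I_s) :=
  if N is M.+1 then [seq j :: w | j <- index_enum 'I_s, w <- level M] else [:: [::]].

Lemma mem_level N w : (w \in level N) = (size w == N).
Proof.
elim: N w => [|N IH] [|j w] //=.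
  by apply/allpairsP => -[[j w] [_ _]].
apply/allpairsP/idP => [[[k v] /= [_ hv [_ ->]]]|hw]; first by rewrite eqSS -IH.
by exists (j, w); rewrite mem_index_enum /= IH -eqSS.
Qed.

Lemma uniq_level N : uniq (level N).
Proof.
elim: N => [|N IH] //=; apply: allpairs_uniq => //; first exact: index_enum_uniq.
by move=> [j w] [k v] _ _ [-> ->].
Qed.

Lemma sum_levelS (V : zmodType) (f : seq 'I_s -> V) N :
  \sum_(w <- level N.+1) f w = \sum_j \sum_(w <- level N) f (j :: w).
Proof. by rewrite /= big_allpairs_dep. Qed.

Definition upto N : seq (seq 'I_s) := flatten [seq level k | k <- iota 0 N].

Lemma sum_upto (V : zmodType) (f : seq 'I_s -> V) (P : pred (seq 'I_s)) N :
  \sum_(w <- upto N | P w) f w = \sum_(k < N) \sum_(w <- level k | P w) f w.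
Proof.
rewrite big_flatten big_map /=.
by rewrite -{1}[N]subn0 -/(index_iota 0 N) big_mkord.
Qed.

Lemma sum_uptoS (V : zmodType) (f : seq 'I_s -> V) (P : pred (seq 'I_s)) N :
  \sum_(w <- upto N.+1 | P w) f w
   = \sum_(w <- upto N | P w) f w + \sum_(w <- level N | P w) f w.
Proof. by rewrite !sum_upto big_ord_recr. Qed.

Lemma mem_upto N w : (w \in upto N) = (size w < N)%N.
Proof.
apply/flattenP/idP => [[l /mapP[k]]|hw].
  by rewrite mem_iota add0n => kN ->; rewrite mem_level => /eqP ->.
exists (level (size w)); last by rewrite mem_level.
by apply/mapP; exists (size w); rewrite ?mem_iota.
Qed.

Lemma uniq_upto N : uniq (upto N).
Proof.
elim: N => [|N IH] //; rewrite /upto -addn1 iotaD map_cat flatten_cat cat_uniq IH /=.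
rewrite cats0 uniq_level andbT; apply/hasPn => w; rewrite mem_level add0n => /eqP hw.
by rewrite mem_upto hw ltnn.
Qed.

Definition not_starting (j : 'I_s) (w : seq 'I_s) := if w is k :: _ then k != j else true.

End Levels.

(** * Algebra of sums over words *)

Section WordSums.
Context {R : realType} {s : nat}.
Context (c : 'I_s -> R[i]) (r : 'I_s -> R) (a : 'I_s -> R[i]) (sigma : 'I_s -> R).
Local Notation C := R[i].
Local Notation T := (Tmap a sigma).
Local Notation tau := (tau a sigma).
Local Notation dtau := (dtau c r a sigma).
Implicit Types (z : C) (w : seq 'I_s) (j k : 'I_s) (h : C -> C).

(* [T j] is the reflection of [1 / z^*] in the circle of the hole [D j]; by the mean
   value property this is the integral of [h w (1 - z conj(w))^-2] over [D j]. *)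
Definition pullback j h z : C := (r j ^+ 2)%:C / (1 - (c j)^* * z) ^+ 2 * h (T j z).

Definition term h z w : C := dtau w z * h (tau w z).

Lemma term_cons h z j w : term h z (j :: w) = term (pullback j h) z w.
Proof. by rewrite /term /pullback /= -mulrA mulrCA. Qed.

Lemma termB h h' z w : term (fun x => h x - h' x) z w = term h z w - term h' z w.
Proof. by rewrite /term mulrBr. Qed.

Lemma sum_level_term h z N :
  \sum_(w <- level N.+1) term h z w
   = \sum_(w <- level N) term (fun x => \sum_j pullback j h x) z w.
Proof.
rewrite sum_levelS exchange_big /=; apply: eq_bigr => w _.
by rewrite {2}/term mulr_sumr; apply: eq_bigr => j _; rewrite term_cons.
Qed.

(** The sum over words of length < N is 1 + L + ... + L^(N-1) for L = sum_j [pullback j], so this is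
    the telescoping of the Neumann series of 1 - L. *)
Lemma resolvent_sum p z N :
  \sum_(w <- upto N) term (fun x => p x - \sum_j pullback j p x) z w
   = p z - \sum_(w <- level N) term p z w.
Proof.
elim: N => [|N IH]; first by rewrite /upto /= big_nil big_seq1 /term /= mul1r subrr.
rewrite sum_uptoS IH.
under [X in _ + X]eq_bigr => w _ do rewrite termB.
by rewrite sumrB -sum_level_term; ring.
Qed.

(** Nonempty words are split by their outermost letter, which [term_cons] absorbs into the function;
    hence the drop from N + 1 to N. *)
Lemma sum_upto_term_split h z N :
  \sum_(w <- upto N.+1) term h z w - h z
   = \sum_j \sum_(w <- upto N) term (pullback j h) z w.
Proof.
elim: N => [|N IH].
  rewrite /upto /= big_seq1 /term /= mul1r subrr big1 // => j _.
  by rewrite big_nil.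
rewrite sum_uptoS addrAC IH sum_levelS -big_split /=; apply: eq_bigr => j _.
by rewrite sum_uptoS; congr (_ + _); apply: eq_bigr => w _; rewrite term_cons.
Qed.

Lemma sum_not_starting j h z N :
  \sum_(w <- upto N.+1 | not_starting j w) term h z w
   = \sum_(w <- upto N.+1) term h z w - \sum_(w <- upto N) term (pullback j h) z w.
Proof.
elim: N => [|N IH].
  by rewrite /upto /= !big_cons !big_nil /= subr0.
rewrite sum_uptoS IH !(sum_uptoS _ xpredT); move: (\sum_(w <- upto N) _) => X.
have -> : \sum_(w <- level N.+1 | not_starting j w) term h z w
   = \sum_(w <- level N.+1) term h z w - \sum_(w <- level N) term (pullback j h) z w.
  rewrite big_mkcond !sum_levelS (bigD1 j) //= [in RHS](bigD1 j) //= eqxx big1_eq add0r.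
  rewrite -[LHS]add0r; under [in RHS]eq_bigr => w _ do rewrite term_cons.
  rewrite addrAC subrr; congr (_ + _); apply: eq_bigr => k kj.
  by rewrite kj.
by ring.
Qed.

(** The contribution of the prefixes j^v for v = 1, ..., V. The empty prefix is left out, because it
    is the words starting with j that are to be counted. *)
Definition block j h V z : C := \sum_(v < V) iter v.+1 (pullback j) h z.

Lemma pullback_block j h V z :
  pullback j (block j h V) z = \sum_(v < V) iter v.+2 (pullback j) h z.
Proof. by rewrite /pullback /block mulr_sumr. Qed.

(** A block minus its own pullback telescopes to [pullback j h] minus the iterate of order V + 1.
    This is the unique factorisation of a word starting with j as j^v followed by a word not
    starting with j, up to runs of more than V letters and a boundary term at length N. *)
Lemma sum_not_starting_block j h V z N :
  \sum_(w <- upto N.+1 | not_starting j w) term (block j h V) z w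
   = \sum_(w <- upto N) term (pullback j h) z w
     - \sum_(w <- upto N) term (iter V.+1 (pullback j) h) z w
     + \sum_(w <- level N) term (block j h V) z w.
Proof.
rewrite sum_not_starting sum_uptoS addrAC -!sumrB; congr (_ + _).
apply: eq_bigr => w _; rewrite -!termB /term; congr (_ * _).
rewrite pullback_block /block; elim: V => [|V IH].
  by rewrite !big_ord0 /= !subrr.
by rewrite !big_ord_recr /= opprD addrACA IH /= addrA subrK.
Qed.

End WordSums.

(** * Limits of sums over words *)

Section WordSumLimits.
Context {R : realType} {s : nat}.
Context (c : 'I_s -> R[i]) (r : 'I_s -> R) (a : 'I_s -> R[i]) (sigma : 'I_s -> R).
Hypothesis cm : is_cmcd c r.
Hypothesis un : forall j, is_uniformizer (c j) (r j) (a j) (sigma j).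
Hypothesis rho_gt0 : 0 < rho a.
Local Notation C := R[i].
Local Notation tau := (tau a sigma).
Local Notation dtau := (dtau c r a sigma).
Context (S : R) (z : C).
Hypothesis S_bound : forall ws : seq (seq 'I_s), uniq ws -> \sum_(w <- ws) cmod (dtau w z) <= S.

Lemma sum_term_le h N (B : R) : (forall w, cmod (h (tau w z)) <= B) -> 0 <= B ->
  cmod (\sum_(w <- upto N) term c r a sigma h z w) <= S * B.
Proof.
move=> hB B0; apply: le_trans (cmod_sum _ _ _) _.
apply: (@le_trans _ _ (\sum_(w <- upto N) cmod (dtau w z) * B)).
  by apply: ler_sum => w _; rewrite cmodM ler_wpM2l ?cmod_ge0.
by rewrite -mulr_suml ler_wpM2r // S_bound // uniq_upto.
Qed.

Lemma sum_term_not_starting_le j h N (B : R) :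
  (forall w, not_starting j w -> cmod (h (tau w z)) <= B) -> 0 <= B ->
  cmod (\sum_(w <- upto N | not_starting j w) term c r a sigma h z w) <= S * B.
Proof.
move=> hB B0; apply: le_trans (cmod_sum _ _ _) _.
apply: (@le_trans _ _ (\sum_(w <- upto N) cmod (dtau w z) * B)).
  rewrite big_mkcond /=; apply: ler_sum => w _; case: ifP => hw.
    by rewrite cmodM ler_wpM2l ?cmod_ge0 // hB.
  by rewrite mulr_ge0 ?cmod_ge0.
by rewrite -mulr_suml ler_wpM2r // S_bound // uniq_upto.
Qed.

(** The words of length N lie in the tail of the convergent series of |dtau|. *)
Lemma level_term_small h (B e : R) : (forall w, cmod (h (tau w z)) <= B) -> 0 < e ->
  exists N0, forall N, (N0 <= N)%N ->
    cmod (\sum_(w <- level N) term c r a sigma h z w) <= e.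
Proof.
move=> hB e0; have B0 : 0 <= B by apply: le_trans (hB [::]); exact: cmod_ge0.
have B1 : 0 < B + 1 by rewrite ltr_wpDl.
have [N0 hN0] := @bounded_uniq_sums_tail _ _ (fun w => cmod (dtau w z)) S size
  (fun w => cmod_ge0 _) S_bound (e / (B + 1)) (divr_gt0 e0 B1).
exists N0 => N hN; apply: le_trans (cmod_sum _ _ _) _.
apply: (@le_trans _ _ (\sum_(w <- level N) cmod (dtau w z) * (B + 1))).
  apply: ler_sum => w _; rewrite cmodM ler_wpM2l ?cmod_ge0 //.
  by apply: le_trans (hB w) _; rewrite lerDl.
rewrite -mulr_suml -ler_pdivlMr //; apply: hN0; first exact: uniq_level.
by move=> w; rewrite mem_level => /eqP ->.
Qed.

Lemma not_starting_mem j w : not_starting j w -> (Tcal a sigma `\` Tcal_at a sigma j) (tau w).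
Proof.
move=> hw; split; first by exists w.
move=> [_ [v ->] e]; have : j :: v = w.
  by apply: (tau_inj cm un rho_gt0) => x _; rewrite -e.
by move=> ew; move: hw; rewrite -ew /= eqxx.
Qed.

Lemma mem_not_starting j f : (Tcal a sigma `\` Tcal_at a sigma j) f ->
  exists2 w, not_starting j w & tau w = f.
Proof.
move=> [[w ->] h]; exists w => //; case: w h => [//|k w] h /=.
by apply: contra_notN h => /eqP ->; exists (tau w) => //; exists w.
Qed.

(** Each map of the index set is given by exactly one word not starting with [j], so tails over maps
    are tails over words. *)
Lemma sum_over_words_approx j (G : (C -> C) -> C) (B e : R) :
  (forall w, not_starting j w -> cmod (G (tau w)) <= cmod (dtau w z) * B) -> 0 <= B -> 0 < e ->
  exists N0, forall N, (N0 <= N)%N ->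
    cmod (sum_over (Tcal a sigma `\` Tcal_at a sigma j) G
          - \sum_(w <- upto N | not_starting j w) G (tau w)) <= e.
Proof.
move=> hG B0 e0; pose A := Tcal a sigma `\` Tcal_at a sigma j.
have B1 : 0 < B + 1 by rewrite ltr_wpDl.
have [N0 hN0] := @bounded_uniq_sums_tail _ _ (fun w => cmod (dtau w z)) S size
  (fun w => cmod_ge0 _) S_bound (e / (B + 1)) (divr_gt0 e0 B1).
have wdP (x : A) : exists w, not_starting j w /\ tau w = val x.
  by have [w h1 h2] := mem_not_starting (set_mem (valP x)); exists w.
pose wd x := proj1_sig (cid (wdP x)).
have wd1 x : not_starting j (wd x) by rewrite /wd; case: cid => w [].
have wd2 x : tau (wd x) = val x by rewrite /wd; case: cid => w [].
have wd_inj : injective wd.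
  by move=> x y e'; apply: val_inj; rewrite -!wd2 e'.
have sumJ (J : {fset A}) : \sum_(x <- J) cmod (G (val x))
    <= (\sum_(w <- [seq wd x | x <- enum_fset J]) cmod (dtau w z)) * (B + 1).
  rewrite mulr_suml big_map; apply: ler_sum => x _; rewrite -wd2.
  apply: le_trans (hG _ (wd1 x)) _; rewrite ler_wpM2l ?cmod_ge0 // lerDl //.
have uJ (J : {fset A}) : uniq [seq wd x | x <- enum_fset J] by rewrite map_inj_uniq ?fset_uniq.
have fB (J : {fset A}) : \sum_(x <- J) cmod (G (val x)) <= S * (B + 1).
  by apply: le_trans (sumJ J) _; rewrite ler_wpM2r ?(ltW B1) // S_bound.
exists N0 => N hN.
pose ws := [seq w <- upto N | not_starting j w].
have uws : uniq ws by rewrite filter_uniq // uniq_upto.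
have A0 : A (tau [::]) by exact: not_starting_mem.
(* The identity map is a dummy value for words whose map is not in the index set. *)
pose el w : A := if pselect (A (tau w)) is left p then SigSub (mem_set p) else SigSub (mem_set A0).
have elP w : not_starting j w -> val (el w) = tau w.
  by move=> /not_starting_mem h; rewrite /el; case: pselect.
have uel : uniq (map el ws).
  rewrite map_inj_in_uniq // => w w'; rewrite !mem_filter => /andP[hw _] /andP[hw' _] e'.
  by apply: (tau_inj cm un rho_gt0) => t _; rewrite -(elP _ hw) -(elP _ hw') e'.
have [J0 hJ0 sJ0] := fset_of_uniq uel.
have tail (J : {fset A}) : fdisjoint J J0 -> \sum_(x <- J) cmod (G (val x)) <= e.
  move=> /fdisjointP dJ; apply: le_trans (sumJ J) _; rewrite -ler_pdivlMr //.
  apply: hN0 => // w /mapP[x xJ ->]; rewrite leqNgt; apply/negP => hx.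
  have := dJ x xJ; rewrite hJ0 => /negP; apply; apply/mapP; exists (wd x).
    by rewrite mem_filter wd1 mem_upto (leq_trans hx).
  by apply: val_inj; rewrite elP // wd2.
have := abs_sum_approx fB tail; rewrite sJ0 big_map big_filter.
suff -> : \sum_(w <- upto N | not_starting j w) G (val (el w))
   = \sum_(w <- upto N | not_starting j w) G (tau w) by [].
by apply: eq_bigr => w hw; rewrite elP.
Qed.

End WordSumLimits.

From mathcomp Require Import measurable_realfun.

(** * The area integral *)

Section AreaIntegral.
Context {R : realType}.
Local Notation C := R[i].
Local Notation mR := (measurableTypeR R).
Local Notation mu := (lebesgue_measure \x lebesgue_measure)%E.
Implicit Types (D : set C) (f g : C -> C).

Definition plane D : set (mR * mR) := [set p | D (p.1 +i* p.2)].

Definition region D := measurable (plane D) /\ D `<=` [set z | cmod z <= 1].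

(** A class closed under sums, products and conjugation, and sufficient for integrability over every
    [region]. *)
Definition tame f :=
  [/\ measurable_fun setT (fun p : mR * mR => Re (f (p.1 +i* p.2))),
      measurable_fun setT (fun p : mR * mR => Im (f (p.1 +i* p.2))) &
      exists M, forall z, cmod z <= 1 -> cmod (f z) <= M].

Lemma tame_cst (k : C) : tame (fun _ => k).
Proof.
by split; [exact: measurable_cst|exact: measurable_cst|exists (cmod k)].
Qed.

Lemma tame_id : tame id.
Proof.
by split; [exact: measurable_fst|exact: measurable_snd|exists 1].
Qed.

Lemma tame_conj f : tame f -> tame (fun z => (f z)^*).
Proof.
move=> [m1 m2 [M hM]]; split.
- apply: eq_measurable_fun m1 => p _; rewrite Num_conjE; by case: (f _).
- apply: (eq_measurable_fun (fun p : mR * mR => - Im (f (p.1 +i* p.2)))).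
    by move=> p _; rewrite Num_conjE; case: (f _).
  exact: measurableT_comp.
- by exists M => z hz; rewrite cmod_conj hM.
Qed.

Lemma tameD f g : tame f -> tame g -> tame (fun z => f z + g z).
Proof.
move=> [m1 m2 [M hM]] [m1' m2' [M' hM']]; split.
- apply: (eq_measurable_fun (fun p : mR * mR => Re (f (p.1 +i* p.2)) + Re (g (p.1 +i* p.2)))).
    by move=> p _; rewrite ReD.
  exact: measurable_funD.
- apply: (eq_measurable_fun (fun p : mR * mR => Im (f (p.1 +i* p.2)) + Im (g (p.1 +i* p.2)))).
    by move=> p _; rewrite ImD.
  exact: measurable_funD.
- by exists (M + M') => z hz; apply: le_trans (cmodD _ _) _; rewrite lerD ?hM ?hM'.
Qed.

Lemma tameM f g : tame f -> tame g -> tame (fun z => f z * g z).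
Proof.
move=> [m1 m2 [M hM]] [m1' m2' [M' hM']]; split.
- apply: (eq_measurable_fun (fun p : mR * mR => Re (f (p.1 +i* p.2)) * Re (g (p.1 +i* p.2))
     - Im (f (p.1 +i* p.2)) * Im (g (p.1 +i* p.2)))).
    by move=> p _; case: (f _) => ? ?; case: (g _).
  by apply: measurable_funB; apply: measurable_funM.
- apply: (eq_measurable_fun (fun p : mR * mR => Re (f (p.1 +i* p.2)) * Im (g (p.1 +i* p.2))
     + Im (f (p.1 +i* p.2)) * Re (g (p.1 +i* p.2)))).
    by move=> p _; case: (f _) => ? ?; case: (g _).
  by apply: measurable_funD; apply: measurable_funM.
- exists (M * M') => z hz; rewrite cmodM.
  by apply: ler_pM; rewrite ?cmod_ge0 ?hM ?hM'.
Qed.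

Lemma tameX f n : tame f -> tame (fun z => f z ^+ n).
Proof.
move=> tf; elim: n => [|n IH]; first exact: tame_cst.
have -> : (fun z => f z ^+ n.+1) = (fun z => f z * f z ^+ n) by apply/funext => z; rewrite exprS.
exact: tameM.
Qed.

Lemma tame_sum (I : Type) (s : seq I) (F : I -> C -> C) :
  (forall i, tame (F i)) -> tame (fun z => \sum_(i <- s) F i z).
Proof.
move=> h; elim: s => [|i s IH].
  have -> : (fun z => \sum_(i <- [::]) F i z) = (fun _ => 0) by apply/funext => z; rewrite big_nil.
  exact: tame_cst.
have -> : (fun z => \sum_(j <- i :: s) F j z) = (fun z => F i z + \sum_(j <- s) F j z).
  by apply/funext => z; rewrite big_cons.
exact: tameD.
Qed.

Lemma region_finite D : region D -> (mu (plane D) <= (4 : R)%:E)%E.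
Proof.
move=> [mD D1].
have mI : measurable ((`[-1, 1]%classic : set mR) `*` (`[-1, 1]%classic : set mR)).
  by apply: measurableX.
apply: (@le_trans _ _ (mu ((`[-1, 1]%classic : set mR) `*` (`[-1, 1]%classic : set mR)))).
  apply: le_measure; [exact: mem_set|exact: mem_set|] => -[x y] /D1 /= h.
  have h1 := Re_le_cmod (x +i* y); have h2 := Im_le_cmod (x +i* y).
  by split; rewrite /= in_itv /= -ler_norml; [apply: le_trans h1 h|apply: le_trans h2 h].
rewrite product_measure1E //= !lebesgue_measure_itv /= lte_fin.
by rewrite ifT -?EFinB -?EFinM ?lee_fin; lra.
Qed.

Lemma region_fin_num D : region D -> mu (plane D) \is a fin_num.
Proof.
move=> rD; rewrite ge0_fin_numE; last exact: measure_ge0.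
by apply: le_lt_trans (region_finite rD) _; rewrite ltry.
Qed.

Lemma bounded_part_integrable D (g : mR * mR -> R) M : region D ->
  measurable_fun setT g -> (forall p, plane D p -> `|g p| <= M) ->
  mu.-integrable (plane D) (EFin \o g).
Proof.
move=> rD mg gM; apply: measurable_bounded_integrable.
- by case: rD.
- by apply: le_lt_trans (region_finite rD) _; rewrite ltry.
- by apply: measurable_funS mg.
- exists M; split; rewrite ?num_real // => y My p Dp /=.
  by apply: le_trans (gM p Dp) (ltW My).
Qed.

Lemma tame_integrable D f : region D -> tame f ->
  mu.-integrable (plane D) (EFin \o (fun p : mR * mR => Re (f (p.1 +i* p.2)))) /\
  mu.-integrable (plane D) (EFin \o (fun p : mR * mR => Im (f (p.1 +i* p.2)))).
Proof.
move=> rD [m1 m2 [M hM]]; have [_ D1] := rD; split; apply: (@bounded_part_integrable _ _ M) => // p /D1 h.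
  by apply: le_trans (Re_le_cmod _) (hM _ h).
by apply: le_trans (Im_le_cmod _) (hM _ h).
Qed.

Lemma area_integral_linear D f g (k : C) : region D -> tame f -> tame g ->
  area_integral D (fun z => k * f z + g z) = k * area_integral D f + area_integral D g.
Proof.
move=> rD tf tg; have [f1 f2] := tame_integrable rD tf; have [g1 g2] := tame_integrable rD tg.
have [mD _] := rD; rewrite /area_integral -/(plane D).
case: k => k1 k2.
have integrableZ (x : R) (h : mR * mR -> R) : mu.-integrable (plane D) (EFin \o h) ->
    mu.-integrable (plane D) (EFin \o (fun p => x * h p)).
  move=> hi; have -> : EFin \o (fun p => x * h p) = (fun p => (x%:E * (EFin \o h) p)%E) by apply/funext.
  exact: integrableZl.
have integrable_add (h h' : mR * mR -> R) : mu.-integrable (plane D) (EFin \o h) -> mu.-integrable (plane D) (EFin \o h') ->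
    mu.-integrable (plane D) (EFin \o (fun p => h p + h' p)).
  by move=> hi hi'; apply: (integrableD mD hi hi').
under eq_Rintegral => p _.
  rewrite (_ : Re _ = (k1 * Re (f (p.1 +i* p.2)) + (- k2) * Im (f (p.1 +i* p.2)))
     + Re (g (p.1 +i* p.2))); last by case: (f _) (g _) => ? ? [? ?] /=; ring.
  over.
rewrite RintegralD ?RintegralD ?RintegralZl //; try (by do ?apply: integrable_add => //; apply: integrableZ).
under [X in _ +i* (_ * X) = _]eq_Rintegral => p _.
  rewrite (_ : Im _ = (k1 * Im (f (p.1 +i* p.2)) + k2 * Re (f (p.1 +i* p.2)))
     + Im (g (p.1 +i* p.2))); last by case: (f _) (g _) => ? ? [? ?] /=; ring.
  over.
rewrite RintegralD ?RintegralD ?RintegralZl //; try (by do ?apply: integrable_add => //; apply: integrableZ).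
by apply/eqP; rewrite eq_complex /=; apply/andP; split; apply/eqP; ring.
Qed.

Lemma area_integral0 D : region D -> area_integral D (fun _ => 0) = 0.
Proof.
move=> rD; have := area_integral_linear 0 rD (tame_cst 0) (tame_cst 0).
have -> : (fun z : C => 0 * 0 + 0) = (fun _ => 0) :> (C -> C) by apply/funext => z; ring.
by rewrite mul0r add0r => _; rewrite /area_integral !Rintegral_cst ?mul0r ?mulr0 //; case: rD.
Qed.

Lemma area_integralZ D f (k : C) : region D -> tame f ->
  area_integral D (fun z => k * f z) = k * area_integral D f.
Proof.
move=> rD tf; have := area_integral_linear k rD tf (tame_cst 0).
rewrite area_integral0 // addr0 => <-; congr area_integral; apply/funext => z.
by rewrite addr0.
Qed.

Lemma area_integralD D f g : region D -> tame f -> tame g ->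
  area_integral D (fun z => f z + g z) = area_integral D f + area_integral D g.
Proof.
move=> rD tf tg; have := area_integral_linear 1 rD tf tg; rewrite mul1r => <-.
by congr area_integral; apply/funext => z; rewrite mul1r.
Qed.

Lemma area_integral_sum D (I : Type) (s : seq I) (k : I -> C) (F : I -> C -> C) :
  region D -> (forall i, tame (F i)) ->
  area_integral D (fun z => \sum_(i <- s) k i * F i z) = \sum_(i <- s) k i * area_integral D (F i).
Proof.
move=> rD tF; elim: s => [|i s IH].
  rewrite big_nil -[RHS](area_integral0 rD); congr area_integral.
  by apply/funext => z; rewrite big_nil.
rewrite big_cons -IH -area_integral_linear //; last first.
  by apply: tame_sum => j; apply: tameM => //; exact: tame_cst.
by congr area_integral; apply/funext => z; rewrite big_cons.
Qed.

Lemma area_integral_bound : exists2 K : R, 0 <= K & forall D f M, region D -> tame f ->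
  (forall z, D z -> cmod (f z) <= M) -> cmod (area_integral D f) <= K * `|M|.
Proof.
(* Real and imaginary parts each contribute |M| times the area 4 of the square of side 2 around the
   disk. *)
exists (8 / pi); first by rewrite divr_ge0 // pi_ge0.
move=> D f M rD tf fM; have [f1 f2] := tame_integrable rD tf; have [mD _] := rD.
have fin := region_fin_num rD.
have bd (g : mR * mR -> R) : mu.-integrable (plane D) (EFin \o g) ->
    (forall p, plane D p -> `|g p| <= `|M|) -> `|Rintegral mu (plane D) g| <= `|M| * 4.
  move=> ig gM; apply: le_trans (le_normr_Rintegral mD ig) _.
  apply: (@le_trans _ _ (Rintegral mu (plane D) (fun _ => `|M|))).
    apply: le_Rintegral => //.
      by have := integrable_norm ig.
    apply: (bounded_part_integrable (M := `|M|)) => // p _.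
    by rewrite normr_id.
  rewrite Rintegral_cst // ler_wpM2l // -lee_fin fineK //; exact: region_finite.
apply: le_trans (cmod_le_ReIm _) _; rewrite /area_integral /= -/(plane D).
rewrite !normrM gtr0_norm ?invr_gt0 ?pi_gt0 //.
have pi0 : 0 <= pi^-1 :> R by rewrite invr_ge0 pi_ge0.
have e : 8 / pi * `|M| = pi^-1 * (`|M| * 4) + pi^-1 * (`|M| * 4) :> R by ring.
rewrite e; apply: lerD; rewrite ler_wpM2l //; apply: bd => // p Dp.
  by apply: le_trans (Re_le_cmod _) _; apply: le_trans (fM _ Dp) (ler_norm _).
by apply: le_trans (Im_le_cmod _) _; apply: le_trans (fM _ Dp) (ler_norm _).
Qed.

Lemma area_integralU D D' f : region D -> region D' -> D `&` D' = set0 -> tame f ->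
  area_integral (D `|` D') f = area_integral D f + area_integral D' f.
Proof.
move=> rD rD' dis tf.
have rU : region (D `|` D').
  split; last by move=> z [/(proj2 rD)|/(proj2 rD')].
  by have := measurableU _ _ (proj1 rD) (proj1 rD').
have [f1 f2] := tame_integrable rU tf.
have e : plane (D `|` D') = plane D `|` plane D' by [].
have dis' : [disjoint plane D & plane D'].
  by apply/disj_set2P; apply/seteqP; split => // p [h1 h2]; have : (D `&` D') (p.1 +i* p.2) by []; rewrite dis.
rewrite e in f1 f2; rewrite /area_integral -/(plane D) -/(plane D') -/(plane (D `|` D')) e.
rewrite !Rintegral_setU //; [|exact: (proj1 rD)|exact: (proj1 rD')|exact: (proj1 rD)|exact: (proj1 rD')].
by apply/eqP; rewrite eq_complex /=; apply/andP; split; apply/eqP; ring.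
Qed.

(** Fubini along vertical slices; [plane_integral_slices2] uses the horizontal ones. *)
Lemma plane_integral_slices1 D (g : mR * mR -> R) : region D ->
  mu.-integrable (plane D) (EFin \o g) ->
  (forall x, (\int[lebesgue_measure]_(y in [set y : mR | D (x +i* y)]) (g (x, y))%:E)%E = 0) ->
  Rintegral mu (plane D) g = 0.
Proof.
move=> [mD _] ig h; have [+ _] := @integrable_mkcond _ _ _ mu (plane D) (EFin \o g) mD => /(_ ig) ig'.
rewrite /Rintegral integral_mkcond -integral12_prod_meas1 //= (eq_integral (cst 0%E)) ?integral0 // => x _ /=.
rewrite -[RHS](h x) [RHS]integral_mkcond; apply: eq_integral => y _.
by rewrite !patchE; congr (if _ then _ else _); apply/idP/idP => /set_mem /= ?; apply/mem_set.
Qed.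

Lemma plane_integral_slices2 D (g : mR * mR -> R) : region D ->
  mu.-integrable (plane D) (EFin \o g) ->
  (forall y, (\int[lebesgue_measure]_(x in [set x : mR | D (x +i* y)]) (g (x, y))%:E)%E = 0) ->
  Rintegral mu (plane D) g = 0.
Proof.
move=> [mD _] ig h; have [+ _] := @integrable_mkcond _ _ _ mu (plane D) (EFin \o g) mD => /(_ ig) ig'.
rewrite /Rintegral integral_mkcond -integral21_prod_meas1 //= (eq_integral (cst 0%E)) ?integral0 // => y _ /=.
rewrite -[RHS](h y) [RHS]integral_mkcond; apply: eq_integral => x _.
by rewrite !patchE; congr (if _ then _ else _); apply/idP/idP => /set_mem /= ?; apply/mem_set.
Qed.

End AreaIntegral.

(** * Real directional derivatives of complex functions *)

Section DirectionalDerivative.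
Context {R : realType}.
Local Notation C := R[i].

Lemma is_derive_mul (f g : R -> R) (t df dg : R) :
  is_derive t 1 f df -> is_derive t 1 g dg ->
  is_derive t 1 (fun u => f u * g u) (df * g t + f t * dg).
Proof.
move=> hf hg; apply: (is_derive_eq (is_deriveM hf hg)).
by rewrite ![_ *: _]/(_ * _) addrC mulrC.
Qed.

Lemma is_derive_add (f g : R -> R) (t df dg : R) :
  is_derive t 1 f df -> is_derive t 1 g dg -> is_derive t 1 (fun u => f u + g u) (df + dg).
Proof. by move=> hf hg; exact: is_deriveD. Qed.

Lemma is_derive_sub (f g : R -> R) (t df dg : R) :
  is_derive t 1 f df -> is_derive t 1 g dg -> is_derive t 1 (fun u => f u - g u) (df - dg).
Proof. by move=> hf hg; exact: is_deriveB. Qed.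

(** The functions involved contain conj(z) and are not holomorphic, so they are differentiated along
    real lines in a direction [d], later 1 and i. *)
Definition dir_deriv (d : C) (G G' : C -> C) := forall (z : C) (t : R),
  is_derive t 1 (fun u : R => Re (G (z + u%:C * d))) (Re (G' (z + t%:C * d)))
  /\ is_derive t 1 (fun u : R => Im (G (z + u%:C * d))) (Im (G' (z + t%:C * d))).

Lemma dir_deriv_cst d (k : C) : dir_deriv d (fun _ => k) (fun _ => 0).
Proof. by move=> z t; split; exact: is_derive_cst. Qed.

Lemma is_derive_affine (x y t : R) : is_derive t 1 (fun u : R => x + u * y) y.
Proof.
have h := is_derive_add (is_derive_cst x t 1) (is_derive_mul (is_derive_id t 1) (is_derive_cst y t 1)).
by apply: (is_derive_eq h); rewrite /= mul1r mulr0 addr0 add0r.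
Qed.

Lemma dir_deriv_id d (c : C) : dir_deriv d (fun z => z - c) (fun _ => d).
Proof.
move=> z t; case: z d c => z1 z2 [d1 d2] [c1 c2]; split.
  have := is_derive_affine (z1 - c1) d1 t.
  by congr is_derive; apply/funext => u /=; ring.
have := is_derive_affine (z2 - c2) d2 t.
by congr is_derive; apply/funext => u /=; ring.
Qed.

Lemma dir_deriv_conj d G G' : dir_deriv d G G' -> dir_deriv d (fun z => (G z)^*) (fun z => (G' z)^*).
Proof.
move=> h z t; have [h1 h2] := h z t; split.
  move: h1; rewrite Num_conjE; case: (G' _) => x y /= h1.
  by move: h1; congr is_derive; apply/funext => u; rewrite Num_conjE; case: (G _).
have := is_derive_sub (is_derive_cst 0 t 1) h2; rewrite sub0r.
have -> : Im (G' (z + t%:C * d))^* = - Im (G' (z + t%:C * d)).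
  by rewrite Num_conjE; case: (G' _).
by congr is_derive; apply/funext => u; rewrite Num_conjE /= sub0r; case: (G _).
Qed.

Lemma dir_derivD d G G' H H' : dir_deriv d G G' -> dir_deriv d H H' ->
  dir_deriv d (fun z => G z + H z) (fun z => G' z + H' z).
Proof.
move=> hG hH z t; have [h1 h2] := hG z t; have [h3 h4] := hH z t; split.
  have := is_derive_add h1 h3; rewrite -ReD.
  by congr is_derive; apply/funext => u; rewrite ReD.
have := is_derive_add h2 h4; rewrite -ImD.
by congr is_derive; apply/funext => u; rewrite ImD.
Qed.

Lemma dir_derivM d G G' H H' : dir_deriv d G G' -> dir_deriv d H H' ->
  dir_deriv d (fun z => G z * H z) (fun z => G' z * H z + G z * H' z).
Proof.
move=> hG hH z t; have [h1 h2] := hG z t; have [h3 h4] := hH z t; split.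
  have h := is_derive_sub (is_derive_mul h1 h3) (is_derive_mul h2 h4).
  have e : Re (G' (z + t%:C * d) * H (z + t%:C * d) + G (z + t%:C * d) * H' (z + t%:C * d))
     = Re (G' (z + t%:C * d)) * Re (H (z + t%:C * d)) + Re (G (z + t%:C * d)) * Re (H' (z + t%:C * d))
     - (Im (G' (z + t%:C * d)) * Im (H (z + t%:C * d)) + Im (G (z + t%:C * d)) * Im (H' (z + t%:C * d))).
    by case: (G _) (G' _) (H _) (H' _) => ? ? [? ?] [? ?] [? ?] /=; ring.
  rewrite e; move: h; congr is_derive; apply/funext => u.
  by case: (G _) (H _) => ? ? [? ?].
have h := is_derive_add (is_derive_mul h1 h4) (is_derive_mul h2 h3).
have e : Im (G' (z + t%:C * d) * H (z + t%:C * d) + G (z + t%:C * d) * H' (z + t%:C * d))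
   = Re (G' (z + t%:C * d)) * Im (H (z + t%:C * d)) + Re (G (z + t%:C * d)) * Im (H' (z + t%:C * d))
   + (Im (G' (z + t%:C * d)) * Re (H (z + t%:C * d)) + Im (G (z + t%:C * d)) * Re (H' (z + t%:C * d))).
  by case: (G _) (G' _) (H _) (H' _) => ? ? [? ?] [? ?] [? ?] /=; ring.
rewrite e; move: h; congr is_derive; apply/funext => u.
by case: (G _) (H _) => ? ? [? ?].
Qed.

Lemma dir_derivX d G (k : C) n : dir_deriv d G (fun _ => k) ->
  dir_deriv d (fun z => G z ^+ n) (fun z => n%:R * k * G z ^+ n.-1).
Proof.
move=> hG; elim: n => [|n IH].
  have -> : (fun z => 0%:R * k * G z ^+ 0.-1) = (fun _ => 0) by apply/funext => z; rewrite !mul0r.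
  exact: dir_deriv_cst.
have -> : (fun z => G z ^+ n.+1) = (fun z => G z * G z ^+ n) by apply/funext => z; rewrite exprS.
have -> : (fun z => n.+1%:R * k * G z ^+ n.+1.-1)
    = (fun z => k * G z ^+ n + G z * (n%:R * k * G z ^+ n.-1)).
  apply/funext => z /=; case: n {IH} => [|n]; first by rewrite expr0; ring.
  by rewrite -[n.+2]addn1 natrD /= exprS; ring.
exact: dir_derivM.
Qed.

Lemma dir_deriv_continuous d G G' z : dir_deriv d G G' ->
  continuous (fun u : R => Re (G (z + u%:C * d))) /\
  continuous (fun u : R => Im (G (z + u%:C * d))).
Proof.
move=> h; split=> t; apply: differentiable_continuous; apply/derivable1_diffP.
  by have [[]] := h z t.
by have [_ []] := h z t.
Qed.

Lemma FTC_real (F f : R -> R) (a b : R) : a <= b -> (forall t : R, is_derive t 1 F (f t)) ->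
  continuous f ->
  (\int[lebesgue_measure]_(x in `[a, b]) (f x)%:E = (F b - F a)%:E)%E.
Proof.
rewrite le_eqVlt => /predU1P[<- _ _|ab hF cf].
  by rewrite subrr set_itv1 integral_set1.
have cF : continuous F.
  by move=> x; apply: differentiable_continuous; apply/derivable1_diffP; have [] := hF x.
rewrite (@continuous_FTC2 _ f F) //.
- exact: continuous_subspaceT.
- split; first by move=> x _; have [] := hF x.
    by apply: cvg_at_right_filter; exact: cF.
  by apply: cvg_at_left_filter; exact: cF.
- by move=> x _; rewrite derive1E; have [_] := hF x.
Qed.

End DirectionalDerivative.

From mathcomp Require Import measurable_realfun.

(** * Integrals over disks and circles *)

Section DiskIntegrals.
Context {R : realType}.
Local Notation C := R[i].
Local Notation mR := (measurableTypeR R).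
Local Notation mu := (lebesgue_measure \x lebesgue_measure)%E.
Implicit Types (c : C) (r : R) (f : C -> C).

Definition cdisk c r : set C := [set z | cmod (z - c) <= r].

Lemma cmod_leE c r (x y : R) : 0 <= r ->
  (cmod ((x +i* y) - c) <= r) = ((x - Re c) ^+ 2 + (y - Im c) ^+ 2 <= r ^+ 2).
Proof.
move=> r0; rewrite -(ler_pXn2r (n := 2)) ?nnegrE ?cmod_ge0 // cmod_sqr.
by case: c.
Qed.

Lemma slice_itv (k m : R) : [set y : R | (y - k) ^+ 2 <= m]
  = if 0 <= m then [set` `[k - Num.sqrt m, k + Num.sqrt m]] else set0.
Proof.
apply/seteqP; split=> y /=; case: ifPn => m0 //=.
- by rewrite in_itv /= -(ler_distl) -sqrtr_sqr ler_sqrt.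
- by move=> h; move: m0; rewrite (le_trans _ h) // sqr_ge0.
- by rewrite in_itv /= -(ler_distl) -sqrtr_sqr ler_sqrt.
Qed.

Let measurable_sqdist c : measurable_fun setT (fun p : mR * mR => (p.1 - Re c) ^+ 2 + (p.2 - Im c) ^+ 2).
Proof.
by apply: measurable_funD; apply: measurable_funX; apply: measurable_funB.
Qed.

Lemma region_cdisk c r : 0 <= r -> cmod c + r <= 1 -> region (cdisk c r).
Proof.
move=> r0 cr; split; last first.
  move=> z; rewrite /cdisk /= => h; have := cmodD (z - c) c; rewrite subrK => h'.
  by apply: le_trans h' _; lra.
have mY : measurable (`]-oo, r ^+ 2]%classic : set mR) by exact: measurable_itv.
have := measurable_sqdist c; move=> /(_ measurableT _ mY).
rewrite setTI; congr measurable; apply/seteqP.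
by split=> p; rewrite /plane /cdisk /= cmod_leE // in_itv.
Qed.

Lemma region_circle : region [set z : C | cmod z = 1].
Proof.
split; last by move=> z /= ->.
have mY : measurable ([set 1] : set mR) by exact: measurable_set1.
have := measurable_sqdist 0; move=> /(_ measurableT _ mY).
rewrite setTI; congr measurable; apply/seteqP; split=> -[x y]; rewrite /plane /= !subr0 => h.
  by rewrite h sqrtr1.
have : (Num.sqrt (x ^+ 2 + y ^+ 2)) ^+ 2 = 1 by rewrite h expr1n.
by rewrite sqr_sqrtr // addr_ge0 ?sqr_ge0.
Qed.

Lemma region_setD (D D' : set C) : region D -> region D' -> region (D `\` D').
Proof.
move=> [m1 h1] [m2 h2]; split; last by move=> z [/h1].
by have := measurableD m1 m2.
Qed.

Lemma cdisk_circle r (z c : C) (x y : R) : 0 <= r -> 0 <= r ^+ 2 - (x - Re c) ^+ 2 ->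
  y = Im c + Num.sqrt (r ^+ 2 - (x - Re c) ^+ 2) \/
  y = Im c - Num.sqrt (r ^+ 2 - (x - Re c) ^+ 2) ->
  cmod ((x +i* y) - c) = r.
Proof.
move=> r0 m0 hy; apply/eqP; rewrite -(eqrXn2 (n := 2)) ?cmod_ge0 // cmod_sqr.
have -> : Im (x +i* y - c) ^+ 2 = r ^+ 2 - (x - Re c) ^+ 2.
  rewrite -[RHS]sqr_sqrtr //; case: c {m0} hy => c1 c2 /=.
  by move=> [->|->]; ring.
by case: c {m0 hy} => c1 c2 /=; apply/eqP; ring.
Qed.

Lemma cdisk_circle' r (z c : C) (x y : R) : 0 <= r -> 0 <= r ^+ 2 - (y - Im c) ^+ 2 ->
  x = Re c + Num.sqrt (r ^+ 2 - (y - Im c) ^+ 2) \/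
  x = Re c - Num.sqrt (r ^+ 2 - (y - Im c) ^+ 2) ->
  cmod ((x +i* y) - c) = r.
Proof.
move=> r0 m0 hy; apply/eqP; rewrite -(eqrXn2 (n := 2)) ?cmod_ge0 // cmod_sqr.
have -> : Re (x +i* y - c) ^+ 2 = r ^+ 2 - (y - Im c) ^+ 2.
  rewrite -[RHS]sqr_sqrtr //; case: c {m0} hy => c1 c2 /=.
  by move=> [->|->]; ring.
by case: c {m0 hy} => c1 c2 /=; apply/eqP; ring.
Qed.

(** A case of the divergence theorem: on each horizontal chord the integral is a difference of
    values of [G] at two points of the circle, where [G] vanishes. The second derivative serves to
    make [G'] continuous along the chords. *)
Lemma disk_integral_dx c r (G G' G'' : C -> C) : 0 <= r -> cmod c + r <= 1 ->
  dir_deriv 1 G G' -> dir_deriv 1 G' G'' -> tame G' ->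
  (forall z, cmod (z - c) = r -> G z = 0) -> area_integral (cdisk c r) G' = 0.
Proof.
move=> r0 cr hG hG' tG' G0; have rD := region_cdisk r0 cr.
have [i1 i2] := tame_integrable rD tG'.
rewrite /area_integral -/(plane (cdisk c r)).
have line (x y : R) : (0 +i* y) + x%:C * 1 = x +i* y :> C.
  by apply/eqP; rewrite eq_complex /=; apply/andP; split; apply/eqP; ring.
have key (pr : C -> R) (h : forall z (t : R), is_derive t 1 (fun u : R => pr (G (z + u%:C * 1))) (pr (G' (z + t%:C * 1))))
    (hc : forall z, continuous (fun u : R => pr (G' (z + u%:C * 1)))) (p0 : pr 0 = 0) (y : mR) :
    (\int[lebesgue_measure]_(x in [set x : mR | cdisk c r (x +i* y)]) (pr (G' (x +i* y)))%:E)%E = 0.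
  have -> : [set x : mR | cdisk c r (x +i* y)]
     = [set x : R | (x - Re c) ^+ 2 <= r ^+ 2 - (y - Im c) ^+ 2].
    by apply/seteqP; split=> x; rewrite /cdisk /= cmod_leE // lerBrDr.
  rewrite slice_itv; case: ifPn => m0; last by rewrite integral_set0.
  set sq := Num.sqrt _.
  have := @FTC_real R (fun x : R => pr (G ((0 +i* y) + x%:C * 1))) (fun x : R => pr (G' ((0 +i* y) + x%:C * 1)))
    (Re c - sq) (Re c + sq) _ (h _) (hc _).
  rewrite !line (G0 _ (cdisk_circle' c r0 m0 (or_introl erefl))) (G0 _ (cdisk_circle' c r0 m0 (or_intror erefl))) p0 subrr.
  under eq_integral => x _ do rewrite line.
  by apply; have := sqrtr_ge0 (r ^+ 2 - (y - Im c) ^+ 2); rewrite -/sq; lra.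
rewrite (plane_integral_slices2 rD i1) ?(plane_integral_slices2 rD i2) ?mulr0 //.
  move=> y; apply: (key (@Im R)) => // z; first by move=> t; have [] := hG z t.
  by have [] := dir_deriv_continuous z hG'.
move=> y; apply: (key (@Re R)) => // z; first by move=> t; have [] := hG z t.
by have [] := dir_deriv_continuous z hG'.
Qed.

Lemma disk_integral_dy c r (G G' G'' : C -> C) : 0 <= r -> cmod c + r <= 1 ->
  dir_deriv 'i%C G G' -> dir_deriv 'i%C G' G'' -> tame G' ->
  (forall z, cmod (z - c) = r -> G z = 0) -> area_integral (cdisk c r) G' = 0.
Proof.
move=> r0 cr hG hG' tG' G0; have rD := region_cdisk r0 cr.
have [i1 i2] := tame_integrable rD tG'.
rewrite /area_integral -/(plane (cdisk c r)).
have line (x y : R) : (x +i* 0) + y%:C * 'i%C = x +i* y :> C.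
  by apply/eqP; rewrite eq_complex /=; apply/andP; split; apply/eqP; ring.
have key (pr : C -> R) (h : forall z (t : R), is_derive t 1 (fun u : R => pr (G (z + u%:C * 'i%C))) (pr (G' (z + t%:C * 'i%C))))
    (hc : forall z, continuous (fun u : R => pr (G' (z + u%:C * 'i%C)))) (p0 : pr 0 = 0) (x : mR) :
    (\int[lebesgue_measure]_(y in [set y : mR | cdisk c r (x +i* y)]) (pr (G' (x +i* y)))%:E)%E = 0.
  have -> : [set y : mR | cdisk c r (x +i* y)]
     = [set y : R | (y - Im c) ^+ 2 <= r ^+ 2 - (x - Re c) ^+ 2].
    by apply/seteqP; split=> y; rewrite /cdisk /= cmod_leE // lerBrDr addrC.
  rewrite slice_itv; case: ifPn => m0; last by rewrite integral_set0.
  set sq := Num.sqrt _.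
  have := @FTC_real R (fun y : R => pr (G ((x +i* 0) + y%:C * 'i%C))) (fun y : R => pr (G' ((x +i* 0) + y%:C * 'i%C)))
    (Im c - sq) (Im c + sq) _ (h _) (hc _).
  rewrite !line (G0 _ (cdisk_circle c r0 m0 (or_introl erefl))) (G0 _ (cdisk_circle c r0 m0 (or_intror erefl))) p0 subrr.
  under eq_integral => y _ do rewrite line.
  by apply; have := sqrtr_ge0 (r ^+ 2 - (x - Re c) ^+ 2); rewrite -/sq; lra.
rewrite (plane_integral_slices1 rD i1) ?(plane_integral_slices1 rD i2) ?mulr0 //.
  move=> y; apply: (key (@Im R)) => // z; first by move=> t; have [] := hG z t.
  by have [] := dir_deriv_continuous z hG'.
move=> y; apply: (key (@Re R)) => // z; first by move=> t; have [] := hG z t.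
by have [] := dir_deriv_continuous z hG'.
Qed.

Local Open Scope ereal_scope.

(* The value [pi] of this area is never needed, only that it is positive and finite. *)
Definition unit_area : \bar R := \int[lebesgue_measure]_(t in `[(-1)%R, 1%R]) (2 * Num.sqrt (1 - t ^+ 2))%:E.

Let G_cont (m k : R) : continuous (fun x : R => 2 * Num.sqrt (m - (x - k) ^+ 2) : R)%R.
Proof.
move=> x; apply: cvgM; first exact: cvg_cst.
apply: (@continuous_comp _ _ _ (fun x : R => m - (x - k) ^+ 2)%R Num.sqrt); last exact: sqrt_continuous.
apply: cvgB; first exact: cvg_cst.
by apply: (@continuous_comp _ _ _ (fun x : R => x - k)%R (fun u : R => u ^+ 2)%R);
  [apply: cvgB; [exact: cvg_id|exact: cvg_cst]|exact: exprn_continuous].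
Qed.

(** Chord lengths are integrated, and the substitution x = Re c + t r isolates the factor r^2. *)
Lemma plane_measure_cdisk c r : (0 < r)%R -> mu (plane (cdisk c r)) = (r ^+ 2)%:E * unit_area.
Proof.
move=> r0; pose G (x : R) : R := (2 * Num.sqrt (r ^+ 2 - (x - Re c) ^+ 2))%R.
pose F (t : R) : R := (Re c + t * r)%R.
have sec (x : mR) : lebesgue_measure (xsection (plane (cdisk c r)) x) = (G x)%:E.
  have -> : xsection (plane (cdisk c r)) x
     = [set y : R | (y - Im c) ^+ 2 <= r ^+ 2 - (x - Re c) ^+ 2]%R.
    by rewrite xsectionE; apply/seteqP; split=> y; rewrite /plane /cdisk /= cmod_leE ?(ltW r0) // lerBrDr addrC.
  rewrite slice_itv; case: ifPn => m0.
    rewrite lebesgue_measure_itv /= lte_fin; case: ifPn => h.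
      by rewrite -EFinB; congr (_%:E); rewrite /G; ring.
    have := sqrtr_ge0 (r ^+ 2 - (x - Re c) ^+ 2)%R; move: h; rewrite -leNgt => h h'.
    by rewrite /G; congr (_%:E); lra.
  by rewrite measure0 /G ler0_sqrtr ?mulr0 //; rewrite -ltNge in m0; exact: ltW.
have -> : mu (plane (cdisk c r)) = \int[lebesgue_measure]_x (G x)%:E.
  by rewrite /product_measure1; apply: eq_integral => x _; exact: sec.
have -> : \int[lebesgue_measure]_x (G x)%:E = \int[lebesgue_measure]_(x in `[F (-1)%R, F 1%R]) (G x)%:E.
  rewrite [RHS]integral_mkcond; apply: eq_integral => x _; rewrite patchE.
  case: ifPn => // hx; rewrite /G ler0_sqrtr ?mulr0 //.
  move: hx; rewrite notin_setE /= in_itv /= => /negP; rewrite /F mul1r mulN1r -ler_distl -ltNge => hx.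
  by rewrite subr_le0 -[((x - _) ^+ 2)%R]real_normK ?num_real // lerXn2r ?nnegrE // ltW.
have dF (t : R) : is_derive t 1%R F r by exact: is_derive_affine.
have F' : F^`()%classic = (fun _ => r).
  by apply/funext => t; rewrite derive1E; have [_] := dF t.
have cF : continuous F.
  by move=> x; apply: differentiable_continuous; apply/derivable1_diffP; have [] := dF x.
rewrite integration_by_substitution_increasing; last first.
- by apply: continuous_subspaceT; exact: G_cont.
- split; first by move=> t _; have [] := dF t.
    by apply: cvg_at_right_filter; exact: cF.
  by apply: cvg_at_left_filter; exact: cF.
- by rewrite F'; exact: is_cvg_cst.
- by rewrite F'; exact: is_cvg_cst.
- by rewrite F' => t _; exact: cvg_cst.
- by move=> x y _ _ xy; rewrite /F ltrD2l ltr_pM2r.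
- by lra.
rewrite /unit_area F' -integralZl //; last first.
  apply: continuous_compact_integrable; first exact: segment_compact.
  apply: continuous_subspaceT => t.
  have := @G_cont 1 0 t; congr continuous_at; apply/funext => u; by rewrite subr0.
have E (t : R) : (G (F t) * r = r ^+ 2 * (2 * Num.sqrt (1 - t ^+ 2)))%R.
  rewrite /G /F.
  have -> : (r ^+ 2 - (Re c + t * r - Re c) ^+ 2 = r ^+ 2 * (1 - t ^+ 2))%R by ring.
  by rewrite sqrtrM ?sqr_ge0 // sqrtr_sqr gtr0_norm //; ring.
by apply: eq_integral => t _; rewrite -EFinM; congr (_%:E); exact: E.
Qed.

Lemma unit_area_bounds : 0 < unit_area < +oo.
Proof.
have r1 : region (cdisk (0%R : C) 1%R) by apply: region_cdisk; rewrite ?cmod0 ?add0r.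
have e : mu (plane (cdisk (0%R : C) 1%R)) = unit_area.
  by rewrite plane_measure_cdisk // expr1n mul1e.
rewrite -e; apply/andP; split; last first.
  by apply: le_lt_trans (region_finite r1) _; rewrite ltry.
(* For positivity: this square lies in the unit disk and has area 1/4. *)
have mI : measurable ((`[0%R, (1/2)%R]%classic : set mR) `*` (`[0%R, (1/2)%R]%classic : set mR)).
  by apply: measurableX.
apply: (@lt_le_trans _ _ (mu ((`[0%R, (1/2)%R]%classic : set mR) `*` (`[0%R, (1/2)%R]%classic : set mR)))).
  rewrite product_measure1E //= !lebesgue_measure_itv /= lte_fin.
  by rewrite ifT -?EFinB -?EFinM ?lte_fin; lra.
apply: le_measure; [exact: mem_set|apply: mem_set; exact: (proj1 r1)|] => -[x y] [] /=.
rewrite !in_itv /= => /andP[x0 x1] /andP[y0 y1].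
change (cmod ((x +i* y) - 0) <= 1)%R; rewrite subr0.
apply: le_trans (cmod_le_ReIm _) _; rewrite /= !ger0_norm //; lra.
Qed.

Local Open Scope ring_scope.

(** The dA-area of the unit disk. It is a common factor of all moments and cancels between the unit
    disk and the holes. *)
Definition kappa : R := pi^-1 * fine unit_area.

Lemma kappa_gt0 : 0 < kappa.
Proof.
have /andP[h0 h1] := unit_area_bounds.
rewrite mulr_gt0 ?invr_gt0 ?pi_gt0 // fine_gt0 //; exact/andP.
Qed.

Lemma area_integral1_cdisk c r : 0 < r -> cmod c + r <= 1 ->
  area_integral (cdisk c r) (fun _ => 1) = (kappa * r ^+ 2)%:C.
Proof.
move=> r0 cr; have [mD _] := region_cdisk (ltW r0) cr.
rewrite /area_integral -/(plane (cdisk c r)) /= !Rintegral_cst //.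
have /andP[h0 h1] := unit_area_bounds.
have fu : unit_area \is a fin_num by rewrite ge0_fin_numE // ltW.
have e : fine ((lebesgue_measure \x lebesgue_measure)%E (plane (cdisk c r))) = r ^+ 2 * fine unit_area.
  by rewrite plane_measure_cdisk // -(fineK fu).
have E (m : R) : m = r ^+ 2 * fine unit_area ->
    (pi^-1 * (1 * m)) +i* (pi^-1 * (0 * m)) = (kappa * r ^+ 2)%:C.
  by move=> ->; apply/eqP; rewrite eq_complex /= /kappa; apply/andP; split; apply/eqP; ring.
by apply: E; exact: e.
Qed.

(** Every vertical slice of the circle has at most two points. *)
Lemma area_integral_circle f : tame f -> area_integral [set z : C | cmod z = 1] f = 0.
Proof.
move=> tf; have [f1 f2] := tame_integrable region_circle tf; have [mD _] := region_circle.
have N0 : mu (plane [set z : C | cmod z = 1]) = 0%E.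
  rewrite /product_measure1 (eq_integral (cst 0%E)) ?integral0 // => x _ /=.
  apply: countable_lebesgue_measure0; apply: (@sub_countable _ _ _ ([set Num.sqrt (1 - x ^+ 2)] `|` [set - Num.sqrt (1 - x ^+ 2)])).
    apply: subset_card_le => y; rewrite xsectionE /plane /= => h.
    have : (Num.sqrt (x ^+ 2 + y ^+ 2)) ^+ 2 = 1 by rewrite h expr1n.
    rewrite sqr_sqrtr ?addr_ge0 ?sqr_ge0 // => h2.
    have -> : 1 - x ^+ 2 = y ^+ 2 by rewrite -h2; ring.
    by rewrite sqrtr_sqr; have [y0|y0] := leP 0 y; [left; rewrite ger0_norm|right; rewrite ltr0_norm ?opprK].
  by apply: finite_set_countable; rewrite finite_setU; split; exact: finite_set1.
rewrite /area_integral -/(plane [set z : C | cmod z = 1]).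
have key (g : mR * mR -> R) : mu.-integrable (plane [set z : C | cmod z = 1]) (EFin \o g) ->
    Rintegral mu (plane [set z : C | cmod z = 1]) g = 0.
  by move=> ig; rewrite /Rintegral null_set_integral //; exact: measurable_int ig.
by rewrite (key _ f1) (key _ f2) mulr0.
Qed.

Lemma region_unit_disk : region (disk (0 : C) 1).
Proof.
have -> : disk (0 : C) 1 = cdisk 0 1 `\` [set z | cmod z = 1].
  apply/seteqP; split=> z; rewrite /disk /cdisk /= subr0.
    by move=> h; split; [exact: ltW|move=> e; rewrite e ltxx in h].
  by move=> [h1 h2]; rewrite lt_neqAle h1 andbT; apply/eqP.
by apply: region_setD; [apply: region_cdisk; rewrite ?cmod0 ?add0r|exact: region_circle].
Qed.

Lemma area_integral_unit_disk f : tame f ->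
  area_integral (disk 0 1) f = area_integral (cdisk 0 1) f.
Proof.
move=> tf; have -> : cdisk (0 : C) 1 = disk 0 1 `|` [set z | cmod z = 1].
  apply/seteqP; split=> z; rewrite /disk /cdisk /= subr0.
    by rewrite le_eqVlt => /predU1P[|]; [right|left].
  by move=> [/ltW|->].
rewrite area_integralU ?area_integral_circle ?addr0 //; [exact: region_unit_disk|exact: region_circle|].
by apply/seteqP; split=> // z; rewrite /disk /= subr0 => -[h e]; rewrite e ltxx in h.
Qed.

(** * Moments of a disk *)

Section Moments.
Variables (c : C) (r : R).
Hypotheses (r0 : 0 < r) (cr : cmod c + r <= 1).

Definition monomial k m (z : C) : C := (z - c) ^+ k * (z - c)^* ^+ m.
Definition moment k m := area_integral (cdisk c r) (monomial k m).

Lemma tame_monomial k m : tame (monomial k m).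
Proof.
have t : tame (fun z => z - c) by apply: tameD; [exact: tame_id|exact: tame_cst].
by apply: tameM; apply: tameX => //; exact: tame_conj.
Qed.

Let reg : region (cdisk c r). Proof. exact: region_cdisk (ltW r0) cr. Qed.

Definition monomial_deriv (d : C) k m (z : C) : C :=
  k%:R * d * monomial k.-1 m z + m%:R * d^* * monomial k m.-1 z.

Lemma dir_deriv_monomial d k m : dir_deriv d (monomial k m) (monomial_deriv d k m).
Proof.
have h := dir_derivM (dir_derivX k (dir_deriv_id d c)) (dir_derivX m (dir_deriv_conj (dir_deriv_id d c))).
have -> : monomial_deriv d k m = (fun z => k%:R * d * (z - c) ^+ k.-1 * (z - c)^* ^+ m
   + (z - c) ^+ k * (m%:R * d^* * (z - c)^* ^+ m.-1)).
  by apply/funext => z; rewrite /monomial_deriv /monomial; ring.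
exact: h.
Qed.

Lemma dir_deriv_scale d (q : C) G G' : dir_deriv d G G' ->
  dir_deriv d (fun z => q * G z) (fun z => q * G' z).
Proof.
move=> h; have := dir_derivM (dir_deriv_cst d q) h.
by congr dir_deriv; apply/funext => z; rewrite mul0r add0r.
Qed.

(** This is (z - c)^k conj(z - c)^m (r^2 - |z - c|^2), chosen to vanish on the circle. *)
Let bump k m (z : C) : C := (r ^+ 2)%:C * monomial k m z + -1 * monomial k.+1 m.+1 z.
Let bump' d k m (z : C) : C := (r ^+ 2)%:C * monomial_deriv d k m z + -1 * monomial_deriv d k.+1 m.+1 z.

Let dir_bump d k m : dir_deriv d (bump k m) (bump' d k m).
Proof. by apply: dir_derivD; apply: dir_deriv_scale; exact: dir_deriv_monomial. Qed.

Let bump_circle k m z : cmod (z - c) = r -> bump k m z = 0.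
Proof.
move=> e; rewrite /bump /monomial -e -mul_conj !exprS; ring.
Qed.

Let tame_bump' d k m : tame (bump' d k m).
Proof.
have tc q : tame (fun _ : C => q) by exact: tame_cst.
have tZ q f : tame f -> tame (fun z => q * f z) by move=> tf; apply: tameM.
have tdm i j : tame (monomial_deriv d i j) by apply: tameD; apply: tZ; exact: tame_monomial.
by apply: tameD; apply: tZ.
Qed.

Let bump'_deriv d k m : exists G'', dir_deriv d (bump' d k m) G''.
Proof.
eexists; apply: dir_derivD; apply: dir_deriv_scale; apply: dir_derivD; apply: dir_deriv_scale; exact: dir_deriv_monomial.
Qed.

Let int_bump' d k m : area_integral (cdisk c r) (bump' d k m)
  = d * ((r ^+ 2)%:C * k%:R * moment k.-1 m - k.+1%:R * moment k m.+1)
  + d^* * ((r ^+ 2)%:C * m%:R * moment k m.-1 - m.+1%:R * moment k.+1 m).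
Proof.
have tc q : tame (fun _ : C => q) by exact: tame_cst.
have tm i j : tame (monomial i j) by exact: tame_monomial.
have tZ q f : tame f -> tame (fun z => q * f z) by move=> tf; apply: tameM.
have tdm i j : tame (monomial_deriv d i j) by apply: tameD; apply: tZ.
have e i j : area_integral (cdisk c r) (monomial_deriv d i j)
   = i%:R * d * moment i.-1 j + j%:R * d^* * moment i j.-1.
  by rewrite /monomial_deriv area_integralD ?area_integralZ //; apply: tZ.
rewrite /bump' area_integralD ?area_integralZ // ?e /=; [ring|exact: tZ|exact: tZ].
Qed.

(** The directions 1 and i give X + Y = 0 and X - Y = 0, where X and Y are the integrals of the two
    Wirtinger derivatives of [bump]. *)
Lemma moment_recurrences k m :
  (r ^+ 2)%:C * k%:R * moment k.-1 m = k.+1%:R * moment k m.+1 /\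
  (r ^+ 2)%:C * m%:R * moment k m.-1 = m.+1%:R * moment k.+1 m.
Proof.
have [G1 h1] := bump'_deriv 1 k m; have [G2 h2] := bump'_deriv 'i%C k m.
have e1 := disk_integral_dx (ltW r0) cr (dir_bump 1 k m) h1 (tame_bump' 1 k m) (fun z => @bump_circle k m z).
have e2 := disk_integral_dy (ltW r0) cr (dir_bump 'i%C k m) h2 (tame_bump' 'i%C k m) (fun z => @bump_circle k m z).
move: e1 e2; rewrite !int_bump'.
set X := _ - _; set Y := _ - (m.+1%:R * _).
have c1 : 1^* = 1 :> C by rewrite Num_conjE /= oppr0.
have ci : ('i%C)^* = - 'i%C :> C by rewrite Num_conjE; apply/eqP; rewrite eq_complex /= oppr0 !eqxx.
rewrite c1 ci !mul1r mulNr => e1 /eqP; rewrite subr_eq0 => /eqP e2.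
have i0 : 'i%C != 0 :> C by rewrite eq_complex /= oner_eq0 andbF.
have XY : X = Y by apply: (mulfI i0).
have X0 : X = 0.
  have : 2%:R * X = 0 by rewrite -e1 -XY; ring.
  by move=> /eqP; rewrite mulf_eq0 pnatr_eq0 /= => /eqP.
split; apply/eqP; rewrite -subr_eq0; apply/eqP; first exact: X0.
by rewrite -/Y -XY X0.
Qed.

(** The recurrences lower both exponents together; once exactly one of them is 0, a factor 0 forces
    the moment to vanish, and equal exponents end at the area. *)
Lemma momentE k m :
  moment k m = if k == m then (kappa * r ^+ 2)%:C * (r ^+ 2)%:C ^+ k / k.+1%:R else 0.
Proof.
have nz n : n.+1%:R != 0 :> C by rewrite pnatr_eq0.
elim: k m => [|k IH] [|m].
- have := area_integral1_cdisk r0 cr; rewrite eqxx expr0 mulr1 divr1 => <-.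
  by congr area_integral; apply/funext => z; rewrite /monomial !expr0 mulr1.
- have [h _] := moment_recurrences 0 m; move: h; rewrite mulr0 mul0r => /esym/eqP.
  by rewrite mulf_eq0 (negPf (nz _)) /= => /eqP.
- have [_ h] := moment_recurrences k 0; move: h; rewrite mulr0 mul0r => /esym/eqP.
  by rewrite mulf_eq0 (negPf (nz _)) /= => /eqP.
- have [h _] := moment_recurrences k.+1 m; apply: (mulfI (nz k.+1)).
  rewrite -h /= IH eqSS; case: ifP => _; last by rewrite !mulr0.
  have := nz k.+1; have := nz k; move: (k.+1%:R) (k.+2%:R) ((kappa * r ^+ 2)%:C) ((r ^+ 2)%:C) => p q K Q p0 q0.
  rewrite exprS.
  by field; rewrite p0 q0.
Qed.

End Moments.

End DiskIntegrals.

(** * Limits up to an error *)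

Section Within.
Context {R : realType}.
Local Notation C := R[i].
Implicit Types (u v : nat -> C) (l k : C) (B : R).

(** The upper limit of |u N - l| is at most [B]; for B = 0 this is convergence. Carrying [B] along
    lets errors be added without naming limits that are known only approximately. *)
Definition within u l B := forall e : R, 0 < e ->
  exists N0, forall N, (N0 <= N)%N -> cmod (u N - l) <= B + e.

Lemma within_le u l B B' : B <= B' -> within u l B -> within u l B'.
Proof.
by move=> hB h e /h[N0 {}h]; exists N0 => N /h {}h; apply: le_trans h _; rewrite lerD2r.
Qed.

Lemma within_cst u l B : (forall N, cmod (u N - l) <= B) -> within u l B.
Proof. by move=> h e e0; exists 0%N => N _; apply: le_trans (h N) _; rewrite lerDl ltW. Qed.

Lemma within_eq u v l B : (forall N, u N = v N) -> within u l B -> within v l B.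
Proof. by move=> h; have -> : u = v by apply/funext. Qed.

Lemma withinD u v l k B B' : within u l B -> within v k B' ->
  within (fun N => u N + v N) (l + k) (B + B').
Proof.
move=> hu hv e e0; have e2 : 0 < e / 2 by rewrite divr_gt0.
have [N1 h1] := hu _ e2; have [N2 h2] := hv _ e2.
exists (maxn N1 N2) => N; rewrite geq_max => /andP[/h1 {}h1 /h2 {}h2].
by rewrite opprD addrACA; apply: le_trans (cmodD _ _) _; lra.
Qed.

Lemma withinM k u l B : within u l B -> within (fun N => k * u N) (k * l) (cmod k * B).
Proof.
move=> hu e e0; have k1 : 0 < cmod k + 1 by rewrite ltr_wpDl ?cmod_ge0.
have [N0 h] := hu _ (divr_gt0 e0 k1); exists N0 => N /h {}h.
rewrite -mulrBr cmodM; apply: le_trans (ler_wpM2l (cmod_ge0 k) h) _.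
rewrite mulrDr lerD2l mulrA ler_pdivrMr // mulrC ler_wpM2l ?(ltW e0) //.
by rewrite lerDl.
Qed.

Lemma within_sum (I : Type) (s : seq I) (u : I -> nat -> C) (l : I -> C) (B : I -> R) :
  (forall i, within (u i) (l i) (B i)) ->
  within (fun N => \sum_(i <- s) u i N) (\sum_(i <- s) l i) (\sum_(i <- s) B i).
Proof.
move=> h; elim: s => [|i s IH].
  by apply: within_cst => N; rewrite !big_nil subrr cmod0.
rewrite !big_cons; apply: (within_eq (u := fun N => u i N + \sum_(j <- s) u j N)).
  by move=> N; rewrite big_cons.
exact: withinD.
Qed.

Lemma within_shift u l B : within u l B -> within (fun N => u N.+1) l B.
Proof. by move=> h e /h[N0 {}h]; exists N0 => N hN; apply: h; exact: leqW. Qed.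

Lemma within_trans u v l B B' :
  within (fun N => v N - u N) 0 B' -> within u l B -> within v l (B + B').
Proof.
move=> h1 h2; rewrite -[l]addr0; apply: within_eq (withinD h2 h1) => N.
by rewrite addrC subrK.
Qed.

(** An asymptotic expansion is read off from two evaluations of the same sum over words. *)
Lemma within_unique u l k B B' : within u l B -> within u k B' -> cmod (l - k) <= B + B'.
Proof.
move=> hu hv; apply/ler_addgt0Pr => e e0; have e2 : 0 < e / 2 by rewrite divr_gt0.
have [N1 h1] := hu _ e2; have [N2 h2] := hv _ e2.
have {}h1 := h1 (maxn N1 N2) (leq_maxl _ _); have {}h2 := h2 (maxn N1 N2) (leq_maxr _ _).
have -> : l - k = (u (maxn N1 N2) - k) - (u (maxn N1 N2) - l) by ring.
by apply: le_trans (cmodB_le _ _) _; lra.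
Qed.

Lemma within_limit u l B : (forall e, 0 < e -> within u l (B + e)) -> within u l B.
Proof.
move=> h e e0; have e2 : 0 < e / 2 by rewrite divr_gt0.
have [N0 {}h] := h _ e2 _ e2; exists N0 => N /h {}h; apply: le_trans h _.
by rewrite -addrA -splitr.
Qed.

Lemma withinD0 u v l k : within u l 0 -> within v k 0 -> within (fun N => u N + v N) (l + k) 0.
Proof. by move=> hu hv; have := withinD hu hv; rewrite addr0. Qed.

Lemma withinM0 k u l : within u l 0 -> within (fun N => k * u N) (k * l) 0.
Proof. by move=> /(withinM k); rewrite mulr0. Qed.

Lemma within_sum0 (I : Type) (s : seq I) (u : I -> nat -> C) (l : I -> C) :
  (forall i, within (u i) (l i) 0) ->
  within (fun N => \sum_(i <- s) u i N) (\sum_(i <- s) l i) 0.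
Proof. by move=> h; have := within_sum s h; rewrite [X in within _ _ X]big1. Qed.

Lemma within_cst0 k : within (fun _ => k) k 0.
Proof. by apply: within_cst => N; rewrite subrr cmod0. Qed.

Lemma within_dist u l (k : C) (B : R) N1 : within u l 0 ->
  (forall N, (N1 <= N)%N -> cmod (k - u N) <= B) -> cmod (k - l) <= B.
Proof.
move=> hu h; have hB : within u k B.
  move=> e e0; exists N1 => N /h hN; rewrite cmodB; apply: le_trans hN _.
  by rewrite lerDl ltW.
by have := within_unique hB hu; rewrite addr0.
Qed.

Lemma expr_small (q e : R) : 0 <= q < 1 -> 0 < e -> exists N0, forall N, (N0 <= N)%N -> q ^+ N <= e.
Proof.
move=> /andP[q0 q1] e0; have : `|q| < 1 by rewrite ger0_norm.
move=> /cvg_expr /cvgrPdist_le /(_ e e0)[N0 _ h]; exists N0 => N hN.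
have := h N hN; rewrite /= sub0r normrN ger0_norm // exprn_ge0 //.
Qed.

Lemma scaled_expr_small (q X e : R) : 0 <= q < 1 -> 0 <= X -> 0 < e -> exists V, X * q ^+ V <= e.
Proof.
move=> hq X0 e0; have D0 : 0 < X + 1 by rewrite ltr_wpDl.
have [V hV] := expr_small hq (divr_gt0 e0 D0); exists V.
apply: le_trans (ler_wpM2l X0 (hV V (leqnn _))) _.
by rewrite mulrCA ler_piMr ?(ltW e0) // ler_pdivrMr // mul1r lerDl.
Qed.

(** The fourth power absorbs every polynomial factor met later, the largest being (n + 2) (n +
    1)^2. *)
Lemma quartic_expr_bounded (q : R) : 0 <= q < 1 ->
  exists2 K, 0 <= K & forall n, q ^+ n * n.+1%:R ^+ 4 <= K.
Proof.
move=> /andP[q0 q1]; have [->|qn0] := eqVneq q 0.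
  exists 1 => // -[|n]; first by rewrite expr0 expr1n mul1r.
  by rewrite expr0n mul0r.
have qp : 0 < q by rewrite lt_neqAle eq_sym qn0.
have k0 : 0 < - ln q by rewrite oppr_gt0 ln_lt0 // qp.
have [K K0 h] := expR_dominates4 k0; exists K; first exact: ltW.
move=> n; have := h n%:R (ler0n _ _); rewrite mulrC mulNr opprK mulrC expRM_natr lnK //.
by rewrite -natr1 addrC [X in X <= _]mulrC addrC.
Qed.

End Within.

(** * The negative binomial series *)

Section NegativeBinomial.
Context {R : realType}.
Local Notation C := R[i].

(** Pascal's rule, with the boundary term kept so that the sums stay finite. *)
Lemma negbin_rec (K : comPzRingType) (x : K) k N :
  (1 - x) * \sum_(m < N) x ^+ (m - k.+1) *+ 'C(m, k.+1)
   = \sum_(m < N) x ^+ (m - k) *+ 'C(m, k) - x ^+ (N - k.+1) *+ 'C(N, k.+1).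
Proof.
elim: N => [|N IH]; first by rewrite !big_ord0 bin0n mulr0n subr0 mulr0.
rewrite !big_ord_recr /= mulrDr IH binS mulrnDr subSS.
have e : x * (x ^+ (N - k.+1) *+ 'C(N, k.+1)) = x ^+ (N - k) *+ 'C(N, k.+1).
  case: (ltnP k N) => kN; last by rewrite bin_small ?ltnS // !mulr0n mulr0.
  by rewrite mulrnAr -exprS -subSn // subSS.
by rewrite mulrBl mul1r e; ring.
Qed.

Lemma negbin_bound (y : R) k N : 0 <= y < 1 ->
  \sum_(m < N) y ^+ (m - k) *+ 'C(m, k) <= ((1 - y) ^+ k.+1)^-1.
Proof.
move=> hy; have /andP[y0 y1] := hy; have h : 0 < 1 - y by rewrite subr_gt0.
elim: k => [|k IH].
  under eq_bigr => m _ do rewrite bin0 subn0 mulr1n.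
  rewrite expr1 -[_^-1]mul1r ler_pdivlMr // mulrC -opprB mulNr -subrX1 opprB lerBlDr lerDl.
  by rewrite exprn_ge0.
rewrite exprS invfM -[X in X * _]mulr1 -mulrA mul1r -ler_pdivrMl ?invr_gt0 // invrK negbin_rec.
apply: le_trans IH; rewrite lerBlDr lerDl mulrn_wge0 // exprn_ge0 //.
Qed.

(** For y strictly between |x| and 1 the numbers binom(N, k) y^(N-k) stay bounded, while (|x| /
    y)^(N-k) tends to 0. *)
Lemma binom_expr_small (x : C) k : cmod x < 1 ->
  within (fun N => x ^+ (N - k) *+ 'C(N, k)) 0 0.
Proof.
move=> x1 e e0; have x0 := cmod_ge0 x.
have [y [y0 y1 xy]] : exists y, [/\ 0 < y, y < 1 & cmod x < y].
  by exists ((cmod x + 1) / 2); split; lra.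
pose B := ((1 - y) ^+ k.+1)^-1.
have B0 : 0 < B by rewrite invr_gt0 exprn_gt0 // subr_gt0.
have q01 : 0 <= cmod x / y < 1.
  by rewrite divr_ge0 ?(ltW y0) //= ltr_pdivrMr // mul1r.
have [N0 hN0] := expr_small q01 (divr_gt0 e0 B0).
exists (N0 + k)%N => N hN; rewrite subr0 add0r -mulr_natl cmodM cmod_nat cmodX.
have -> : 'C(N, k)%:R * cmod x ^+ (N - k) = (y ^+ (N - k) *+ 'C(N, k)) * (cmod x / y) ^+ (N - k).
  have ey : (y * (cmod x / y)) ^+ (N - k) = cmod x ^+ (N - k) by rewrite mulrC divfK ?gt_eqF.
  by rewrite -ey exprMn -[in RHS]mulr_natl mulrA.
have h1 : y ^+ (N - k) *+ 'C(N, k) <= B.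
  apply: le_trans (negbin_bound k N.+1 _); last by rewrite (ltW y0).
  rewrite big_ord_recr /= lerDr sumr_ge0 // => m _; rewrite mulrn_wge0 // exprn_ge0 // ltW //.
have h2 : (cmod x / y) ^+ (N - k) <= e / B.
  by apply: hN0; rewrite leq_subRL 1?addnC // (leq_trans _ hN) // leq_addl.
apply: le_trans (_ : B * (e / B) <= _); last by rewrite mulrC divfK // gt_eqF.
case/andP: q01 => q0 _; apply: ler_pM => //; last exact: exprn_ge0.
by rewrite mulrn_wge0 // exprn_ge0 // ltW.
Qed.

(** With k + 1 in place of k it sums the contribution of the k-th Taylor coefficient of a polynomial
    at the centre of a hole. *)
Lemma negbin_series (x : C) k : cmod x < 1 ->
  within (fun N => \sum_(m < N) x ^+ (m - k) *+ 'C(m, k)) ((1 - x) ^- k.+1) 0.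
Proof.
move=> x1; have d0 : 1 - x != 0.
  by rewrite subr_eq0; apply: contraTneq x1 => <-; rewrite cmod1 ltxx.
elim: k => [|k IH].
  have := withinM0 (1 - x)^-1 (withinD0 (within_cst0 1) (withinM0 (-1) (binom_expr_small 0 x1))).
  rewrite mulr0 addr0 mulr1 expr1; apply: within_eq => N; apply: (mulfI d0).
  under [in RHS]eq_bigr => m _ do rewrite bin0 subn0 mulr1n.
  rewrite mulVKf // bin0 subn0 mulr1n.
  have -> : (1 - x) * \sum_(m < N) x ^+ m = - ((x - 1) * \sum_(m < N) x ^+ m) by ring.
  by rewrite -subrX1; ring.
have := withinM0 (1 - x)^-1 (withinD0 IH (withinM0 (-1) (binom_expr_small k.+1 x1))).
rewrite mulr0 addr0 [in X in _ -> within _ X _]exprS invfM.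
apply: within_eq => N; apply: (mulfI d0).
by rewrite mulVKf // negbin_rec; ring.
Qed.

End NegativeBinomial.

(** * Orthogonality and the functional equation *)

Section Representation.
Context {R : realType} {s : nat}.
Context (c : 'I_s -> R[i]) (r : 'I_s -> R) (a : 'I_s -> R[i]) (sigma : 'I_s -> R).
Hypothesis cm : is_cmcd c r.
Hypothesis un : forall j, is_uniformizer (c j) (r j) (a j) (sigma j).
Hypothesis rho_gt0 : 0 < rho a.
Local Notation C := R[i].
Local Notation pullback := (pullback c r a sigma).
Implicit Types (p : {poly C}) (z : C).

Let rj0 j : 0 < r j. Proof. exact: (radius_gt0 cm). Qed.
Let crj j : cmod (c j) + r j <= 1. Proof. exact: ltW (center_radius_lt1 cm j). Qed.
Let reg j : region (cdisk (c j) (r j)). Proof. exact: region_cdisk (ltW (rj0 j)) (crj j). Qed.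

Lemma holes_bound : exists h : R, [/\ 0 < h, h < 1 & forall j, cmod (c j) + r j <= h].
Proof.
exists (\big[Num.max/(1/2)]_j (cmod (c j) + r j)); split.
- by apply: (@lt_le_trans _ _ (1/2)); [lra|exact: bigmax_ge_id].
- by apply/bigmax_ltP; split=> [|j _]; [lra|exact: center_radius_lt1].
- by move=> j; exact: le_bigmax.
Qed.

Lemma cmcd_area_split f : tame f ->
  area_integral (disk 0 1) f
   = area_integral (cmcd c r) f + \sum_j area_integral (cdisk (c j) (r j)) f.
Proof.
move=> tf; pose U (l : seq 'I_s) : set C := [set z | exists2 j, j \in l & cdisk (c j) (r j) z].
have hU l : uniq l -> region (U l) /\ area_integral (U l) f = \sum_(j <- l) area_integral (cdisk (c j) (r j)) f.
  elim: l => [|j l IH] /=.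
    have e0 : U [::] = set0 by apply/seteqP; split=> // z [].
    have r0 : region (set0 : set C).
      split => //; have -> : plane (set0 : set C) = set0 by [].
      exact: measurable0.
    rewrite big_nil e0; split=> //; rewrite /area_integral.
    have -> : [set p : measurableTypeR R * measurableTypeR R | (set0 : set C) (p.1 +i* p.2)] = set0 by [].
    by rewrite !Rintegral_set0 mulr0.
  move=> /andP[jl ul]; have [rU eU] := IH ul.
  have e : U (j :: l) = cdisk (c j) (r j) `|` U l.
    apply/seteqP; split=> z.
      by move=> [k]; rewrite inE => /predU1P[->|kl] hz; [left|right; exists k].
    by move=> [hz|[k kl hz]]; [exists j; rewrite ?mem_head|exists k; rewrite // inE kl orbT].
  rewrite big_cons e; split.
    split; last by move=> z [/(proj2 (reg j))|/(proj2 rU)].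
    by have := measurableU _ _ (proj1 (reg j)) (proj1 rU).
  rewrite area_integralU ?eU //; apply/seteqP; split=> // z [hz [k kl hk]].
  have jk : j = k := disk_disjoint cm hz hk.
  by move: jl; rewrite jk kl.
have [rU eU] := hU _ (index_enum_uniq 'I_s).
have e1 : cmcd c r = disk 0 1 `\` U (index_enum 'I_s).
  rewrite /cmcd; congr (_ `\` _); apply/seteqP; split=> z [j jP].
    by rewrite closure_disk // => hz; exists j => //; rewrite mem_index_enum.
  by move=> hz; exists j => //; rewrite closure_disk.
have rc : region (cmcd c r) by rewrite e1; apply: region_setD => //; exact: region_unit_disk.
have e2 : disk (0 : C) 1 = cmcd c r `|` U (index_enum 'I_s).
  rewrite e1; apply/seteqP; split=> z.
    by move=> hz; have [hU'|hU'] := pselect (U (index_enum 'I_s) z); [right|left].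
  move=> [[]//|[j _]]; rewrite /cdisk /disk /= subr0 => hz.
  have := cmodD (z - c j) (c j); rewrite subrK => h; apply: le_lt_trans h _.
  by apply: le_lt_trans (center_radius_lt1 cm j); rewrite addrC lerD2l.
rewrite -eU [in LHS]e2 area_integralU //.
by apply/seteqP; split=> // z; rewrite e1 => -[[_ h1] h2].
Qed.

Lemma tame_horner p : tame (fun z => p.[z]).
Proof.
have -> : (fun z => p.[z]) = (fun z => \sum_(i < size p) p`_i * z ^+ i).
  by apply/funext => z; rewrite horner_coef.
apply: tame_sum => i; apply: tameM; first exact: tame_cst.
by apply: tameX; exact: tame_id.
Qed.

Lemma tame_moment_integrand p m : tame (fun z => p.[z] * (z ^+ m)^*).
Proof.
apply: tameM; first exact: tame_horner.
by apply: tame_conj; apply: tameX; exact: tame_id.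
Qed.

Definition hole_moment p j m : C :=
  kappa%:C^-1 * area_integral (cdisk (c j) (r j)) (fun z => p.[z] * (z ^+ m)^*).

Let kC : kappa%:C != 0 :> C.
Proof. by rewrite (fmorph_eq0 (real_complex R)) gt_eqF // kappa_gt0. Qed.

Lemma unit_disk_moment p m :
  area_integral (disk 0 1) (fun z => p.[z] * (z ^+ m)^*) = kappa%:C * p`_m / m.+1%:R.
Proof.
rewrite area_integral_unit_disk; last exact: tame_moment_integrand.
have e : (fun z : C => p.[z] * (z ^+ m)^*) = (fun z => \sum_(i < size p) p`_i * monomial 0 i m z).
  apply/funext => z; rewrite horner_coef mulr_suml; apply: eq_bigr => i _.
  by rewrite /monomial subr0 rmorphXn mulrA.
have r1 : cmod (0 : C) + 1 <= 1 :> R by rewrite cmod0 add0r.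
rewrite e area_integral_sum; last 2 first.
- exact: region_cdisk ler01 r1.
- by move=> i; exact: tame_monomial.
under eq_bigr => i _ do rewrite -/(moment 0 1 i m) (momentE ltr01 r1).
have [mp|mp] := ltnP m (size p).
  rewrite (bigD1 (Ordinal mp)) //= eqxx big1 ?addr0; last first.
    by move=> i; rewrite -val_eqE /= => /negPf ->; rewrite mulr0.
  have e1 : (1 : R)%:C = 1 :> C by [].
  by rewrite !expr1n ?e1 ?expr1n !mulr1; ring.
rewrite nth_default // mulr0 mul0r big1 // => i _; rewrite ifN ?mulr0 //.
by rewrite ltn_eqF // (leq_trans (ltn_ord i)).
Qed.

(* On the unit disk [z^m] only sees the coefficient [p_m]. *)
Lemma orthogonal_coef p n m : monic_orthogonal (cmcd c r) n p -> (m < n)%N ->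
  p`_m = m.+1%:R * \sum_j hole_moment p j m.
Proof.
move=> [_ _ h] mn; have := cmcd_area_split (tame_moment_integrand p m).
rewrite (h m mn) add0r unit_disk_moment => e.
have m0 : m.+1%:R != 0 :> C by rewrite pnatr_eq0.
rewrite /hole_moment -mulr_sumr -e; have := kC.
move: (kappa%:C) m0; move: (m.+1%:R) => q K q0 K0.
by field; rewrite ?K0 ?q0.
Qed.

Lemma hole_moment_bound : exists2 K : R, 0 <= K & forall p j m (h M : R),
  (forall j, cmod (c j) + r j <= h) -> 0 <= M ->
  (forall z, cmod z <= h -> cmod p.[z] <= M) -> cmod (hole_moment p j m) <= K * M * h ^+ m.
Proof.
have [K K0 hK] := @area_integral_bound R; exists (K / kappa).
  by rewrite divr_ge0 // ltW // kappa_gt0.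
move=> p j m h M hh M0 hM; rewrite /hole_moment cmodM cmodV cmod_real gtr0_norm ?kappa_gt0 //.
have h0 : 0 <= h by apply: le_trans (hh j); rewrite addr_ge0 ?cmod_ge0 // ltW.
have inh z : cdisk (c j) (r j) z -> cmod z <= h.
  rewrite /cdisk /= => hz; apply: le_trans (hh j); have := cmodD (z - c j) (c j).
  by rewrite subrK => h1; apply: le_trans h1 _; rewrite addrC lerD2l.
have := hK _ _ (M * h ^+ m) (reg j) (tame_moment_integrand p m) _.
rewrite ger0_norm ?mulr_ge0 ?exprn_ge0 // => h1.
have -> : K / kappa * M * h ^+ m = kappa^-1 * (K * (M * h ^+ m)) by ring.
rewrite ler_wpM2l ?invr_ge0 ?(ltW kappa_gt0) //; apply: h1 => z /inh hz.
rewrite cmodM cmod_conj cmodX; apply: ler_pM; rewrite ?exprn_ge0 ?cmod_ge0 ?hM //.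
by rewrite lerXn2r ?nnegrE ?cmod_ge0.
Qed.

(** Taylor expansion of [p] at c_j and binomial expansion of conj(z)^m leave only diagonal moments
    of the disk; the factor m + 1 turns binom(m, k) / (k + 1) into binom(m + 1, k + 1). *)
Lemma hole_momentE p j m : let q := p \Po ('X + (c j)%:P) in
  m.+1%:R * hole_moment p j m
   = \sum_(k < size q) q`_k * (r j ^+ 2)%:C ^+ k.+1 * (((c j)^*) ^+ (m - k) *+ 'C(m.+1, k.+1)).
Proof.
move=> q.
have e : (fun z : C => p.[z] * (z ^+ m)^*)
   = (fun z => \sum_(k < size q) q`_k * (\sum_(i < m.+1) (((c j)^*) ^+ (m - i) *+ 'C(m, i)) * monomial (c j) k i z)).
  apply/funext => z; have -> : p.[z] = q.[z - c j] by rewrite horner_comp hornerD hornerX hornerC subrK.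
  rewrite horner_coef mulr_suml; apply: eq_bigr => k _; rewrite -mulrA; congr (_ * _).
  have -> : (z ^+ m)^* = ((c j)^* + (z - c j)^*) ^+ m by rewrite -rmorphD -rmorphXn addrC subrK.
  rewrite [X in _ * X]exprDn mulr_sumr; apply: eq_bigr => i _.
  by rewrite /monomial -mulrnAl mulrCA.
have tm k i : tame (monomial (c j) k i) by exact: tame_monomial.
rewrite /hole_moment e area_integral_sum //; last first.
  by move=> k; apply: tame_sum => i; apply: tameM => //; exact: tame_cst.
rewrite mulrA mulr_sumr; apply: eq_bigr => k _.
rewrite area_integral_sum //.
under eq_bigr => i _ do rewrite -/(moment (c j) (r j) k i) (momentE (rj0 j) (crj j)).
have -> : \sum_(i < m.+1) ((c j)^* ^+ (m - i) *+ 'C(m, i) *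
     (if k == i :> nat then (kappa * r j ^+ 2)%:C * (r j ^+ 2)%:C ^+ k / k.+1%:R else 0))
   = (c j)^* ^+ (m - k) *+ 'C(m, k) * ((kappa * r j ^+ 2)%:C * (r j ^+ 2)%:C ^+ k / k.+1%:R).
  have [km|km] := ltnP k m.+1.
    rewrite (bigD1 (Ordinal km)) //= eqxx big1 ?addr0 // => i.
    by rewrite -val_eqE /= eq_sym => /negPf ->; rewrite mulr0.
  rewrite bin_small // mulr0n mul0r big1 // => i _; rewrite ifN ?mulr0 //.
  by rewrite gtn_eqF // (leq_trans (ltn_ord i)).
rewrite -[_ *+ 'C(m, k)]mulr_natr -[_ *+ 'C(m.+1, k.+1)]mulr_natr.
have eb : m.+1%:R * 'C(m, k)%:R = k.+1%:R * 'C(m.+1, k.+1)%:R :> C.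
  by rewrite -!natrM mul_bin_diag.
have k0 : k.+1%:R != 0 :> C by rewrite pnatr_eq0.
have eb' : 'C(m.+1, k.+1)%:R = m.+1%:R * 'C(m, k)%:R / k.+1%:R :> C.
  by rewrite eb mulrC mulKf.
have eK : (kappa * r j ^+ 2)%:C = kappa%:C * (r j ^+ 2)%:C :> C by rewrite rmorphM.
rewrite eb' eK [in RHS]exprS; move: kC k0.
move: (kappa%:C) ((r j ^+ 2)%:C) ('C(m, k)%:R) (k.+1%:R) (m.+1%:R) => K Q b k1 m1 K0 k0.
by field; rewrite K0 k0.
Qed.

(** Since sum_m (m + 1) conj(w)^m z^m = (1 - z conj(w))^-2, the limit is the integral of [p] against
    this kernel over the hole. It is found termwise: each Taylor coefficient gives a negative
    binomial series, and together they form the Taylor polynomial at [T j z]. *)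
Lemma hole_moment_series p j z : cmod z <= 1 ->
  within (fun N => \sum_(m < N) m.+1%:R * hole_moment p j m * z ^+ m) (pullback j (horner p) z) 0.
Proof.
move=> z1; set q := p \Po ('X + (c j)%:P); pose x := (c j)^* * z.
have dz := le1_in_domain un rho_gt0 z1.
have x1 : cmod x < 1.
  by rewrite /x cmodM cmod_conj (center_mul_lt1 cm un).
have d0 : 1 - x != 0 by rewrite /x cmod_conjM_lt1 // (center_mul_lt1 cm un).
have := within_sum0 (index_enum 'I_(size q)) (fun k : 'I_(size q) =>
  withinM0 (q`_k * (r j ^+ 2)%:C ^+ k.+1 * z ^+ k) (within_shift (negbin_series k.+1 x1))).
have -> : \sum_(k <- index_enum 'I_(size q)) q`_k * (r j ^+ 2)%:C ^+ k.+1 * z ^+ k * (1 - x) ^- k.+2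
   = pullback j (horner p) z.
  rewrite /pullback (TmapE cm un rho_gt0) //.
  have -> : p.[c j + (r j ^+ 2)%:C * z / (1 - (c j)^* * z)] = q.[(r j ^+ 2)%:C * z / (1 - x)].
    by rewrite horner_comp hornerD hornerX hornerC addrC.
  rewrite horner_coef mulr_sumr; apply: eq_bigr => k _; rewrite -/x.
  rewrite !exprMn exprVn -[k.+2]addn2 exprD invfM exprS; ring.
apply: within_eq => N.
have -> : \sum_(m < N) m.+1%:R * hole_moment p j m * z ^+ m
  = \sum_(m < N) \sum_(k < size q) q`_k * (r j ^+ 2)%:C ^+ k.+1 * (((c j)^*) ^+ (m - k) *+ 'C(m.+1, k.+1)) * z ^+ m.
  by apply: eq_bigr => m _; rewrite hole_momentE mulr_suml.
rewrite exchange_big /=; apply: eq_bigr => k _.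
(* The term m = 0 of the shifted series vanishes, as binom(0, k + 1) = 0, which aligns the
   indices. *)
rewrite big_ord_recl bin0n mulr0n add0r mulr_sumr; apply: eq_bigr => m _.
rewrite lift0 subSS; case: (leqP k m) => km; last by rewrite bin_small ?ltnS // !mulr0n !mulr0 mul0r.
have ez : z ^+ m = z ^+ (m - k) * z ^+ k by rewrite -exprD subnK.
by rewrite ez !mulrnAr mulrnAl /x exprMn; congr (_ *+ _); ring.
Qed.

(** Orthogonality makes the coefficients of [p] below degree n those of the series in
    [hole_moment_series]; the error is the part of that series from n on, where |w|^m <= h^m on the
    holes. *)
Lemma functional_equation (h : R) : 0 < h < 1 -> (forall j, cmod (c j) + r j <= h) ->
  exists2 K, 0 <= K & forall n p M, monic_orthogonal (cmcd c r) n p -> 0 <= M ->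
    (forall z, cmod z <= h -> cmod p.[z] <= M) ->
    forall z, cmod z <= 1 ->
      cmod (p.[z] - \sum_j pullback j (horner p) z - z ^+ n) <= K * M * (n.+1%:R * (h * cmod z) ^+ n).
Proof.
move=> /andP[h0 h1] hh; have [K K0 hK] := hole_moment_bound.
have g0 : 0 <= ((1 - h) ^+ 2)^-1 by rewrite invr_ge0 sqr_ge0.
exists (s%:R * (K * ((1 - h) ^+ 2)^-1)); first by rewrite !mulr_ge0.
move=> n p M hp M0 hM z z1.
have lim : within (fun N => z ^+ n + \sum_j \sum_(m < N) m.+1%:R * hole_moment p j m * z ^+ m)
    (z ^+ n + \sum_j pullback j (horner p) z) 0.
  by apply: withinD0; [exact: within_cst0|apply: within_sum0 => j; exact: hole_moment_series].
have -> : p.[z] - \sum_j pullback j (horner p) z - z ^+ n = p.[z] - (z ^+ n + \sum_j pullback j (horner p) z) by ring.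
apply: (within_dist lim (N1 := n)) => N nN.
have [pm ps _] := hp.
have -> : p.[z] = z ^+ n + \sum_j \sum_(m < n) m.+1%:R * hole_moment p j m * z ^+ m.
  rewrite horner_coef ps big_ord_recr /= addrC; congr (_ + _).
    by have := monicP pm; rewrite lead_coefE ps /= => ->; rewrite mul1r.
  rewrite exchange_big /=; apply: eq_bigr => m _.
  by rewrite (orthogonal_coef hp) // mulr_sumr mulr_suml.
rewrite -(subnKC nN) opprD addrACA subrr add0r -sumrB.
apply: le_trans (cmod_sum _ _ _) _.
have hz0 : 0 <= h * cmod z by rewrite mulr_ge0 ?cmod_ge0 // ltW.
apply: (@le_trans _ _ (\sum_(j < s) K * ((1 - h) ^+ 2)^-1 * M * (n.+1%:R * (h * cmod z) ^+ n))); last first.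
  by rewrite sumr_const card_ord -[_ *+ s]mulr_natl !mulrA.
apply: ler_sum => j _; rewrite big_split_ord /= opprD addrA subrr sub0r cmodN.
apply: le_trans (cmod_sum _ _ _) _.
apply: (@le_trans _ _ (\sum_(i < N - n) K * M * (n.+1%:R * (h * cmod z) ^+ n) * (i.+1%:R * h ^+ i))).
  (* Here n + i + 1 <= (n + 1) (i + 1) and |z|^i <= 1 split off a convergent sum over i. *)
  apply: ler_sum => i _; rewrite cmodM cmodX cmodM cmod_nat.
  have hb := hK p j (n + i)%N h M hh M0 hM.
  apply: (@le_trans _ _ ((n.+1%:R * i.+1%:R) * (K * M * h ^+ (n + i)) * cmod z ^+ n)).
    apply: ler_pM; rewrite ?mulr_ge0 ?exprn_ge0 ?cmod_ge0 //.
      apply: ler_pM; rewrite ?cmod_ge0 ?ler0n //.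
      by rewrite -natrM ler_nat mulnS -addSn leq_add2l leq_pmull.
    by rewrite exprD ler_piMr ?exprn_ge0 ?cmod_ge0 // exprn_ile1 ?cmod_ge0.
  by rewrite le_eqVlt; apply/orP; left; apply/eqP; rewrite exprD exprMn; ring.
rewrite -mulr_sumr.
have sb : \sum_(i < N - n) i.+1%:R * h ^+ i <= ((1 - h) ^+ 2)^-1.
  have h01 : 0 <= h < 1 by rewrite (ltW h0).
  apply: le_trans (negbin_bound 1 (N - n).+1 h01); rewrite big_ord_recl bin0n mulr0n add0r.
  by apply: ler_sum => i _; rewrite lift0 bin1 subSS subn0 mulr_natl.
apply: le_trans (_ : K * M * (n.+1%:R * (h * cmod z) ^+ n) * ((1 - h) ^+ 2)^-1 <= _).
  by rewrite ler_wpM2l // !mulr_ge0 // exprn_ge0.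
by rewrite le_eqVlt; apply/orP; left; apply/eqP; ring.
Qed.

(** * Iterating the functional equation *)

Hypothesis summable : Tcal_derivatives_summable a sigma.
Local Notation tau := (tau a sigma).
Local Notation dtau := (dtau c r a sigma).
Local Notation term := (term c r a sigma).
Implicit Type w : seq 'I_s.

Lemma dtau_summable_unit : exists2 S, 0 <= S & forall z, cmod z <= 1 ->
  forall ws : seq (seq 'I_s), uniq ws -> \sum_(w <- ws) cmod (dtau w z) <= S.
Proof.
have [S S0 hS] := dtau_summable0 cm un rho_gt0 summable.
have r1 : 0 < 1 - rho a by rewrite subr_gt0 (rho_lt1 un).
exists (S / (1 - rho a) ^+ 2); first by rewrite divr_ge0 // sqr_ge0.
move=> z z1 ws uws; apply: le_trans (_ : \sum_(w <- ws) cmod (dtau w 0) / (1 - rho a) ^+ 2 <= _).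
  apply: ler_sum => w _; apply: le_trans (dtau_distortion cm un rho_gt0 w (le1_in_domain un rho_gt0 z1)) _.
  have h : 1 - rho a <= 1 - rho a * cmod z by rewrite lerD2l lerN2 ler_piMr // ltW.
  rewrite ler_wpM2l ?cmod_ge0 // lef_pV2 ?posrE ?exprn_gt0 //; last exact: lt_le_trans r1 h.
  by rewrite lerXn2r ?nnegrE ?(ltW r1) // ltW // (lt_le_trans r1 h).
by rewrite -mulr_suml ler_wpM2r ?invr_ge0 ?sqr_ge0 ?hS.
Qed.

Lemma horner_bounded p : exists2 B, 0 <= B & forall z, cmod z <= 1 -> cmod p.[z] <= B.
Proof.
exists (\sum_(i < size p) cmod p`_i); first by apply: sumr_ge0 => i _; exact: cmod_ge0.
move=> z z1; rewrite horner_coef; apply: le_trans (cmod_sum _ _ _) _.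
apply: ler_sum => i _; rewrite cmodM cmodX ler_piMr ?cmod_ge0 //.
by rewrite exprn_ile1 ?cmod_ge0.
Qed.

Lemma tau_in_holes (h : R) w z : (forall j, cmod (c j) + r j <= h) -> h <= 1 -> cmod z <= h ->
  cmod (tau w z) <= h.
Proof.
case: w => [|j w] //= hh h1 zh.
have := tau_cons_in_disk cm un rho_gt0 j w (le_trans zh h1) => ht.
apply: le_trans (hh j); have := cmodD (tau (j :: w) z - c j) (c j); rewrite subrK => h2.
by apply: le_trans h2 _; rewrite addrC lerD2l.
Qed.

Lemma resolvent_within p z : cmod z <= 1 ->
  within (fun N => \sum_(w <- upto N) term (fun x => p.[x] - \sum_j pullback j (horner p) x) z w)
    p.[z] 0.
Proof.
have [S S0 hS] := dtau_summable_unit.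
have [B B0 hB] := horner_bounded p.
move=> z1 e e0.
have hb w : cmod p.[tau w z] <= B by apply: hB; exact: (tau_le1 cm un rho_gt0).
have [N0 hN] := level_term_small (hS z z1) hb e0.
exists N0 => N /hN; rewrite resolvent_sum add0r cmodB opprB addrC subrK //.
Qed.

(** With M the supremum of |p| on |z| <= h, iteration gives M <= S (h^n + K M (n + 1) h^(2n)). For
    large n the coefficient of M is at most 1/2, whence M <= 2 S. *)
Lemma orthogonal_uniformly_bounded (h : R) : 0 < h < 1 -> (forall j, cmod (c j) + r j <= h) ->
  exists2 B, 0 <= B & exists n0, forall n p, (n0 <= n)%N -> monic_orthogonal (cmcd c r) n p ->
    forall z, cmod z <= h -> cmod p.[z] <= B.
Proof.
move=> hb hh; have /andP[h0 h1] := hb.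
have [S S0 hS] := dtau_summable_unit.
have [K K0 hK] := functional_equation hb hh.
have [Q Q0 hQ] := quartic_expr_bounded (q := h) (andb_true_intro (conj (ltW h0) h1)).
exists (2 * S); first by rewrite mulr_ge0.
have h01 : 0 <= h < 1 by rewrite (ltW h0).
have D0 : 0 < 2 * (S * K * Q + 1) by rewrite mulr_gt0 // ltr_wpDl // !mulr_ge0.
have Di : 0 < (2 * (S * K * Q + 1))^-1 by rewrite invr_gt0.
(* One factor h^n is used up in (n + 1) h^n <= Q; the other is made at most 1 / (2 (S K Q + 1)). *)
have [n0 hn0] := expr_small h01 Di.
exists n0 => n p nn hp.
have [B B0 hB] := horner_bounded p.
pose E : set R := [set cmod p.[z] | z in [set z | cmod z <= h]].
have Esup : has_sup E.
  split; first by exists (cmod p.[0]); exists 0 => //; have := ltW h0; rewrite -[X in X <= h]cmod0.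
  by exists B => _ [z zh <-]; apply: hB; apply: le_trans zh (ltW h1).
pose M := sup E.
have hM z : cmod z <= h -> cmod p.[z] <= M.
  by move=> zh; apply: sup_upper_bound => //; exists z.
have M0 : 0 <= M by apply: le_trans (hM 0 _); rewrite ?cmod_ge0 // cmod0 ltW.
have step z : cmod z <= h -> cmod p.[z] <= S * (h ^+ n + K * M * (n.+1%:R * h ^+ n * h ^+ n)).
  move=> zh; have z1 : cmod z <= 1 by exact: le_trans zh (ltW h1).
  have b0 : 0 <= h ^+ n + K * M * (n.+1%:R * h ^+ n * h ^+ n).
    by rewrite addr_ge0 ?mulr_ge0 ?exprn_ge0 // ltW.
  have w1 : within (fun N => \sum_(w <- upto N) term (fun x => p.[x] - \sum_j pullback j (horner p) x) z w)
    0 (S * (h ^+ n + K * M * (n.+1%:R * h ^+ n * h ^+ n))).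
    apply: within_cst => N; rewrite subr0; apply: (sum_term_le (hS z z1)) => // w.
    have := tau_in_holes w hh (ltW h1) zh; set y := tau w z => yh.
    have y1 : cmod y <= 1 by exact: le_trans yh (ltW h1).
    have := hK n p M hp M0 hM y y1; set q := p.[y] - _ => hq.
    have -> : q = y ^+ n + (q - y ^+ n) by ring.
    apply: le_trans (cmodD _ _) _; apply: lerD.
      by rewrite cmodX lerXn2r ?nnegrE ?cmod_ge0 // ltW.
    apply: le_trans hq _; rewrite ler_wpM2l ?mulr_ge0 // -mulrA ler_wpM2l // exprMn.
    rewrite ler_wpM2l ?exprn_ge0 ?(ltW h0) // lerXn2r ?nnegrE ?cmod_ge0 //; exact: ltW.
  have := within_unique (resolvent_within p z1) w1.
  by rewrite subr0 add0r.
have hMM : M <= S * (h ^+ n + K * M * (n.+1%:R * h ^+ n * h ^+ n)).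
  by apply: ge_sup => //; [exact: (proj1 Esup)|move=> _ [z zh <-]; exact: step].
have hn := hn0 n nn.
have hQn : n.+1%:R * h ^+ n <= Q.
  apply: le_trans (hQ n); rewrite mulrC ler_wpM2l ?exprn_ge0 ?(ltW h0) //.
  have n1 : 1 <= n.+1%:R :> R by rewrite ler1n.
  by rewrite -[X in X <= _]expr1 ler_weXn2l.
have small : S * K * (n.+1%:R * h ^+ n) * h ^+ n <= 1 / 2.
  apply: le_trans (_ : (S * K * Q) * (2 * (S * K * Q + 1))^-1 <= _).
    apply: ler_pM => //; rewrite ?mulr_ge0 ?exprn_ge0 ?(ltW h0) //.
    by rewrite ler_wpM2l ?mulr_ge0.
  by rewrite ler_pdivrMr // mul1r mulrA mulVf // mul1r lerDl.
have hn1 : h ^+ n <= 1 by rewrite exprn_ile1 ?ltW.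
have : M <= S + M / 2.
  apply: le_trans hMM _; rewrite mulrDr; apply: lerD; first by rewrite ler_piMr.
  have -> : S * (K * M * (n.+1%:R * h ^+ n * h ^+ n)) = M * (S * K * (n.+1%:R * h ^+ n) * h ^+ n) by ring.
  by have := ler_wpM2l M0 small; rewrite mul1r.
move=> hMf z zh; apply: le_trans (hM z zh) _; lra.
Qed.

(* The error is [O(n (h rho)^n)] with [h < 1]. *)
Lemma orthogonal_within : exists2 K, 0 <= K & exists n0, forall n p, (n0 <= n)%N ->
  monic_orthogonal (cmcd c r) n.+1 p -> forall z, cmod z <= rho a ->
  within (fun N => \sum_(w <- upto N) term (fun x => x ^+ n.+1) z w) p.[z]
    (K * (rho a ^+ n.+1 / n.+1%:R ^+ 2)).
Proof.
have [S S0 hS] := dtau_summable_unit.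
have [h [h0 h1 hh]] := holes_bound; have hb : 0 < h < 1 by rewrite h0.
have h01 : 0 <= h < 1 by rewrite (ltW h0).
have [K K0 hK] := functional_equation hb hh.
have [M M0 [n0 hM]] := orthogonal_uniformly_bounded hb hh.
have [Q Q0 hQ] := quartic_expr_bounded h01.
exists (S * (K * M * Q)); first by rewrite !mulr_ge0.
have rl1 := rho_lt1 un.
exists n0 => n p nn hp z zr; have z1 : cmod z <= 1 by exact: le_trans zr (ltW rl1).
have n1 : 0 < n.+1%:R :> R by rewrite ltr0n.
rewrite -[X in within _ _ X]add0r; apply: within_trans (resolvent_within p z1).
apply: within_cst => N; rewrite subr0 -sumrB.
under eq_bigr => w _ do rewrite -termB.
pose B := K * M * Q * (rho a ^+ n.+1 / n.+1%:R ^+ 2).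
rewrite -[X in _ <= X]mulrA; apply: (sum_term_le (hS z z1) N (B := B)) => [w|]; last first.
  by rewrite !mulr_ge0 ?invr_ge0 ?exprn_ge0 // ltW.
have := tau_le_rho cm un rho_gt0 w zr; set y := tau w z => yr.
have y1 : cmod y <= 1 by exact: le_trans yr (ltW rl1).
rewrite cmodB; apply: le_trans (hK n.+1 p M hp M0 (hM _ _ (leqW nn) hp) y y1) _.
rewrite -[X in _ <= X]mulrA ler_wpM2l ?mulr_ge0 // exprMn mulrA.
apply: le_trans (_ : n.+2%:R * h ^+ n.+1 * rho a ^+ n.+1 <= _).
  by rewrite ler_wpM2l ?mulr_ge0 ?exprn_ge0 ?(ltW h0) // lerXn2r ?nnegrE ?cmod_ge0 // ltW.
rewrite mulrCA [X in _ <= X]mulrC ler_wpM2r ?exprn_ge0 ?(ltW rho_gt0) //.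
rewrite ler_pdivlMr ?exprn_gt0 //; apply: le_trans (hQ n.+1).
rewrite mulrAC mulrC ler_wpM2l ?exprn_ge0 ?(ltW h0) //.
have n12 : n.+1%:R <= n.+2%:R :> R by rewrite ler_nat.
have n21 : 1 <= n.+2%:R :> R by rewrite ler1n.
apply: le_trans (_ : n.+2%:R * n.+2%:R ^+ 2 <= _).
  by rewrite ler_wpM2l // lerXn2r ?nnegrE.
by rewrite -exprS ler_weXn2l.
Qed.

End Representation.

(** * Powers of one map in the coordinate Phi *)

Section Blocks.
Context {R : realType} {s : nat}.
Context (c : 'I_s -> R[i]) (r : 'I_s -> R) (a : 'I_s -> R[i]) (sigma : 'I_s -> R).
Hypothesis cm : is_cmcd c r.
Hypothesis un : forall j, is_uniformizer (c j) (r j) (a j) (sigma j).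
Hypothesis rho_gt0 : 0 < rho a.
Local Notation C := R[i].
Local Notation T := (Tmap a sigma).
Local Notation tau := (tau a sigma).
Local Notation dtau := (dtau c r a sigma).
Local Notation term := (term c r a sigma).
Local Notation pullback := (pullback c r a sigma).
Local Notation block := (block c r a sigma).
Implicit Types (z : C) (w : seq 'I_s).

Lemma tau_nseq v j z : tau (nseq v j) z = iter v (T j) z.
Proof. by elim: v => //= v IH; rewrite -IH. Qed.

Lemma sigma2_bounds_at j : 0 < sigma j ^+ 2 < 1.
Proof. exact: sigma2_bounds (un j). Qed.

Lemma Phi_den j z : cmod z < (rho a)^-1 -> 1 - (a j)^* * z != 0.
Proof. by move=> hz; apply: cmod_conjM_lt1; exact: modulus_mul_lt1. Qed.

Lemma Tmap_domain j z : cmod z < (rho a)^-1 -> cmod (T j z) < (rho a)^-1.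
Proof. by move=> hz; exact: (tau_domain cm un rho_gt0 [:: j]). Qed.

Lemma Phi_Tmap j z : cmod z < (rho a)^-1 ->
  Phi (a j) (T j z) = (sigma j ^+ 2)%:C * Phi (a j) z.
Proof.
move=> hz; rewrite (TmapE cm un rho_gt0) //.
exact: (Phi_reflection (radius_gt0 cm j) (center_radius_lt1 cm j) (un j) (modulus_mul_lt1 rho_gt0 j hz)).
Qed.

Lemma Phi_iter j v z : cmod z < (rho a)^-1 ->
  Phi (a j) (iter v (T j) z) = ((sigma j ^+ 2) ^+ v)%:C * Phi (a j) z.
Proof.
move=> hz; elim: v => [|v IH]; first by rewrite expr0 mul1r.
rewrite iterS Phi_Tmap ?IH; last by rewrite -tau_nseq; exact: (tau_domain cm un rho_gt0).
by rewrite mulrA -rmorphM -exprS.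
Qed.

(** The identity T_j' = sigma_j^2 Phi_j' / (Phi_j' o T_j): up to the constant, the derivative is a
    quotient of one function at two successive points, so products along iterates telescope in
    [iter_pullback]. *)
Lemma Tmap_derivative_ratio j z : cmod z < (rho a)^-1 ->
  (r j ^+ 2)%:C / (1 - (c j)^* * z) ^+ 2
   = (sigma j ^+ 2)%:C * ((1 - (a j)^* * T j z) / (1 - (a j)^* * z)) ^+ 2.
Proof.
move=> hz.
have := Phi_reflection_derivative (radius_gt0 cm j) (center_radius_lt1 cm j) (un j) (modulus_mul_lt1 rho_gt0 j hz).
rewrite -(TmapE cm un rho_gt0) //.
have d0 := Phi_den j hz; have d1 := Phi_den j (Tmap_domain j hz).
have p0 := phase_neq0 (a j).
have q0 : 1 - (a j)^* * a j != 0 by apply: disk_conj_neq0; case: (un j).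
move: d0 d1 p0 q0; set p := phase _; set q := 1 - _ * a j; set x := 1 - _ * z; set y := 1 - _ * T j z.
move: ((r j ^+ 2)%:C / _) ((sigma j ^+ 2)%:C) => u S d0 d1 p0 q0 e.
have -> : u = (p * q / y ^+ 2 * u) * y ^+ 2 / (p * q) by field; rewrite p0 q0.
by rewrite e; field; rewrite ?p0 ?q0 ?d0 ?d1.
Qed.

Lemma iter_pullback j h v z : cmod z < (rho a)^-1 ->
  iter v (pullback j) h z
   = ((sigma j ^+ 2) ^+ v)%:C * ((1 - (a j)^* * iter v (T j) z) / (1 - (a j)^* * z)) ^+ 2
       * h (iter v (T j) z).
Proof.
elim: v z => [|v IH] z hz; first by rewrite expr0 /= divff ?Phi_den // expr1n !mul1r.
rewrite iterS /pullback IH ?Tmap_domain // -iterSr Tmap_derivative_ratio //.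
have d0 := Phi_den j hz; have d1 := Phi_den j (Tmap_domain j hz).
move: d0 d1; set x := 1 - _ * z; set y := 1 - _ * T j z => d0 d1.
have -> : ((sigma j ^+ 2) ^+ v.+1)%:C = (sigma j ^+ 2)%:C * ((sigma j ^+ 2) ^+ v)%:C :> C.
  by rewrite exprS rmorphM.
move: (h _) (1 - _ * iter _ _ _) ((sigma j ^+ 2)%:C) (((sigma j ^+ 2) ^+ v)%:C) => H Y Q1 Q2.
by field; rewrite ?d0 ?d1.
Qed.

(** Expresses the denominators of the derivatives through [Phi], so that an iterate enters only by
    its grid point sigma_j^(2v) Phi. *)
Lemma one_plus_Phi j z : cmod z < (rho a)^-1 ->
  1 + (cmod (a j))%:C * Phi (a j) z = (1 - (a j)^* * a j) / (1 - (a j)^* * z).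
Proof.
move=> hz; have d0 := Phi_den j hz.
have e : (cmod (a j))%:C * phase (a j) = (a j)^*.
  rewrite /phase; case: eqVneq => [e0|n0].
    by rewrite e0 cmod0 (_ : (0 : R)%:C = 0 :> C) // mul0r rmorph0.
  by rewrite mulrC divfK // (fmorph_eq0 (real_complex R)) cmod_eq0.
have -> : 1 + (cmod (a j))%:C * Phi (a j) z
  = 1 + (cmod (a j))%:C * phase (a j) * ((z - a j) / (1 - (a j)^* * z)) by rewrite /Phi; ring.
by rewrite e; field.
Qed.

Lemma one_minus_modulus j : 1 - (a j)^* * a j = (1 - cmod (a j) ^+ 2)%:C :> C.
Proof. by rewrite mulrC mul_conj -(rmorph1 (real_complex R)) -rmorphB. Qed.

(* Equal to [a j * alpha j * Phi' z] when [a j != 0]. *)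
Definition weight j z : C := ((1 - (a j)^* * a j) / (1 - (a j)^* * z)) ^+ 2.

Section Extremal.
Context (j : 'I_s).
Hypothesis aj : cmod (a j) = rho a.
Local Notation A := (a j).
Local Notation b := (cmod (a j)).
Local Notation theta := (sigma j ^+ 2).

Let b0 : 0 < b. Proof. by rewrite aj. Qed.
Let b1 : b < 1. Proof. by rewrite aj (rho_lt1 un). Qed.
Let bC0 : b%:C != 0 :> C. Proof. by rewrite (fmorph_eq0 (real_complex R)) gt_eqF. Qed.
Let A0 : A != 0. Proof. by rewrite -cmod_eq0 gt_eqF. Qed.
Let q0 : 1 - A^* * A != 0. Proof. by apply: disk_conj_neq0; case: (un j). Qed.

Lemma ratio_Phi z : cmod z < (rho a)^-1 -> A * PhiV_ratio A (Phi A z) = z.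
Proof.
move=> hz; have d0 := Phi_den j hz; rewrite /PhiV_ratio one_plus_Phi //.
have e : A * (1 + b^-1%:C * Phi A z) = z * (1 - A^* * A) / (1 - A^* * z).
  have -> : A * (1 + b^-1%:C * Phi A z) = A + b^-1%:C * (phase A * A) * ((z - A) / (1 - A^* * z)).
    by rewrite /Phi; ring.
  have -> : b^-1%:C * (phase A * A) = 1 by rewrite phase_conj_mul fmorphV mulVf.
  by field.
by rewrite mulrA e; field; rewrite d0 q0.
Qed.

Lemma weight_alpha z : cmod z < (rho a)^-1 ->
  A * (alpha a j)%:C * (phase A * (1 - A^* * A) / (1 - A^* * z) ^+ 2) = weight j z.
Proof.
move=> hz; have d0 := Phi_den j hz.
have -> : A * (alpha a j)%:C * (phase A * (1 - A^* * A) / (1 - A^* * z) ^+ 2)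
  = (phase A * A) * (alpha a j)%:C * ((1 - A^* * A) / (1 - A^* * z) ^+ 2) by ring.
have -> : phase A * A * (alpha a j)%:C = 1 - A^* * A.
  rewrite phase_conj_mul one_minus_modulus; have <- : b * alpha a j = 1 - b ^+ 2.
    by rewrite /alpha; field; rewrite gt_eqF.
  by rewrite rmorphM.
by rewrite /weight expr_div_n; field.
Qed.

Local Notation grid_term n w v :=
  (PhiV_ratio A ((theta ^+ v)%:C * w) ^+ n * (1 + b%:C * ((theta ^+ v)%:C * w)) ^- 2).

Lemma iter_pullback_expr n v z : cmod z < (rho a)^-1 ->
  iter v (pullback j) (fun x => x ^+ n) z
   = A ^+ n * weight j z * ((theta ^+ v)%:C * grid_term n (Phi A z) v).
Proof.
move=> hz; rewrite iter_pullback //; set y := iter v (T j) z.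
have hy : cmod y < (rho a)^-1 by rewrite /y -tau_nseq; exact: (tau_domain cm un rho_gt0).
rewrite -Phi_iter // -/y one_plus_Phi // /weight.
have -> : y ^+ n = A ^+ n * PhiV_ratio A (Phi A y) ^+ n by rewrite -exprMn ratio_Phi.
have d0 := Phi_den j hz; have d1 := Phi_den j hy.
move: (PhiV_ratio _ _ ^+ n) (A ^+ n) ((_)%:C) d0 d1 q0 => P X Th.
set x := 1 - _ * z; set u := 1 - _ * y; set q := 1 - _ * A => d0 d1 q0'.
by field; rewrite d0 d1 q0'.
Qed.

Lemma weight_le1 z : cmod z <= rho a -> cmod (weight j z) <= 1.
Proof.
move=> hz; rewrite /weight cmodX exprn_ile1 ?cmod_ge0 // cmodM cmodV.
have d : 1 - b ^+ 2 <= cmod (1 - A^* * z).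
  apply: le_trans (cmodBr _ _); rewrite cmod1 cmodM cmod_conj lerD2l lerN2 expr2.
  by rewrite ler_wpM2l ?cmod_ge0 // aj.
have p : 0 < 1 - b ^+ 2 by rewrite subr_gt0 exprn_ilt1 ?ltW.
rewrite ler_pdivrMr ?(lt_le_trans p) // mul1r; apply: le_trans d.
by rewrite one_minus_modulus cmod_real gtr0_norm.
Qed.

Definition away (e : R) z := cmod z <= rho a /\ e <= cmod (z - A).

(** For w = Phi z the bound |z| <= |a_j| says |1 + w / b| <= |1 + b w|, which expands to the first
    inequality of [far_left]. Moreover |w| >= e / 2, as |1 - conj(a_j) z| <= 2, and that inequality
    then gives 2 Re w <= -|w|^2 <= -e^2 / 4. *)
Lemma away_far_left e z : 0 < e -> away e z -> far_left A (e ^+ 2 / 8) (Phi A z).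
Proof.
move=> e0 [zr ez]; have hz := le_rho_in_domain un rho_gt0 zr.
set w := Phi A z.
have d0 := Phi_den j hz.
have n0 : 1 + b%:C * w != 0 by rewrite one_plus_Phi // mulf_neq0 // invr_eq0.
have sq (x : R) : cmod (1 + x%:C * w) ^+ 2 = 1 + 2 * x * Re w + x ^+ 2 * cmod w ^+ 2.
  rewrite !cmod_sqr ReD ImD Re_rM Im_rM /=; ring.
have h1 : cmod (1 + b^-1%:C * w) ^+ 2 <= cmod (1 + b%:C * w) ^+ 2.
  rewrite lerXn2r ?nnegrE ?cmod_ge0 //.
  have := zr; rewrite -[in X in X -> _](ratio_Phi hz) -/w /PhiV_ratio cmodM cmodM cmodV -aj.
  by rewrite -[X in _ <= X]mulr1 ler_pM2l // ler_pdivrMr ?mul1r // cmod_gt0.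
have k0 : 0 < b^-1 - b by rewrite subr_gt0 (lt_trans b1) // invf_gt1.
have h2 : 2 * Re w + cmod w ^+ 2 * (b^-1 + b) <= 0.
  have := h1; rewrite !sq -subr_ge0 => h3; rewrite -(pmulr_lle0 _ k0); nra.
split=> //.
have hw : e / 2 <= cmod w.
  rewrite /w cmod_PhiE ler_pdivlMr ?cmod_gt0 //; apply: le_trans ez.
  have : cmod (1 - A^* * z) <= 2.
    apply: le_trans (cmodB_le _ _) _; rewrite cmod1 cmodM cmod_conj.
    have : b * cmod z <= 1 by rewrite ltW // (modulus_mul_lt1 rho_gt0).
    by lra.
  have e2 : 0 <= e / 2 by rewrite divr_ge0 // ltW.
  by move=> h; apply: le_trans (ler_wpM2l e2 h) _; rewrite divfK.
have e2 : 0 <= e / 2 by rewrite divr_ge0 // ltW.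
have hw2 : (e / 2) ^+ 2 <= cmod w ^+ 2 by rewrite lerXn2r ?nnegrE ?cmod_ge0.
have bi : 1 <= b^-1 by rewrite ltW // invf_gt1.
have bib : 1 <= b^-1 + b by rewrite (le_trans bi) // lerDl ltW.
have : cmod w ^+ 2 * 1 <= cmod w ^+ 2 * (b^-1 + b) by rewrite ler_wpM2l ?sqr_ge0.
move: h2 hw2; rewrite expr_div_n; lra.
Qed.

Definition theta_sum n z : C :=
  sum (fun v : int => (theta ^ v)%:C * cexp ((theta ^ v)%:C * (n%:R * (alpha a j)%:C * Phi A z)) : C).

Lemma blockE n V z : cmod z <= rho a ->
  block j (fun x => x ^+ n) V z
   = A ^+ n * weight j z * \sum_(v < V) (theta ^+ v.+1)%:C * grid_term n (Phi A z) v.+1.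
Proof.
move=> zr; rewrite /block mulr_sumr; apply: eq_bigr => v _.
by rewrite iter_pullback_expr // (le_rho_in_domain un rho_gt0 zr).
Qed.

Let bb : 0 < b < 1. Proof. by rewrite b0. Qed.

Lemma cmod_weighted n z x : cmod z <= rho a ->
  cmod (A ^+ n * weight j z * x) <= rho a ^+ n * cmod x.
Proof.
move=> zr; rewrite cmodM [cmod (_ * weight _ _)]cmodM cmodX aj ler_wpM2r ?cmod_ge0 // ler_piMr ?weight_le1 //.
by rewrite exprn_ge0 // ltW.
Qed.

Lemma block_small e : 0 < e -> exists2 K, 0 <= K & forall n V z, away e z ->
  cmod (block j (fun x => x ^+ n.+1) V z) <= rho a ^+ n.+1 * (K / n.+1%:R).
Proof.
move=> e0; have d0 : 0 < e ^+ 2 / 8 by rewrite divr_gt0 ?exprn_gt0.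
have [K K0 hK] := inner_sum_small bb (sigma2_bounds_at j) d0.
exists K => // n V z hz; rewrite blockE ?(proj1 hz) //.
apply: le_trans (cmod_weighted _ _ (proj1 hz)) _.
rewrite ler_wpM2l ?exprn_ge0 ?(ltW rho_gt0) //; apply: le_trans (hK n V _ (away_far_left e0 hz)).
apply: le_trans (cmod_sum _ _ _) _; apply: ler_sum => v _; rewrite cmodM cmod_real ger0_norm //.
by rewrite exprn_ge0 // sqr_ge0.
Qed.

Lemma block_close e : 0 < e -> exists2 K, 0 <= K & forall n V z, away e z ->
  cmod (block j (fun x => x ^+ n.+1) V z - A ^+ n.+1 * weight j z * theta_sum n.+1 z)
    <= rho a ^+ n.+1 * (K / n.+1%:R ^+ 2 + theta ^+ V * K).
Proof.
move=> e0; have d0 : 0 < e ^+ 2 / 8 by rewrite divr_gt0 ?exprn_gt0.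
have [K K0 hK] := inner_sum_approx bb (sigma2_bounds_at j) d0.
exists K => // n V z hz; rewrite blockE ?(proj1 hz) // -mulrBr.
apply: le_trans (cmod_weighted _ _ (proj1 hz)) _.
by rewrite ler_wpM2l ?exprn_ge0 ?(ltW rho_gt0) // hK //; exact: away_far_left.
Qed.

End Extremal.
End Blocks.

(** * Words with a given outermost letter *)

Section FirstLetter.
Context {R : realType} {s : nat}.
Context (c : 'I_s -> R[i]) (r : 'I_s -> R) (a : 'I_s -> R[i]) (sigma : 'I_s -> R).
Hypothesis cm : is_cmcd c r.
Hypothesis un : forall j, is_uniformizer (c j) (r j) (a j) (sigma j).
Hypothesis rho_gt0 : 0 < rho a.
Local Notation C := R[i].
Context (S : R).
Hypothesis S0 : 0 <= S.
Local Notation T := (Tmap a sigma).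
Local Notation tau := (tau a sigma).
Local Notation dtau := (dtau c r a sigma).
Local Notation term := (term c r a sigma).
Local Notation pullback := (pullback c r a sigma).
Local Notation block := (block c r a sigma).
Local Notation weight := (weight a).
Local Notation theta_sum := (theta_sum a sigma).
Local Notation away := (away a).
Hypothesis hS : forall z, cmod z <= 1 ->
  forall ws : seq (seq 'I_s), uniq ws -> \sum_(w <- ws) cmod (dtau w z) <= S.
Implicit Types (z : C) (w : seq 'I_s) (j k : 'I_s).

Local Notation letter_sum j n z := (fun N => \sum_(w <- upto N) term (pullback j (fun x : C => x ^+ n)) z w).

Let rho1 : rho a < 1. Proof. exact: rho_lt1 un. Qed.
Let rho0 : 0 <= rho a. Proof. exact: ltW. Qed.
Let rho_n n : 0 <= rho a ^+ n. Proof. exact: exprn_ge0. Qed.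
Let le1 z : cmod z <= rho a -> cmod z <= 1.
Proof. by move=> h; apply: le_trans h (ltW rho1). Qed.
Let theta0 j : 0 <= sigma j ^+ 2. Proof. exact: sqr_ge0. Qed.
Let thetaX j v : 0 <= (sigma j ^+ 2) ^+ v. Proof. by apply: exprn_ge0; exact: theta0. Qed.
Let theta1 j : sigma j ^+ 2 < 1. Proof. by case/andP: (sigma2_bounds_at un j). Qed.

(** A crude bound on the whole closed disk, a_j included; its factor sigma_j^(2v) lets long runs of
    the letter j be discarded. *)
Lemma iter_pullback_le : exists2 W, 0 <= W & forall j v n z, cmod z <= rho a ->
  cmod (iter v (pullback j) (fun x => x ^+ n) z) <= W * (rho a ^+ n * (sigma j ^+ 2) ^+ v).
Proof.
have d : 0 < 1 - rho a by rewrite subr_gt0.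
exists ((2 / (1 - rho a)) ^+ 2); first exact: sqr_ge0.
move=> j v n z zr; rewrite (iter_pullback cm un rho_gt0) ?(le_rho_in_domain un rho_gt0) //.
have yr : cmod (iter v (T j) z) <= rho a.
  by rewrite -tau_nseq; exact: (tau_le_rho cm un rho_gt0).
set y := iter v _ z in yr *.
have nv : cmod (((sigma j ^+ 2) ^+ v)%:C : C) = (sigma j ^+ 2) ^+ v.
  by rewrite cmod_real ger0_norm //; apply: exprn_ge0; exact: theta0.
rewrite cmodM (cmodM (_)%:C) nv (cmodX (_ / _)) (cmodX y).
have az x : cmod x <= rho a -> cmod ((a j)^* * x) <= rho a.
  move=> xr; rewrite cmodM cmod_conj; apply: le_trans (_ : rho a * 1 <= _); last by rewrite mulr1.
  by apply: ler_pM; rewrite ?cmod_ge0 ?le_rho ?le1.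
have q : cmod ((1 - (a j)^* * y) / (1 - (a j)^* * z)) <= 2 / (1 - rho a).
  rewrite cmodM cmodV; apply: ler_pM; rewrite ?cmod_ge0 ?invr_ge0 ?cmod_ge0 //.
    by apply: le_trans (cmodB_le _ _) _; rewrite cmod1; have := az y yr; have := rho1; lra.
  have h : 1 - rho a <= cmod (1 - (a j)^* * z).
    by apply: le_trans (cmodBr _ _); rewrite cmod1 lerD2l lerN2 az.
  by rewrite lef_pV2 ?posrE // (lt_le_trans d h).
have X2 : cmod ((1 - (a j)^* * y) / (1 - (a j)^* * z)) ^+ 2 <= (2 / (1 - rho a)) ^+ 2.
  by rewrite lerXn2r ?nnegrE ?cmod_ge0 // divr_ge0 // ltW.
have Yn : cmod y ^+ n <= rho a ^+ n by rewrite lerXn2r ?nnegrE ?cmod_ge0.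
move: X2 Yn (exprn_ge0 v (theta0 j)).
have -> : (2 / (1 - rho a)) ^+ 2 * (rho a ^+ n * (sigma j ^+ 2) ^+ v)
  = (sigma j ^+ 2) ^+ v * (2 / (1 - rho a)) ^+ 2 * rho a ^+ n by ring.
move=> X2 Yn tv; apply: ler_pM => //; last exact: ler_wpM2l.
- by apply: mulr_ge0 => //; exact: sqr_ge0.
- by rewrite exprn_ge0 ?cmod_ge0.
Qed.

(** The two remainders of [sum_not_starting_block]: the boundary level tends to 0, and runs of more
    than V letters j cost sigma_j^(2V). *)
Lemma first_letter_block : exists2 W, 0 <= W & forall j n V z, cmod z <= rho a ->
  within (fun N => letter_sum j n z N
            - \sum_(w <- upto N.+1 | not_starting j w) term (block j (fun x => x ^+ n) V) z w)
    0 (W * (rho a ^+ n * (sigma j ^+ 2) ^+ V)).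
Proof.
have [W W0 hW] := iter_pullback_le; exists (S * W); first exact: mulr_ge0.
move=> j n V z zr e e0; have z1 := le1 zr.
have hb w : cmod (block j (fun x => x ^+ n) V (tau w z)) <= \sum_(v < V) W * (rho a ^+ n * (sigma j ^+ 2) ^+ v.+1).
  apply: le_trans (cmod_sum _ _ _) _; apply: ler_sum => v _; apply: hW.
  exact: (tau_le_rho cm un rho_gt0).
have [N0 hN] := level_term_small (hS z1) hb e0.
exists N0 => N /hN {}hN; rewrite sum_not_starting_block subr0 opprD opprB.
rewrite addrA addrCA subrr addr0; apply: le_trans (cmodB_le _ _) _; apply: lerD => //.
rewrite -mulrA; apply: (sum_term_le (hS z1) N (B := W * (rho a ^+ n * (sigma j ^+ 2) ^+ V))) => [w|].
  apply: le_trans (hW _ _ _ _ (tau_le_rho cm un rho_gt0 w zr)) _.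
  do 2 (apply: ler_wpM2l => //).
  by rewrite (exprS (sigma j ^+ 2)); apply: ler_piMl; [exact: thetaX|apply: ltW; exact: theta1].
by do 2 (apply: mulr_ge0 => //).
Qed.

(** T_j maps |z| <= rho into |z| <= g with g < rho, and powers of g / rho beat n^-2. *)
Lemma first_letter_contract j : cmod (a j) < rho a -> exists2 K, 0 <= K & forall n z,
  cmod z <= rho a -> within (letter_sum j n.+1 z) 0 (K * (rho a ^+ n.+1 / n.+1%:R ^+ 2)).
Proof.
move=> aj; have [g /andP[g0 g1] hg] := Tmap_contracts cm un rho_gt0 aj.
have gr : 0 <= g / rho a < 1 by rewrite divr_ge0 //= ltr_pdivrMr // mul1r.
have [Q Q0 hQ] := quartic_expr_bounded gr.
have cd : cmod (c j) < 1 by have := center_radius_lt1 cm j; have := radius_gt0 cm j; lra.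
have d : 0 < 1 - cmod (c j) by rewrite subr_gt0.
pose D := r j ^+ 2 / (1 - cmod (c j)) ^+ 2.
have D0 : 0 <= D by rewrite divr_ge0 ?sqr_ge0.
exists (S * (D * Q)); first by do 2 apply: mulr_ge0 => //.
move=> n z zr; have z1 := le1 zr; apply: within_cst => N; rewrite subr0.
have n0 : 0 < n.+1%:R :> R by rewrite ltr0n.
rewrite -[X in _ <= X]mulrA.
apply: (sum_term_le (hS z1) N (B := D * Q * (rho a ^+ n.+1 / n.+1%:R ^+ 2))) => [w|]; last first.
  apply: mulr_ge0; first exact: mulr_ge0.
  by apply: divr_ge0 => //; exact: exprn_ge0.
have := tau_le_rho cm un rho_gt0 w zr; set y := tau w z => yr.
rewrite /pullback cmodM -mulrA; apply: ler_pM; rewrite ?cmod_ge0 //.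
  rewrite cmodM cmodV cmodX cmod_real ger0_norm ?sqr_ge0 // ler_wpM2l ?sqr_ge0 //.
  have h : 1 - cmod (c j) <= cmod (1 - (c j)^* * y).
    apply: le_trans (cmodBr _ _); rewrite cmod1 cmodM cmod_conj lerD2l lerN2.
    by rewrite ler_piMr ?cmod_ge0 // le1.
  by rewrite lef_pV2 ?posrE ?exprn_gt0 ?(lt_le_trans d h) // lerXn2r ?nnegrE ?cmod_ge0 // ltW.
rewrite cmodX; apply: le_trans (_ : g ^+ n.+1 <= _).
  by rewrite lerXn2r ?nnegrE ?cmod_ge0 // hg.
have -> : g ^+ n.+1 = (g / rho a) ^+ n.+1 * rho a ^+ n.+1 by rewrite -exprMn divfK // gt_eqF.
rewrite [X in _ <= X]mulrA [X in _ <= X]mulrAC; apply: ler_wpM2r => //; rewrite ler_pdivlMr ?exprn_gt0 //.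
apply: le_trans (hQ n.+1); rewrite ler_wpM2l ?exprn_ge0 ?(proj1 (andP gr)) //.
have n12 : n.+1%:R <= n.+2%:R :> R by rewrite ler_nat.
have n21 : 1 <= n.+2%:R :> R by rewrite ler1n.
by apply: le_trans (_ : n.+2%:R ^+ 2 <= _); [rewrite lerXn2r ?nnegrE|rewrite ler_weXn2l].
Qed.

(** The gap is the distance from a_j to the circle of its own hole; the other holes lie outside that
    circle. *)
Lemma other_disk_gap j : exists2 e : R, 0 < e & forall k y, k != j ->
  cmod (y - c k) <= r k -> e <= cmod (y - a j).
Proof.
have h := center_dist_fixpoint (radius_gt0 cm j) (center_radius_lt1 cm j) (un j).
exists (r j - cmod (a j - c j)); first by rewrite subr_gt0.
move=> k y kj yk; have [yj|yj] := leP (cmod (y - c j)) (r j).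
  by move: kj; rewrite (disk_disjoint cm yj yk) eqxx.
have := cmodD (y - a j) (a j - c j); rewrite addrA subrK; move: yj; lra.
Qed.

(** A nonempty word with outermost letter k != j ends in the hole k wherever [z] is, even at z =
    a_j. *)
Lemma cons_away j : exists2 e : R, 0 < e & forall w z, cmod z <= rho a ->
  not_starting j w -> w != [::] -> away j e (tau w z).
Proof.
have [e e0 he] := other_disk_gap j; exists e => // -[|k w] //= z zr kj _; split.
  exact: (tau_le_rho cm un rho_gt0 (k :: w)).
by apply: he kj _; exact: (tau_cons_in_disk cm un rho_gt0 k w (le1 zr)).
Qed.

Section Extremal.
Context (j : 'I_s).
Hypothesis aj : cmod (a j) = rho a.
Local Notation A := (a j).
Local Notation theta := (sigma j ^+ 2).

(** With N = n + 1, the prefactor N alpha_j Phi_j of [Theta] cancels 1 / N and 1 / Phi_j, and one of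
    the N + 1 factors a_j joins alpha_j Phi_j' to form [weight]. *)
Lemma F_summand_eq e n w z : 0 < e -> cmod z <= rho a -> away j e (tau w z) ->
  n.+1%:R^-1 * A ^+ n.+2 *
    (derive1 (Phi A) (tau w z) / Phi A (tau w z)
      * Theta theta (n.+1%:R * (alpha a j)%:C * Phi A (tau w z)) * derive1 (tau w) z)
  = term (fun y => A ^+ n.+1 * weight j y * theta_sum j n.+1 y) z w.
Proof.
move=> e0 zr hw; have zd := le_rho_in_domain un rho_gt0 zr.
have yd := le_rho_in_domain un rho_gt0 (proj1 hw).
have [_ fl] := away_far_left un rho_gt0 aj e0 hw.
rewrite /term (derive1_tau cm un rho_gt0) //; set y := tau w z in hw yd fl *.
have P0 : Phi A y != 0.
  apply: contraTneq (divr_gt0 (exprn_gt0 2 e0) (ltr0n R 8 : 0 < 8)) => P0.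
  by move: fl; rewrite P0 oppr_ge0 -leNgt.
have ai : cmod A * (rho a)^-1 <= 1 by rewrite aj divff // gt_eqF.
rewrite (derive1_Phi ai yd) -(weight_alpha rho_gt0 aj yd) /Theta -/(theta_sum j n.+1 y).
have n0 : n.+1%:R != 0 :> C by rewrite pnatr_eq0.
rewrite [A ^+ n.+2]exprS; move: (theta_sum _ _ _) (dtau w z) (phase A * _ / _) n0 P0 => t d q.
by move: (n.+1%:R) (Phi A y) => N P n0 P0; field; rewrite n0 P0.
Qed.

(** [block_close] is summed against |dtau| over the words not starting with j. Its constant is free
    of V, so V is chosen last, depending on n and [eps], to bring all terms with sigma_j^(2V) below
    [eps]. *)
Lemma first_letter_away e : 0 < e -> exists2 K, 0 <= K & forall n z,
  cmod z <= rho a -> (forall w, not_starting j w -> away j e (tau w z)) ->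
  within (letter_sum j n.+1 z) (n.+1%:R^-1 * A ^+ n.+2 * F a sigma j n.+1 z)
    (K * (rho a ^+ n.+1 / n.+1%:R ^+ 2)).
Proof.
move=> e0; have [W W0 hW] := first_letter_block.
have [K K0 hK] := block_close cm un rho_gt0 aj e0.
exists (S * K); first exact: mulr_ge0.
move=> n z zr hw; have z1 := le1 zr; apply: within_limit => eps eps0.
pose H y := A ^+ n.+1 * weight j y * theta_sum j n.+1 y.
pose k : C := n.+1%:R^-1 * A ^+ n.+2.
have k0 : k != 0.
  rewrite mulf_neq0 ?invr_eq0 ?pnatr_eq0 // expf_neq0 //.
  by rewrite -cmod_eq0 aj gt_eqF.
pose G (f : C -> C) := derive1 (Phi A) (f z) / Phi A (f z)
      * Theta theta (n.+1%:R * (alpha a j)%:C * Phi A (f z)) * derive1 f z.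
have GE w : not_starting j w -> k * G (tau w) = term H z w.
  by move=> /hw; exact: F_summand_eq.
have HB w : not_starting j w -> cmod (H (tau w z)) <= rho a ^+ n.+1 * (K / n.+1%:R ^+ 2 + K).
  (* At V = 0 the block is empty, so [block_close] bounds [H] itself. *)
  move=> /hw hy; have := hK n 0 _ hy.
  by rewrite /block big_ord0 sub0r cmodN expr0 mul1r.
have HB0 : 0 <= rho a ^+ n.+1 * (K / n.+1%:R ^+ 2 + K).
  by rewrite mulr_ge0 // addr_ge0 // divr_ge0 // exprn_ge0.
have limH : within (fun N => \sum_(w <- upto N | not_starting j w) term H z w)
    (k * F a sigma j n.+1 z) 0.
  have h0 : within (fun N => \sum_(w <- upto N | not_starting j w) G (tau w)) (F a sigma j n.+1 z) 0.
    move=> d d0; have hG w : not_starting j w ->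
      cmod (G (tau w)) <= cmod (dtau w z) * ((cmod k)^-1 * (rho a ^+ n.+1 * (K / n.+1%:R ^+ 2 + K))).
      move=> nw; have := GE w nw; rewrite /term => Gw.
      have -> : G (tau w) = k^-1 * (dtau w z * H (tau w z)) by rewrite -Gw mulKf.
      by rewrite cmodM cmodV [cmod (dtau w z * _)]cmodM mulrCA ler_wpM2l ?cmod_ge0 // ler_wpM2l ?invr_ge0 ?cmod_ge0 // HB.
    have hk : 0 <= (cmod k)^-1 * (rho a ^+ n.+1 * (K / n.+1%:R ^+ 2 + K)).
      by apply: mulr_ge0 => //; rewrite invr_ge0 cmod_ge0.
    have [N0 hN] := sum_over_words_approx cm un rho_gt0 (hS z1) hG hk d0.
    by exists N0 => N /hN; rewrite add0r cmodB.
  have := withinM k h0; rewrite mulr0; apply: within_eq => N.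
  by rewrite mulr_sumr; apply: eq_bigr => w; exact: GE.
have th : 0 <= theta < 1 by rewrite theta0 theta1.
have X0 : 0 <= W * rho a ^+ n.+1 + S * rho a ^+ n.+1 * K.
  by apply: addr_ge0; do ?apply: mulr_ge0.
have [V hV] := scaled_expr_small th X0 eps0.
have limB : within (fun N => \sum_(w <- upto N.+1 | not_starting j w) term (block j (fun x => x ^+ n.+1) V) z w)
    (k * F a sigma j n.+1 z) (0 + S * (rho a ^+ n.+1 * (K / n.+1%:R ^+ 2 + theta ^+ V * K))).
  apply: within_trans (within_shift limH); apply: within_cst => N; rewrite subr0 -sumrB.
  under eq_bigr => w _ do rewrite -termB.
  apply: (sum_term_not_starting_le (hS z1)) => [w /hw hy|]; first exact: hK.
  apply: mulr_ge0 => //; apply: addr_ge0; last exact: mulr_ge0.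
  by apply: divr_ge0 => //; exact: exprn_ge0.
apply: within_le (within_trans (hW j n.+1 V z zr) limB).
have -> : 0 + S * (rho a ^+ n.+1 * (K / n.+1%:R ^+ 2 + theta ^+ V * K)) + W * (rho a ^+ n.+1 * theta ^+ V)
  = S * K * (rho a ^+ n.+1 / n.+1%:R ^+ 2) + (W * rho a ^+ n.+1 + S * rho a ^+ n.+1 * K) * theta ^+ V by ring.
by rewrite lerD2l.
Qed.

Lemma first_letter_small e : 0 < e -> exists2 K, 0 <= K & forall n z,
  cmod z <= rho a -> (forall w, not_starting j w -> away j e (tau w z)) ->
  within (letter_sum j n.+1 z) 0 (K * (rho a ^+ n.+1 / n.+1%:R)).
Proof.
move=> e0; have [W W0 hW] := first_letter_block.
have [K K0 hK] := block_small cm un rho_gt0 aj e0.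
exists (S * K); first exact: mulr_ge0.
move=> n z zr hw; have z1 := le1 zr; apply: within_limit => eps eps0.
have th : 0 <= theta < 1 by rewrite theta0 theta1.
have [V hV] := scaled_expr_small th (mulr_ge0 W0 (rho_n n.+1)) eps0.
have limB : within (fun N => \sum_(w <- upto N.+1 | not_starting j w) term (block j (fun x => x ^+ n.+1) V) z w)
    0 (S * (rho a ^+ n.+1 * (K / n.+1%:R))).
  apply: within_cst => N; rewrite subr0.
  apply: (sum_term_not_starting_le (hS z1)) => [w /hw hy|]; first exact: hK.
  by rewrite mulr_ge0 ?divr_ge0.
apply: within_le (within_trans (hW j n.+1 V z zr) limB).
apply: lerD; last by rewrite mulrA.
by rewrite le_eqVlt; apply/orP; left; apply/eqP; ring.
Qed.

Lemma Tmap_fixpoint : T j A = A.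
Proof.
have P0 : Phi A A = 0 by rewrite /Phi subrr mul0r mulr0.
by rewrite /Tmap P0 mulr0 /PhiV add0r mulr0 addr0 mulrAC divff ?mul1r // phase_neq0.
Qed.

Lemma block_fixpoint n V :
  block j (fun x => x ^+ n) V A = (\sum_(v < V) theta ^+ v.+1)%:C * A ^+ n.
Proof.
rewrite /block rmorph_sum mulr_suml; apply: eq_bigr => v _.
have ar : cmod A <= rho a by rewrite aj.
have ad := le_rho_in_domain un rho_gt0 ar.
have fx m : iter m (T j) A = A by elim: m => //= m ->; exact: Tmap_fixpoint.
by rewrite (iter_pullback cm un rho_gt0) // fx divff ?expr1n ?mulr1 // Phi_den.
Qed.

(** Among the words not starting with j only the empty one fixes a_j, and its block is a geometric
    sum; every other one ends in another hole, where [block_small] applies. *)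
Lemma first_letter_fixpoint : exists2 K, 0 <= K & forall n,
  within (letter_sum j n.+1 A) ((theta / (1 - theta))%:C * A ^+ n.+1)
    (K * (rho a ^+ n.+1 / n.+1%:R)).
Proof.
have [e e0 he] := cons_away j; have [W W0 hW] := first_letter_block.
have [K K0 hK] := block_small cm un rho_gt0 aj e0.
have ar : cmod A <= rho a by rewrite aj.
exists (S * K); first exact: mulr_ge0.
move=> n; have A1 := le1 ar; apply: within_limit => eps eps0.
have t1 : 0 < 1 - theta by rewrite subr_gt0.
have q0 : 0 <= theta / (1 - theta) by apply: divr_ge0 => //; exact: ltW.
have th : 0 <= theta < 1 by rewrite theta0 theta1.
have X0 : 0 <= W * rho a ^+ n.+1 + rho a ^+ n.+1 * (theta / (1 - theta)).
  by apply: addr_ge0; apply: mulr_ge0.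
have [V hV] := scaled_expr_small th X0 eps0.
pose g := block j (fun x => x ^+ n.+1) V.
(* The block is set to 0 at a_j so that one bound holds at all image points; its value at a_j, met
   by the empty word only, is split off. *)
pose g' y := if y == A then 0 else g y.
have gsum : (\sum_(v < V) theta ^+ v.+1) = theta / (1 - theta) * (1 - theta ^+ V).
  have t0 : 1 - theta != 0 by rewrite gt_eqF.
  have -> : 1 - theta ^+ V = (1 - theta) * \sum_(v < V) theta ^+ v.
    by rewrite -opprB subrX1 -mulNr opprB.
  by rewrite mulrA divfK // mulr_sumr; apply: eq_bigr => v _; rewrite exprS.
have limB : within (fun N => \sum_(w <- upto N.+1 | not_starting j w) term g A w)
    ((theta / (1 - theta))%:C * A ^+ n.+1)
    (S * (rho a ^+ n.+1 * (K / n.+1%:R)) + rho a ^+ n.+1 * (theta / (1 - theta)) * theta ^+ V).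
  apply: within_cst => N.
  have -> : \sum_(w <- upto N.+1 | not_starting j w) term g A w
     = g A + \sum_(w <- upto N.+1 | not_starting j w) term g' A w.
    rewrite big_mkcond [in RHS]big_mkcond /=.
    have nilU : ([::] : seq 'I_s) \in upto N.+1 by rewrite mem_upto.
    rewrite (bigD1_seq [::]) ?uniq_upto //= [in RHS](bigD1_seq [::]) ?uniq_upto //=.
    rewrite /term /= /g' eqxx mul1r mulr0 add0r; congr (_ + _); apply: eq_bigr => w wn.
    case: ifP => // nw; rewrite ifN //; apply/eqP => hA.
    have [_] := he w A ar nw wn; rewrite hA subrr cmod0; by rewrite leNgt e0.
  rewrite addrAC [X in _ <= X]addrC; apply: le_trans (cmodD _ _) _; apply: lerD.
    rewrite /g block_fixpoint gsum -mulrBl -rmorphB cmodM cmodX aj cmod_real.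
    have -> : theta / (1 - theta) * (1 - theta ^+ V) - theta / (1 - theta)
      = - (theta / (1 - theta) * theta ^+ V) by ring.
    rewrite normrN ger0_norm; last exact: mulr_ge0.
    by rewrite [X in X <= _]mulrC [X in X <= _]mulrA.
  apply: (sum_term_not_starting_le (hS A1)) => [w nw|]; last by rewrite mulr_ge0 ?divr_ge0.
  rewrite /g'; case: eqP => [_|hA]; first by rewrite cmod0 mulr_ge0 ?divr_ge0.
  apply: hK; apply: he => //; apply/eqP => wn; by rewrite wn in hA.
apply: within_le (within_trans (hW j n.+1 V A ar) limB).
move: q0 hV; set q := theta / (1 - theta) => q0 hV.
have -> : S * (rho a ^+ n.+1 * (K / n.+1%:R)) + rho a ^+ n.+1 * q * theta ^+ V + W * (rho a ^+ n.+1 * theta ^+ V)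
  = S * K * (rho a ^+ n.+1 / n.+1%:R) + (W * rho a ^+ n.+1 + rho a ^+ n.+1 * q) * theta ^+ V by ring.
by rewrite lerD2l.
Qed.

End Extremal.
End FirstLetter.

Lemma inv_sqr_le (R : realType) n : (n.+1%:R ^+ 2)^-1 <= n.+1%:R^-1 :> R.
Proof.
have n1 : 1 <= n.+1%:R :> R by rewrite ler1n.
by rewrite lef_pV2 ?posrE ?exprn_gt0 ?ltr0n // -[X in X <= _]expr1 ler_weXn2l.
Qed.

(** * Assembling the expansions *)

Section Expansion.
Context {R : realType} {s : nat}.
Context (c : 'I_s -> R[i]) (r : 'I_s -> R) (a : 'I_s -> R[i]) (sigma : 'I_s -> R).
Hypothesis cm : is_cmcd c r.
Hypothesis un : forall j, is_uniformizer (c j) (r j) (a j) (sigma j).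
Hypothesis rho_gt0 : 0 < rho a.
Hypothesis summable : Tcal_derivatives_summable a sigma.
Local Notation C := R[i].
Local Notation letter_sum j n z := (fun N => \sum_(w <- upto N)
  term c r a sigma (pullback c r a sigma j (fun x : C => x ^+ n)) z w).
Implicit Types (p : {poly C}) (z : C) (j k : 'I_s).

(** One sum over words is evaluated twice: by iterating the functional equation, and by grouping
    nonempty words by outermost letter, the empty word giving the pure power of z. *)
Lemma orthogonal_expansion : exists2 K, 0 <= K & exists n0, forall n p z (l : 'I_s -> C) B,
  (n0 <= n)%N -> monic_orthogonal (cmcd c r) n.+1 p -> cmod z <= rho a ->
  (forall j, within (letter_sum j n.+1 z) (l j) (B j)) ->
  cmod (p.[z] - (z ^+ n.+1 + \sum_j l j)) <= K * (rho a ^+ n.+1 / n.+1%:R ^+ 2) + \sum_j B j.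
Proof.
have [K K0 [n0 hK]] := orthogonal_within cm un rho_gt0 summable.
exists K => //; exists n0 => n p z l B nn hp zr hl.
have w1 := within_shift (hK n p nn hp z zr).
have w2 := withinD (within_cst0 (z ^+ n.+1)) (within_sum (index_enum 'I_s) hl); rewrite add0r in w2.
apply: (within_unique w1); apply: within_eq w2 => N.
by rewrite -sum_upto_term_split addrC subrK.
Qed.

Lemma expansion_away (Z : set C) : closed Z ->
  Z `<=` closure (disk 0 (rho a)) `\` singular_points a -> forall j,
  exists2 K, 0 <= K & forall n z, Z z ->
    within (letter_sum j n.+1 z)
      (if cmod (a j) == rho a then n.+1%:R^-1 * (a j ^+ n.+2 * F a sigma j n.+1 z) else 0)
      (K * (rho a ^+ n.+1 / n.+1%:R ^+ 2)).
Proof.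
move=> cZ hZ j; have [S S0 hS] := dtau_summable_unit cm un rho_gt0 summable.
have Zr z : Z z -> cmod z <= rho a.
  by move=> /hZ[]; rewrite closure_disk //= subr0.
have [aj|aj] := eqVneq (cmod (a j)) (rho a); last first.
  have [|K K0 hK] := first_letter_contract cm un rho_gt0 S0 hS (j := j).
    by rewrite lt_neqAle aj le_rho.
  by exists K => // n z /Zr; exact: hK.
have nZ : ~ Z (a j) by move=> /hZ[_]; apply; exists j.
(* The distance [e1] from the closed set to a_j serves the empty word, [e2] all the others. *)
have [e1 e10 he1] := closed_away cZ nZ.
have [e2 e20 he2] := cons_away cm un rho_gt0 j.
have e0 : 0 < Num.min e1 e2 by rewrite lt_min e10.
have [K K0 hK] := first_letter_away cm un rho_gt0 S0 hS aj e0.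
exists K => // n z Zz; rewrite mulrA; apply: hK; first exact: Zr.
move=> [|k w] nw.
  by split; [exact: Zr|apply: le_trans (he1 _ Zz); rewrite ge_min lexx].
have [h1 h2] := he2 (k :: w) z (Zr _ Zz) nw isT.
by split=> //; apply: le_trans h2; rewrite ge_min lexx orbT.
Qed.

Lemma expansion_at_center k : cmod (a k) = rho a -> forall j,
  exists2 K, 0 <= K & forall n,
    within (letter_sum j n.+1 (a k))
      (if j == k then (sigma k ^+ 2 / (1 - sigma k ^+ 2))%:C * a k ^+ n.+1 else 0)
      (K * (rho a ^+ n.+1 / n.+1%:R)).
Proof.
move=> ak j; have [S S0 hS] := dtau_summable_unit cm un rho_gt0 summable.
have akr : cmod (a k) <= rho a by rewrite ak.
have [->|jk] := eqVneq j k.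
  exact: (first_letter_fixpoint cm un rho_gt0 S0 hS ak).
have [aj|aj] := eqVneq (cmod (a j)) (rho a); last first.
  have [|K K0 hK] := first_letter_contract cm un rho_gt0 S0 hS (j := j).
    by rewrite lt_neqAle aj le_rho.
  exists K => // n; apply: within_le (hK n (a k) akr).
  by apply: ler_wpM2l => //; apply: ler_wpM2l; [rewrite exprn_ge0 // ltW|exact: inv_sqr_le].
(* For another extremal index j the point a_k lies in the hole k, hence away from a_j already for
   the empty word. *)
have [e1 e10 he1] := other_disk_gap cm un j.
have [e2 e20 he2] := cons_away cm un rho_gt0 j.
have e0 : 0 < Num.min e1 e2 by rewrite lt_min e10.
have [K K0 hK] := first_letter_small cm un rho_gt0 S0 hS aj e0.
exists K => // n; apply: hK => // -[|l w] nw.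
  split=> //; apply: le_trans (_ : e1 <= _); first by rewrite ge_min lexx.
  apply: (he1 k); first by rewrite eq_sym.
  exact: ltW (center_dist_fixpoint (radius_gt0 cm k) (center_radius_lt1 cm k) (un k)).
have [h1 h2] := he2 (l :: w) (a k) akr nw isT.
by split=> //; apply: le_trans h2; rewrite ge_min lexx orbT.
Qed.

End Expansion.

Theorem theorem1p6 (R : realType) (s : nat)
    (c : 'I_s -> R[i]) (r : 'I_s -> R)
    (a : 'I_s -> R[i]) (sigma : 'I_s -> R)
    (P : nat -> {poly R[i]}) :
  is_cmcd c r ->
  (forall j, is_uniformizer (c j) (r j) (a j) (sigma j)) ->
  (forall n, monic_orthogonal (cmcd c r) n (P n)) ->
  Tcal_derivatives_summable a sigma ->
  0 < rho a ->
  (forall K : set R[i], closed K ->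
     K `<=` closure (disk 0 (rho a)) `\` singular_points a ->
     exists M : R, \forall n \near \oo, forall z, K z ->
       cmod ((P n).[z]
             - (z ^+ n
                + n%:R^-1 * \sum_(j < s | cmod (a j) == rho a)
                              a j ^+ n.+1 * F a sigma j n z))
       <= M * (rho a ^+ n / n%:R ^+ 2))
  /\
  (forall j, cmod (a j) = rho a ->
     exists M : R, \forall n \near \oo,
       cmod ((P n).[a j] - a j ^+ n / (1 - sigma j ^+ 2)%:C)
       <= M * (rho a ^+ n / n%:R)).
Proof.
move=> cm un hP summable rho_gt0.
have [K0 K00 [n0 hK0]] := orthogonal_expansion cm un rho_gt0 summable.
have rn n : 0 <= rho a ^+ n by rewrite exprn_ge0 // ltW.
split.
- move=> Z cZ hZ.
  (* One constant per letter, independent of n and z; they are added at the end. *)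
  have [K hK] := choice (fun j => let: ex_intro2 K K1 h := expansion_away cm un rho_gt0 summable cZ hZ j in
    ex_intro (fun K : R => forall n z, Z z -> within _ _ (K * (rho a ^+ n.+1 / n.+1%:R ^+ 2))) K h).
  exists (K0 + \sum_j K j); apply: filterS (nbhs_infty_ge n0.+1) => -[//|n] nn z Zz.
  have zr : cmod z <= rho a by have [] := hZ z Zz; rewrite closure_disk //= subr0.
  have := hK0 n (P n.+1) z _ _ nn (hP n.+1) zr (fun j => hK j n z Zz).
  by rewrite -big_mkcond -mulr_sumr -mulr_suml -mulrDl.
- move=> k ak.
  have [K hK] := choice (fun j => let: ex_intro2 K K1 h := expansion_at_center cm un rho_gt0 summable ak j in
    ex_intro (fun K : R => forall n, within _ _ (K * (rho a ^+ n.+1 / n.+1%:R))) K h).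
  exists (K0 + \sum_j K j); apply: filterS (nbhs_infty_ge n0.+1) => -[//|n] nn.
  have akr : cmod (a k) <= rho a by rewrite ak.
  have := hK0 n (P n.+1) (a k) _ _ nn (hP n.+1) akr (fun j => hK j n).
  rewrite -big_mkcond big_pred1_eq -mulr_suml.
  have t1 : 1 - sigma k ^+ 2 != 0.
    by case/andP: (sigma2_bounds_at un k) => _ h; rewrite subr_eq0 eq_sym lt_eqF.
  (* The empty word contributes 1 and the powers of T_k contribute theta / (1 - theta) with theta =
     sigma_k^2; together they make 1 / (1 - theta). *)
  have -> : a k ^+ n.+1 + (sigma k ^+ 2 / (1 - sigma k ^+ 2))%:C * a k ^+ n.+1
      = a k ^+ n.+1 / (1 - sigma k ^+ 2)%:C.
    have -> : sigma k ^+ 2 / (1 - sigma k ^+ 2) = (1 - sigma k ^+ 2)^-1 - 1 by field.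
    by rewrite rmorphB rmorph1 fmorphV; ring.
  move=> h; apply: le_trans h _; rewrite mulrDl lerD2r; apply: ler_wpM2l => //; apply: ler_wpM2l => //.
  exact: inv_sqr_le.
Qed.
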